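(* Assume the Hardy-Littlewood Conjecture. Let $D=\pm 8 p_1\cdots p_r(q_1\cdots q_s)^2(l_1\cdots l_t)^3$ (so $8\parallel D$), let $\beta$ be a nonzero even integer, let $D=d\bar d$ and the associated quantities be as in the context, and assume that $\bar d$ has some odd prime factor. Put $$A=\frac{(-1)^{r''+t''}}{\tau(\bar d_p\bar d_l)},\qquad B=\frac{2(-1)^{r_1''+r_5''+t_1''+t_5''+s''+\frac{d-1}{2}}}{\tau(\bar d_p\bar d_q\bar d_l)}.$$ (1) If $2\parallel\beta$, with the sign of $\beta$ chosen so that $\beta\equiv2\pmod 8$, then: for $D>0$, $\mathrm{dens}_D(2\beta)=\frac14(1+A-B)$ and $\mathrm{dens}_D(-2\beta)=\frac14(1+A+B)$; for $D<0$, $\mathrm{dens}_D(2\beta)=\frac14(1+A+B)$ and $\mathrm{dens}_D(-2\beta)=\frac14(1+A-B)$. (2) If $4\mid\beta$, then $\mathrm{dens}_D(2\beta)=\mathrm{dens}_D(-2\beta)=\frac14(1-A)$.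
   Context: In $D=\pm 8 p_1\cdots p_r(q_1\cdots q_s)^2(l_1\cdots l_t)^3$, $r,s,t\ge0$ and the $p_i,q_i,l_i$ are pairwise distinct odd primes. Write $D=d\bar d$ with $\gcd(d,\bar d)=1$, $d>0$ odd, every prime factor of $d$ dividing $\beta$, and no odd prime factor of $\bar d$ dividing $\beta$. Write $\bar d=\pm8\,\bar d_p\bar d_q^2\bar d_l^3$ with $\bar d_p,\bar d_q,\bar d_l$ positive, odd, squarefree and pairwise coprime. $r'',s'',t''$ are the numbers of prime factors of $\bar d_p,\bar d_q,\bar d_l$ respectively; $r_i'',t_i''$ are the numbers of prime factors congruent to $i$ mod $8$ of $\bar d_p,\bar d_l$ respectively. On odd squarefree positive integers, $\tau(n)=\prod_{l\mid n}\tau(l)$ with $\tau(l)=l$ if $l\equiv3\pmod4$, $\tau(l)=l-2$ if $l\equiv1\pmod4$, and $\tau(1)=1$. $2^k\parallel n$ means $2^k\mid n$ and $2^{k+1}\nmid n$. For a nonzero integer $D$, $E_D$ is the elliptic curve $y^2=x^3+Dx$, and for a prime $p\nmid 2D$, $a_p(E_D)=1+p-\#\tilde E_D(\mathbb{F}_p)$. For a nonzero integer $m$ put $Q(m,N)=\{p \text{ prime}: p=m^2+x^2\le N \text{ for some } x\in\mathbb{Z}\}$ and $$\mathrm{dens}_D(2m)=\lim_{N\to\infty}\frac{\#\{p\in Q(m,N): p\nmid 2D,\ a_p(E_D)=2m\}}{\#Q(m,N)}$$ (denoted $a_p(2m)$ in the paper); the claim includes that the limits exist. Hardy-Littlewood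 Conjecture: for all integers $a,b,c$ with $a>0$, $\gcd(a,b,c)=1$, $a+b$ and $c$ not both even, and $\Delta=b^2-4ac$ not a perfect square, the number $P(n)$ of primes less than $n$ of the form $ax^2+bx+c$ (with $x$ a nonnegative integer) satisfies $P(n)\sim\delta(a,b,c)\frac{\sqrt{n}}{\log n}$ as $n\to\infty$, where $$\delta(a,b,c)=\frac{\gcd(2,a+b)}{\sqrt{a}}\prod_{p\mid a,\ p\mid b,\ p>2}\frac{p}{p-1}\ \prod_{p\nmid a,\ p>2}\left(1-\frac{\left(\frac{\Delta}{p}\right)}{p-1}\right),$$ the products being over primes (the second taken in increasing order of $p$) and $\left(\frac{\cdot}{p}\right)$ being the Legendre symbol. *)

(* Defs.v *)
From HB Require Import structures.
From mathcomp Require Import all_boot all_order all_algebra.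
From mathcomp Require Import all_classical all_reals all_analysis.
Set Implicit Arguments.
Unset Strict Implicit.
Unset Printing Implicit Defensive.
Import Order.TTheory GRing.Theory Num.Theory.
Import numFieldNormedType.Exports.
Local Open Scope classical_set_scope.
Local Open Scope ring_scope.

Definition squarefree (n : nat) : Prop := forall k : nat, (k ^ 2 %| n)%N -> k = 1%N.

(* 2^k || n *)
Definition two_exactly (k : nat) (n : int) : bool :=
  ((2 ^ k)%N%:Z %| n)%Z && ~~ ((2 ^ k.+1)%N%:Z %| n)%Z.

(* D = +-8 P Q^2 L^3 *)
Definition eight_form (D : int) (P Q L : nat) : Prop :=
  D = 8 * P%:Z * Q%:Z ^+ 2 * L%:Z ^+ 3 \/ D = - (8 * P%:Z * Q%:Z ^+ 2 * L%:Z ^+ 3).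

Definition omega (n : nat) : nat := size (primes n).

Definition omega_mod8 (i n : nat) : nat := count (fun l => l %% 8 == i)%N (primes n).

(* Only meant for odd squarefree n, so that l - 2 is never truncated. *)
Definition tau (n : nat) : nat :=
  (\prod_(l <- primes n) (if l %% 4 == 3 then l else l - 2))%N.

Definition term_A (R : realType) (dp dl : nat) : R :=
  (-1) ^+ (omega dp + omega dl) / (tau (dp * dl))%:R.

Definition term_B (R : realType) (d dp dq dl : nat) : R :=
  2 * (-1) ^+ (omega_mod8 1 dp + omega_mod8 5 dp + omega_mod8 1 dl + omega_mod8 5 dl
               + omega dq + (d - 1) %/ 2)
  / (tau (dp * dq * dl))%:R.

(* The successor counts the point at infinity of y^2 = x^3 + D x. *)
Definition card_E (D : int) (p : nat) : nat :=
  #|[pred P : 'F_p * 'F_p | P.2 ^+ 2 == P.1 ^+ 3 + D%:~R * P.1]|.+1.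

Definition a_ (p : nat) (D : int) : int := 1 + p%:Z - (card_E D p)%:Z.

Definition in_Q (m : int) (p : nat) : bool :=
  prime p && `[< exists x : int, p%:Z = m ^+ 2 + x ^+ 2 >].

Definition card_Q (m : int) (N : nat) : nat := #|[pred p : 'I_N.+1 | in_Q m p]|.

Definition card_Q_trace (D m : int) (N : nat) : nat :=
  #|[pred p : 'I_N.+1 | [&& in_Q m p, ~~ (p%:Z %| 2 * D)%Z & a_ p D == 2 * m]]|.

(* dens_D(2m) exists and equals v *)
Definition has_dens (R : realType) (D m : int) (v : R) : Prop :=
  (fun N : nat => (card_Q_trace D m N)%:R / (card_Q m N)%:R : R) @ \oo --> v.

Definition legendre (a : int) (p : nat) : int :=
  if (p%:Z %| a)%Z then 0
  else if [exists x : 'F_p, x ^+ 2 == a%:~R] then 1 else -1.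

Definition HL_count (a b c : int) (n : nat) : nat :=
  #|[pred p : 'I_n | prime p &&
      `[< exists x : nat, (p : nat)%:Z = a * x%:Z ^+ 2 + b * x%:Z + c >]]|.

(* The infinite product converges (conditionally) for every non-square
   discriminant, so the limit below is never the default value of lim. *)
Definition HL_delta (R : realType) (a b c : int) : R :=
  (gcdz 2 (a + b))%:~R / Num.sqrt a%:~R
  * (\prod_(p <- primes `|a|%N | (2 < p)%N && (p%:Z %| b)%Z) (p%:R / (p%:R - 1)))
  * lim ((fun n : nat =>
       \prod_(0 <= p < n | [&& prime p, (2 < p)%N & ~~ (p%:Z %| a)%Z])
         (1 - (legendre (b ^+ 2 - 4 * a * c) p)%:~R / (p%:R - 1)) : R) @ \oo).

Definition Hardy_Littlewood (R : realType) : Prop :=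
  forall a b c : int,
    0 < a ->
    gcdz a (gcdz b c) = 1 ->
    ~~ ((2 %| a + b)%Z && (2 %| c)%Z) ->
    (~ exists k : int, b ^+ 2 - 4 * a * c = k ^+ 2) ->
    (fun n : nat => (HL_count a b c n)%:R : R^o) ~_\oo
    (fun n : nat => HL_delta R a b c * (Num.sqrt n%:R / ln n%:R) : R^o).

(* Main.v *)
Require Import Defs.
From HB Require Import structures.
From mathcomp Require Import all_boot all_order all_algebra all_field.
From mathcomp Require Import all_classical all_reals all_analysis.
From mathcomp Require Import ring lra zify.
Import Order.TTheory GRing.Theory Num.Theory.
Import numFieldNormedType.Exports.
Local Open Scope ring_scope.

(** Let b stand for beta, an even integer, and let p = x^2 + b^2 be prime.

    The trace.  Let chi be a quartic character mod p and J = J(chi, chi^2) its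
    Jacobi sum with the quadratic character.  Counting points of
    y^2 = x^3 + D x with quadratic characters and substituting s = x^2 gives
    a_p(E_D) = - 2 Re (chi(- D)^-1 J) ([trace_quartic_log]).  Here J is a
    Gaussian integer of norm p with J = -1 mod (2 + 2i) ([jacobi_re_im_norm],
    [jacobi_congruence]), so by uniqueness of the two squares representation,
    and after conjugating chi if needed, - J = a + b i with a = x or - x,
    a + b = 1 mod 4 ([normalized_root]).  Hence a_p = 2 b if and only if
    chi(- D) = i, and a_p = - 2 b if and only if chi(- D) = - i.

    Reciprocity.  For an odd prime q <> p put q* = q or - q, q* = 1 mod 4.  In a
    field of characteristic q, the q-th power of the Gauss sum g of chi is
    computed once by Frobenius and once from g^4 = J^3 conj(J).  Comparing the
    two shows that the value of chi at q* is
    ((a + b i)/(a - b i))^((q* - 1)/4) mod q ([quartic_reciprocity]), a function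
    of a mod q, which is 1 for q dividing b.  The values chi(-1) and chi(2)
    depend on b mod 8 only ([quartic_log_N1], [quartic_log_2]); the second
    follows from (a + b)^2 = 2 a b mod p by applying reciprocity to the prime
    factors of a and a + b.  So whether a_p = 2 b depends on x modulo
    m = 4 prod q only, q running over the odd primes dividing dbar
    ([quartic_log_ND], [trace_class]).

    Counting.  For fixed q not dividing b, each of the four values of the
    symbol is taken by n residues a mod q, except that the value 1 is taken by
    n - 1 of them, where 4 n - 1 = tau(q) ([torus_log_count]).  The
    Chinese remainder theorem then gives the number of classes mod m with a
    given value of chi(- D) ([class_log_count_formula]): it is the inverse
    Fourier transform on Z/4 of products of local sums, all equal to -1 or
    tau(q), whence A and B.

    Analysis.  A class c mod m with c^2 + b^2 prime to m consists of the primes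
    (m y + c)^2 + b^2, y >= 0, and the Hardy-Littlewood constant of this
    polynomial does not depend on c ([class_constant]).  It is nonzero, because
    its infinite product agrees up to finitely many factors with that of
    x^2 + 1, and the latter is nonzero since x^2 + 1 represents the prime 2
    ([HL_base]).  So all these classes have the same density
    ([density_classes]), and the required densities are quotients of numbers of
    classes ([has_dens_class]). *)

Set Implicit Arguments.
Unset Strict Implicit.

(** * Fourth roots of unity *)

Section Lg.
Variables (K : fieldType) (i : K).
Hypothesis i2 : i ^+ 2 = -1.
Hypothesis two0 : 2%:R != 0 :> K.

(** A discrete logarithm to base [i]; its value is meaningful on fourth roots of unity. *)
Definition log4 (z : K) : 'Z_4 :=
  if z == 1 then 0 else if z == i then 1 else if z == -1 then 2%:R else 3%:R.

Lemma N1_neq1 : (-1 == 1 :> K) = false.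
Proof. by apply/negbTE; rewrite eq_sym -subr_eq0 opprK. Qed.

Lemma expi_mod4 n : i ^+ n = i ^+ (n %% 4).
Proof.
rewrite {1}(divn_eq n 4) exprD mulnC exprM.
have -> : i ^+ 4 = 1 by rewrite (_ : 4 = 2 * 2)%N // exprM i2 sqrrN expr1n.
by rewrite expr1n mul1r.
Qed.

Lemma sqrtN1_neq0 : i != 0.
Proof. by apply/eqP => i1; move: i2; rewrite i1 expr0n /= => /eqP;
  rewrite eq_sym oppr_eq0 oner_eq0. Qed.

Lemma log4_exp n : log4 (i ^+ n) = n%:R.
Proof.
have i_neq1 : (i == 1) = false.
  apply/eqP => i1; move: i2; rewrite i1 expr1n => /esym/eqP.
  by rewrite N1_neq1.
have Ni_neq1 : (- i == 1) = false.
  apply/eqP => i1; move: i2; rewrite -sqrrN i1 expr1n => /esym/eqP.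
  by rewrite N1_neq1.
have Nii : (- i == i) = false.
  apply/negbTE; rewrite eq_sym -addr_eq0 -mulr2n -mulr_natl.
  by rewrite mulf_neq0 // sqrtN1_neq0.
have -> : n%:R = (n %% 4)%:R :> 'Z_4 by rewrite Zp_nat_mod.
rewrite expi_mod4; have : (n %% 4 < 4)%N by rewrite ltn_mod.
case: (n %% 4)%N => [|[|[|[|//]]]] _; rewrite /log4 ?expr0 ?expr1 ?i2 ?eqxx ?N1_neq1 ?i_neq1 //.
  case: eqP => // ii; move: i2; rewrite -ii sqrrN expr1n => /esym/eqP.
  by rewrite N1_neq1.
rewrite exprS i2 mulrN1 Ni_neq1 Nii.
by rewrite eqr_opp i_neq1.
Qed.

(** Exponents live in Z/4, so that logarithms are additive without reductions mod 4. *)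
Definition ipow (k : 'Z_4) : K := i ^+ k.
Arguments ipow : simpl never.

Lemma ipowK k : log4 (ipow k) = k.
Proof. by rewrite log4_exp natr_Zp. Qed.

Lemma ipow0 : ipow 0 = 1. Proof. by []. Qed.

Lemma ipow_nat n : ipow n%:R = i ^+ n.
Proof. by rewrite /ipow val_Zp_nat // -expi_mod4. Qed.

Lemma log4K z : z ^+ 4 = 1 -> ipow (log4 z) = z.
Proof.
move=> z4; have : (z - 1) * ((z - i) * ((z + 1) * (z + i))) = 0.
  transitivity ((z ^+ 2 - 1) * (z ^+ 2 - i ^+ 2)); first by ring.
  rewrite i2; transitivity (z ^+ 4 - 1); first by ring.
  by rewrite z4 subrr.
move=> /eqP; rewrite !mulf_eq0 !subr_eq0 !addr_eq0.
case/or4P => /eqP ->.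
- by rewrite -(expr0 i) log4_exp ipow_nat.
- by rewrite -{1 2}(expr1 i) log4_exp ipow_nat.
- by rewrite -i2 log4_exp ipow_nat.
- by rewrite (_ : - i = i ^+ 3) ?log4_exp ?ipow_nat // exprS i2 mulrN1.
Qed.

Lemma ipowD a b : ipow (a + b) = ipow a * ipow b.
Proof. by rewrite /ipow -exprD [RHS]expi_mod4. Qed.

Lemma ipowX a n : ipow (a *+ n) = ipow a ^+ n.
Proof.
elim: n => [|n IH]; first by rewrite mulr0n expr0.
by rewrite mulrS ipowD IH exprS.
Qed.

Lemma ipow_inj : injective ipow.
Proof. exact: can_inj ipowK. Qed.

Lemma log4M z w : z ^+ 4 = 1 -> w ^+ 4 = 1 -> log4 (z * w) = log4 z + log4 w.
Proof.
move=> z4 w4; apply: ipow_inj; rewrite ipowD !log4K //.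
by rewrite exprMn z4 w4 mul1r.
Qed.
End Lg.

Definition re4 (k : 'Z_4) : int := if k == 0 then 1 else if k == 2%:R then -1 else 0.

Definition im4 (k : 'Z_4) : int := if k == 1 then 1 else if k == 3%:R then -1 else 0.

Lemma Z4_cases (k : 'Z_4) : [\/ k = 0, k = 1, k = 2%:R | k = 3%:R].
Proof.
case: k => -[|[|[|[|//]]]] Hk; [constructor 1|constructor 2|constructor 3|constructor 4];
  exact: val_inj.
Qed.

Lemma ipow_re_im (K : fieldType) (i : K) (k : 'Z_4) : i ^+ 2 = -1 ->
  ipow i k = (re4 k)%:~R + (im4 k)%:~R * i.
Proof.
move=> i2; case: (Z4_cases k) => ->; rewrite /re4 /im4 /ipow /=.
- by rewrite mul0r addr0.
- by rewrite mul1r add0r.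
- by rewrite i2 mul0r addr0.
- by rewrite exprS i2 mulrN1 add0r mulN1r.
Qed.

(** * Gauss and Jacobi sums of a quartic character *)

Section QuarticLog.
Variables (p : nat) (I : 'F_p).
Hypotheses (p_pr : prime p) (p4 : (p %% 4 = 1)%N) (I2 : I ^+ 2 = -1).

Lemma Fp_two0 : 2%:R != 0 :> 'F_p.
Proof.
rewrite -(dvdn_pcharf (pchar_Fp p_pr)) dvdn_prime2 //.
by apply/eqP => pp; move: p4; rewrite pp.
Qed.

Lemma card_quarter : p = (4 * (p %/ 4)).+1.
Proof. by rewrite {1}(divn_eq p 4) p4 addn1 mulnC. Qed.

Lemma quarter_gt0 : (0 < p %/ 4)%N.
Proof. have := prime_gt1 p_pr; rewrite {1}card_quarter; lia. Qed.

Lemma Fp_fermat (t : 'F_p) : t != 0 -> t ^+ (4 * (p %/ 4)) = 1.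
Proof.
move=> t0; apply: (mulfI t0); rewrite mulr1 -exprS -card_quarter.
by rewrite -[X in _ ^+ X](card_Fp p_pr) expf_card.
Qed.

(** The exponent (p - 1)/4 maps the units mod p onto the fourth roots of unity, here
    identified with Z/4 through [I].  Working with exponents instead of roots of
    unity allows one symbol to be compared across fields of different characteristics. *)
Definition quartic_log (t : 'F_p) : 'Z_4 := log4 I (t ^+ (p %/ 4)).

Lemma quartic_log_exp (t : 'F_p) : t != 0 -> ipow I (quartic_log t) = t ^+ (p %/ 4).
Proof. by move=> t0; rewrite /quartic_log log4K // ?Fp_two0 // -exprM mulnC Fp_fermat. Qed.

Lemma quartic_logM (s t : 'F_p) : s != 0 -> t != 0 ->
  quartic_log (s * t) = quartic_log s + quartic_log t.
Proof.
move=> s0 t0; rewrite /quartic_log exprMn log4M // ?Fp_two0 // -exprM mulnC Fp_fermat //.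
Qed.

Lemma quartic_log1 : quartic_log 1 = 0.
Proof. by rewrite /quartic_log expr1n /log4 eqxx. Qed.

Lemma quartic_logX (t : 'F_p) n : t != 0 -> quartic_log (t ^+ n) = quartic_log t *+ n.
Proof.
move=> t0; elim: n => [|n IH]; first by rewrite expr0 quartic_log1.
by rewrite exprS quartic_logM ?expf_neq0 // IH mulrS.
Qed.

Lemma quartic_logV (t : 'F_p) : t != 0 -> quartic_log t^-1 = - quartic_log t.
Proof.
move=> t0; apply/eqP; rewrite -addr_eq0 -quartic_logM ?invr_eq0 // mulVf // quartic_log1 //.
Qed.

Lemma quartic_log_root : quartic_log I = (p %/ 4)%:R.
Proof. by rewrite /quartic_log log4_exp ?Fp_two0. Qed.

(** Otherwise t^((p-1)/2) = 1 would have p - 1 roots. *)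
Lemma quartic_log_onto : exists2 t : 'F_p, t != 0 & quartic_log t = 1.
Proof.
have [t t0 Ht] : exists2 t : 'F_p, t != 0 & t ^+ (2 * (p %/ 4)) != 1.
  apply/exists_inP; rewrite -negb_forall_in; apply/negP => /forall_inP H.
  pose P : {poly 'F_p} := 'X^(2 * (p %/ 4)) - 1.
  have q0 := quarter_gt0.
  have sP : size P = (2 * (p %/ 4)).+1 by rewrite size_XnsubC // muln_gt0.
  have : (size (rem 0%R (enum 'F_p)) < size P)%N.
    apply: max_poly_roots.
    - by rewrite -size_poly_eq0 sP.
    - apply/allP => t; rewrite mem_rem_uniq ?enum_uniq // inE => /andP[t0 _].
      have := H t t0; rewrite /root /P !hornerE => /eqP ->.
      by rewrite subrr.
    - by rewrite rem_uniq // enum_uniq.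
  rewrite size_rem ?mem_enum // -cardE card_Fp // sP; have := card_quarter.
  move: (p %/ 4)%N q0 => w w0 ->; lia.
have : quartic_log t = 1 \/ quartic_log t = 3%:R.
  have e : t ^+ (2 * (p %/ 4)) = ipow I (quartic_log t *+ 2) by rewrite ipowX //
    quartic_log_exp // -exprM mulnC.
  case: (Z4_cases (quartic_log t)) => E; [|by left| |by right]; exfalso; move/eqP: Ht; apply;
    rewrite e E //.
case=> E; first by exists t.
have tV : t^-1 != 0 by rewrite invr_eq0.
by exists t^-1; rewrite // quartic_logV // E; apply: val_inj.
Qed.

Section Chi.
Variables (K : fieldType) (i : K).
Hypotheses (i2 : i ^+ 2 = -1) (two0 : 2%:R != 0 :> K).

(** The field is arbitrary because the character is used both with algebraic numbers and
    with elements of a field of characteristic q as values. *)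
Definition chi (j : 'Z_4) (t : 'F_p) : K := if t == 0 then 0 else ipow i (j * quartic_log t).

Lemma chi0 j : chi j 0 = 0. Proof. by rewrite /chi eqxx. Qed.

Lemma chi1 j : chi j 1 = 1. Proof. by rewrite /chi oner_eq0 quartic_log1 mulr0. Qed.

Lemma chiM j s t : chi j (s * t) = chi j s * chi j t.
Proof.
rewrite /chi mulf_eq0; case: eqP => [|/eqP s0]; first by rewrite mul0r.
case: eqP => [|/eqP t0] /=; first by rewrite mulr0.
by rewrite quartic_logM // mulrDr ipowD.
Qed.

Lemma chiD i' j t : t != 0 -> chi (i' + j) t = chi i' t * chi j t.
Proof. by move=> t0; rewrite /chi (negbTE t0) mulrDl ipowD. Qed.

Lemma chi_neq0 j t : t != 0 -> chi j t != 0.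
Proof. by move=> t0; rewrite /chi (negbTE t0) expf_neq0 // (sqrtN1_neq0 i2). Qed.

Lemma chiN j t : t != 0 -> chi (- j) t = (chi j t)^-1.
Proof.
move=> t0; apply: (mulfI (chi_neq0 j t0)); rewrite mulfV ?chi_neq0 // -chiD //.
by rewrite subrr /chi (negbTE t0) mul0r.
Qed.

Lemma chiV j t : t != 0 -> chi j t^-1 = (chi j t)^-1.
Proof.
move=> t0; apply: (mulfI (chi_neq0 j t0)).
by rewrite mulfV ?chi_neq0 // -chiM mulfV // chi1.
Qed.

Lemma chi_sum0 j : j != 0 -> \sum_t chi j t = 0.
Proof.
move=> j0; have [g g0 kg] := quartic_log_onto.
have cg : chi j g != 1.
  rewrite /chi (negbTE g0) kg mulr1; apply/eqP => H.
  by case/eqP: j0; apply: (ipow_inj i2 two0); rewrite H.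
have : \sum_t chi j t = chi j g * \sum_t chi j t.
  rewrite mulr_sumr (reindex_inj (mulfI g0)) /=.
  by apply: eq_bigr => t _; rewrite chiM.
move/eqP; rewrite -subr_eq0 -{1}[X in X - _]mul1r -mulrBl mulf_eq0 subr_eq0 eq_sym.
by rewrite (negbTE cg) /= => /eqP.
Qed.

Definition jacobi (a b : 'Z_4) : K := \sum_t chi a t * chi b (1 - t).

Lemma chi_convolution a b n : n != 0 ->
  \sum_s chi a s * chi b (n - s) = chi (a + b) n * jacobi a b.
Proof.
move=> n0; rewrite /jacobi mulr_sumr (reindex_inj (mulfI n0)) /=.
apply: eq_bigr => t _.
have -> : n - n * t = n * (1 - t) by rewrite mulrBr mulr1.
rewrite (chiM a n t).
rewrite (chiM b n (1 - t)).
rewrite (chiD a b n0).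
by rewrite mulrACA.
Qed.

Lemma chi_convolution0 a b :
  \sum_s chi a s * chi b (0 - s) = chi b (-1) * \sum_(s | s != 0) chi (a + b) s.
Proof.
rewrite mulr_sumr.
rewrite (bigD1 0) //=.
rewrite (chi0 a).
rewrite mul0r add0r; apply: eq_bigr => s s0.
have -> : 0 - s = -1 * s by rewrite sub0r mulN1r.
rewrite chiD // (chiM b); exact: mulrCA.
Qed.

Section Gauss.
Variable z : K.
Hypotheses (zp : z ^+ p = 1) (z1 : z != 1).

Definition zpow (t : 'F_p) : K := z ^+ t.
Arguments zpow : simpl never.

Lemma zpow0 : zpow 0 = 1. Proof. by []. Qed.

Definition gauss_sum (j : 'Z_4) : K := \sum_t chi j t * zpow t.

Lemma zpowD (s t : 'F_p) : zpow (s + t) = zpow s * zpow t.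
Proof.
by rewrite /zpow -exprD /= [X in (_ %% X)%N](Fp_cast p_pr) expr_mod.
Qed.

Lemma zpowM (s t : 'F_p) : zpow (s * t) = zpow s ^+ t.
Proof.
by rewrite /zpow -exprM /= [X in (_ %% X)%N](Fp_cast p_pr) expr_mod.
Qed.

Lemma zpow_sum0 : \sum_(t : 'F_p) zpow t = 0.
Proof.
have : \sum_(t : 'F_p) zpow t = z * \sum_(t : 'F_p) zpow t.
  rewrite mulr_sumr (reindex_inj (addrI 1)) /=.
  by apply: eq_bigr => t _; rewrite zpowD.
move/eqP; rewrite -subr_eq0 -{1}[X in X - _]mul1r -mulrBl mulf_eq0 subr_eq0 eq_sym.
by rewrite (negbTE z1) /= => /eqP.
Qed.

(** Collect the terms of the double sum by the value n of the sum of the two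
    arguments: for n <> 0 scaling gives a Jacobi sum, and the terms with n = 0 cancel. *)
Lemma gauss_sumM a b : a + b != 0 -> gauss_sum a * gauss_sum b = jacobi a b * gauss_sum (a + b).
Proof.
move=> ab0; rewrite /gauss_sum mulr_suml.
transitivity (\sum_n zpow n * \sum_s chi a s * chi b (n - s)).
  under [RHS]eq_bigr => n _ do rewrite mulr_sumr.
  rewrite exchange_big /=; apply: eq_bigr => s _.
  rewrite mulr_sumr (reindex_inj (addIr (- s))) /=; apply: eq_bigr => n _.
  have -> : zpow n = zpow s * zpow (n - s) by rewrite -zpowD addrC subrK.
  by rewrite mulrACA [RHS]mulrC.
rewrite (bigD1 0) //= chi_convolution0.
have -> : \sum_(s | s != 0) chi (a + b) s = 0.
  rewrite -[RHS](chi_sum0 ab0) [RHS](bigD1 0) //= chi0 add0r //.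
rewrite mulr0 mulr0 add0r mulr_sumr [RHS](bigD1 0) //= (chi0 (a + b)) mul0r mulr0 add0r.
by apply: eq_bigr => n n0; rewrite chi_convolution // mulrC mulrAC mulrC mulrA [jacobi _ _ *
  _]mulrC.
Qed.

(** The map t |-> t / (1 - t) turns the sum into the sum of [chi a] over w <> -1. *)
Lemma jacobiN a : a != 0 -> jacobi a (- a) = - chi a (-1).
Proof.
move=> a0; rewrite /jacobi (bigD1 1) //= subrr chi0 mulr0 add0r.
transitivity (\sum_(w | w != -1) chi a w); last first.
  apply/eqP; rewrite -addr_eq0 addrC.
  by move: (chi_sum0 a0); rewrite (bigD1 (-1)) //= => ->.
rewrite (reindex_onto (fun w : 'F_p => w / (1 + w)) (fun t => t / (1 - t))) /=; last first.
  move=> t Ht; have H : 1 - t != 0 by rewrite subr_eq0 eq_sym.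
  by field; rewrite H subrK oner_eq0.
have key (w : 'F_p) : w != -1 -> 1 + w != 0 by rewrite addrC addr_eq0.
apply: eq_big => w.
  have [->|Hw] := eqVneq w (-1).
    by rewrite addrN invr0 mulr0 mul0r [0 == -1]eq_sym oppr_eq0 oner_eq0 andbF.
  have H := key _ Hw; apply/andP; split.
    rewrite -subr_eq0 (_ : _ - 1 = - (1 + w)^-1) ?oppr_eq0 ?invr_eq0 //; by field.
  have H1 : 1 + w - w != 0 by rewrite addrK oner_eq0.
  by apply/eqP; field; rewrite H H1.
move=> /andP[_ /eqP Hw].
have [w1|w1] := eqVneq w (-1).
  by move/eqP: Hw; rewrite w1 addrN invr0 mulr0 mul0r eq_sym oppr_eq0 oner_eq0.
have H := key _ w1.
have -> : 1 - w / (1 + w) = (1 + w)^-1 by field.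
rewrite chiN ?invr_eq0 // chiV // invrK -chiM; congr (chi a _); by field.
Qed.

Lemma gauss_sumMN a : a != 0 -> gauss_sum a * gauss_sum (- a) = chi a (-1) * p%:R.
Proof.
move=> a0; rewrite {1}/gauss_sum mulr_suml.
transitivity (\sum_n zpow n * \sum_s chi a s * chi (- a) (n - s)).
  under [RHS]eq_bigr => n _ do rewrite mulr_sumr.
  rewrite exchange_big /=; apply: eq_bigr => s _.
  rewrite mulr_sumr (reindex_inj (addIr (- s))) /=; apply: eq_bigr => n _.
  have -> : zpow n = zpow s * zpow (n - s) by rewrite -zpowD addrC subrK.
  by rewrite mulrACA [RHS]mulrC.
have ap : chi (- a) (-1) = chi a (-1).
  by rewrite chiN -?chiV ?invrN ?invr1 // oppr_eq0 oner_eq0.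
rewrite (bigD1 0) //= chi_convolution0 subrr ap.
have -> : \sum_(s | s != 0) chi 0 s = (p.-1)%:R :> K.
  rewrite (eq_bigr (fun => 1)); last by move=> s s0; rewrite /chi (negbTE s0) mul0r.
  rewrite sumr_const; congr (_%:R).
  transitivity #|predC1 (0 : 'F_p)|; first exact: eq_card.
  by rewrite cardC1 card_Fp.
rewrite (eq_bigr (fun n : 'F_p => - chi a (-1) * zpow n)); last first.
  by move=> n n0; rewrite chi_convolution // subrr jacobiN // /chi (negbTE n0) mul0r ipow0
    mul1r mulrC.
rewrite -mulr_sumr.
have -> : \sum_(n : 'F_p | n != 0) zpow n = -1.
  by apply/eqP; rewrite -addr_eq0 addrC; move: zpow_sum0; rewrite (bigD1 0) //= zpow0 => ->.
have -> : p%:R = p.-1%:R + 1 :> K by rewrite natr1 prednK // prime_gt0.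
by rewrite zpow0; ring.
Qed.

Definition jacobi_chi := jacobi 1 2%:R.

(** The exponents 3 and 2 are opposite to 1 and 2 in Z/4, so this is the conjugate of
    [jacobi_chi]. *)
Definition jacobi_chi_conj := jacobi 3%:R 2%:R.

Lemma gauss_sum_quad : gauss_sum 2%:R ^+ 2 = p%:R.
Proof.
have := gauss_sumMN (a := 2%:R) isT; have -> : - 2%:R = 2%:R :> 'Z_4 by apply: val_inj.
rewrite -expr2 => ->; rewrite -[RHS]mul1r; congr (_ * _).
by rewrite -[2%:R]/(1 + 1) chiD ?oppr_eq0 ?oner_eq0 // -chiM mulrNN mulr1 chi1.
Qed.

(** Multiply g1 g2 = J g3 by g3 g2 = conj(J) g1 and use g2^2 = p. *)
Lemma jacobi_chi_norm : p%:R != 0 :> K -> jacobi_chi * jacobi_chi_conj = p%:R.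
Proof.
move=> p0.
have H1 := gauss_sumM (a := 1) (b := 2%:R) isT.
have H3 := gauss_sumM (a := 3%:R) (b := 2%:R) isT.
have e3 : 1 + 2%:R = 3%:R :> 'Z_4 by apply: val_inj.
have e1 : 3%:R + 2%:R = 1 :> 'Z_4 by apply: val_inj.
have eN : - 1 = 3%:R :> 'Z_4 by apply: val_inj.
have H13 := gauss_sumMN (a := 1) isT.
rewrite e3 in H1; rewrite e1 in H3; rewrite eN in H13.
have n0 : gauss_sum 1 * gauss_sum 3%:R != 0.
  by rewrite H13 mulf_neq0 // chi_neq0 // oppr_eq0 oner_eq0.
apply: (mulfI n0); rewrite -gauss_sum_quad.
transitivity ((jacobi_chi * gauss_sum 3%:R) * (jacobi_chi_conj * gauss_sum 1)); first by ring.
rewrite /jacobi_chi /jacobi_chi_conj -H1 -H3; ring.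
Qed.

(** From g1 g2 = J g3 and g1 g3 = chi(-1) p one gets g1^2 g2 = J chi(-1) p; square. *)
Lemma gauss_sum_pow4 : p%:R != 0 :> K -> gauss_sum 1 ^+ 4 = jacobi_chi ^+ 2 * p%:R.
Proof.
move=> p0.
have H1 := gauss_sumM (a := 1) (b := 2%:R) isT.
have e3 : 1 + 2%:R = 3%:R :> 'Z_4 by apply: val_inj.
have eN : - 1 = 3%:R :> 'Z_4 by apply: val_inj.
have H13 := gauss_sumMN (a := 1) isT.
rewrite e3 in H1; rewrite eN in H13.
apply: (mulfI p0).
transitivity (((gauss_sum 1 * gauss_sum 2%:R) * gauss_sum 1) ^+ 2).
  by rewrite -gauss_sum_quad; ring.
rewrite H1 -mulrA [gauss_sum 3%:R * _]mulrC H13.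
have : chi 1 (-1) ^+ 2 = 1 by rewrite expr2 -chiM mulrNN mulr1 chi1.
move=> c2; transitivity (jacobi 1 2%:R ^+ 2 * (chi 1 (-1) ^+ 2 * p%:R ^+ 2)); first by ring.
rewrite c2 /jacobi_chi; ring.
Qed.

Lemma gauss_sum_twist a (s : 'F_p) : s != 0 ->
  \sum_t chi a t * zpow (s * t) = chi (- a) s * gauss_sum a.
Proof.
move=> s0; rewrite /gauss_sum (reindex_inj (mulfI (x := s^-1) _)) /= ?invr_eq0 // mulr_sumr.
apply: eq_bigr => t _; rewrite mulVKf // chiM chiV // chiN //; ring.
Qed.

End Gauss.
End Chi.
End QuarticLog.

(** * The Jacobi sum as a Gaussian integer and the trace of Frobenius *)

(** A root of 1 + X + ... + X^(p-1) is a root of unity different from 1 because this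
    polynomial takes the value p at 1. *)
Lemma root_unity_exists (K : closedFieldType) p : prime p -> p%:R != 0 :> K ->
  exists2 z : K, z ^+ p = 1 & z != 1.
Proof.
move=> p_pr p0.
pose P : {poly K} := \poly_(i < p) 1.
have sP : size P = p by rewrite size_poly_eq // oner_eq0.
have [z Hz] : exists z, root P z.
  by apply/closed_rootP; rewrite sP; have := prime_gt1 p_pr; case: p {p_pr p0 P sP} => [|[]].
have E : P.[z] = \sum_(i < p) z ^+ i.
  by rewrite horner_poly; apply: eq_bigr => i _; rewrite mul1r.
move/rootP: Hz; rewrite E => H.
exists z; first by apply/eqP; rewrite -subr_eq0 subrX1 H mulr0.
apply: contraNneq p0 => z1; move: H; rewrite z1.
under eq_bigr do rewrite expr1n.
by rewrite sumr_const card_ord => ->.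
Qed.

Lemma algCi_inj (a b c d : int) :
  a%:~R + b%:~R * 'i = c%:~R + d%:~R * 'i :> algC -> a = c /\ b = d.
Proof.
move=> /eqP; rewrite -subr_eq0 => /eqP H.
have : (a - c)%:~R + (b - d)%:~R * 'i = 0 :> algC by rewrite -H !rmorphB /=; ring.
move/eqP; rewrite addr_eq0 => /eqP H1.
have : ((a - c) ^+ 2)%:~R = (- (b - d) ^+ 2)%:~R :> algC.
  by rewrite rmorphXn /= H1 sqrrN exprMn sqrCi rmorphN rmorphXn /= mulrN1.
move/eqP; rewrite eqr_int => /eqP H2; split; nia.
Qed.

Section Jacobi.
Variables (p : nat) (I : 'F_p).
Hypotheses (p_pr : prime p) (p4 : (p %% 4 = 1)%N) (I2 : I ^+ 2 = -1).
Local Notation quartic_log := (quartic_log I).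

Definition jacobi_log (t : 'F_p) : 'Z_4 := quartic_log t + quartic_log (1 - t) *+ 2.

(** The coordinates of the Jacobi sum, as integers independent of the field in which
    the character takes its values.  The terms t = 0 and t = 1 vanish in the sum. *)
Definition jacobi_re : int := \sum_(t : 'F_p | (t != 0) && (t != 1)) re4 (jacobi_log t).

Definition jacobi_im : int := \sum_(t : 'F_p | (t != 0) && (t != 1)) im4 (jacobi_log t).
Definition quad_char (s : 'F_p) : int := if s == 0 then 0 else re4 (quartic_log s *+ 2).

Section InField.
Variables (K : fieldType) (i : K).
Hypotheses (i2 : i ^+ 2 = -1).

Lemma chi_quadE s : chi I i 2%:R s = (quad_char s)%:~R.
Proof.
rewrite /chi /quad_char; case: eqP => // _; rewrite mulr_natl ipow_re_im //.
by case: (Z4_cases (quartic_log s)) => ->; rewrite /= mul0r addr0.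
Qed.

Lemma jacobi_quadE a : jacobi I i a 2%:R =
  \sum_(t : 'F_p | (t != 0) && (t != 1)) ipow i (a * quartic_log t + quartic_log (1 - t) *+ 2).
Proof.
rewrite /jacobi [RHS]big_mkcond; apply: eq_bigr => t _.
rewrite /chi; case: eqP => [|_] /=; first by rewrite mul0r.
rewrite subr_eq0 eq_sym; case: eqP => [|_] /=; first by rewrite mulr0.
by rewrite mulr_natl [RHS](ipowD i2).
Qed.

Lemma jacobi_chiE : jacobi_chi I i = jacobi_re%:~R + jacobi_im%:~R * i.
Proof.
rewrite /jacobi_chi jacobi_quadE /jacobi_re /jacobi_im !rmorph_sum /= mulr_suml -big_split /=.
by apply: eq_bigr => t _; rewrite mul1r -ipow_re_im.
Qed.

Lemma jacobi_chi_conjE : jacobi_chi_conj I i = jacobi_re%:~R - jacobi_im%:~R * i.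
Proof.
rewrite /jacobi_chi_conj jacobi_quadE /jacobi_re /jacobi_im !rmorph_sum /= mulr_suml -sumrB /=.
apply: eq_bigr => t _.
have -> : 3%:R * quartic_log t + quartic_log (1 - t) *+ 2 = - jacobi_log t.
  by rewrite /jacobi_log; case: (Z4_cases (quartic_log t)) => ->;
    case: (Z4_cases (quartic_log (1 - t))) => ->; apply: val_inj.
rewrite ipow_re_im //.
by case: (Z4_cases (jacobi_log t)) => -> /=; rewrite ?mulNr ?opprK ?mul0r ?oppr0.
Qed.
End InField.

Lemma algC_two0 : 2%:R != 0 :> algC. Proof. by rewrite pnatr_eq0. Qed.
Let two0 := algC_two0.

(** The identity J conj(J) = p is read off in the algebraic numbers, where it is an
    identity between integers. *)
Lemma jacobi_re_im_norm : jacobi_re ^+ 2 + jacobi_im ^+ 2 = p%:Z.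
Proof.
have p0 : p%:R != 0 :> algC by rewrite pnatr_eq0 -lt0n prime_gt0.
have [z zp z1] := root_unity_exists p_pr p0.
have := jacobi_chi_norm p_pr p4 I2 (sqrCi algC) two0 zp z1 p0.
rewrite (jacobi_chiE (sqrCi algC)) (jacobi_chi_conjE (sqrCi algC)) => H.
have : (jacobi_re ^+ 2 + jacobi_im ^+ 2)%:~R = (p%:Z)%:~R :> algC.
  rewrite -[RHS]H rmorphD !rmorphXn /=.
  transitivity (jacobi_re%:~R ^+ 2 - jacobi_im%:~R ^+ 2 * 'i ^+ 2 : algC); last by ring.
  by rewrite sqrCi mulrN1 opprK.
by move/eqP; rewrite eqr_int => /eqP.
Qed.

Lemma quad_char_sum0 : \sum_s quad_char s = 0.
Proof.
have := chi_sum0 p_pr p4 I2 (sqrCi algC) two0 (j := 2%:R) isT.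
under eq_bigr do rewrite (chi_quadE (sqrCi algC)).
by rewrite -rmorph_sum /= => /eqP; rewrite intr_eq0 => /eqP.
Qed.

Lemma quad_char_sqr (y : 'F_p) : y != 0 -> quad_char (y ^+ 2) = 1.
Proof.
move=> y0; rewrite /quad_char expf_eq0 (negbTE y0) /= (quartic_logX p_pr) //.
by case: (Z4_cases (quartic_log y)) => ->.
Qed.

Lemma quad_char_ge s : 0 <= 1 + quad_char s.
Proof.
by rewrite /quad_char; case: eqP => // _; case: (Z4_cases (quartic_log s)) => ->.
Qed.

(** The inequality <= is clear for each s, and both sides have sum p. *)
Lemma card_sqrt (s : 'F_p) : #|[pred y : 'F_p | y ^+ 2 == s]|%:Z = 1 + quad_char s.
Proof.
pose n (s : 'F_p) := #|[pred y : 'F_p | y ^+ 2 == s]|.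
have le s' : 0 <= 1 + quad_char s' - (n s')%:Z.
  rewrite subr_ge0 /n.
  have [E|] := posnP #|[pred y : 'F_p | y ^+ 2 == s']|; first by rewrite E quad_char_ge.
  rewrite lt0n => /pred0Pn [y /= /eqP ys].
  have [y0|y0] := eqVneq y 0.
    have -> : s' = 0 by rewrite -ys y0 expr0n.
    rewrite /quad_char eqxx addr0 lez_nat -[X in (_ <= X)%N](card1 (0 : 'F_p)).
    apply: subset_leq_card; apply/fintype.subsetP => w; rewrite !inE.
    by rewrite sqrf_eq0.
  rewrite -ys quad_char_sqr // lez_nat -[X in (_ <= X)%N]/2%N.
  have : (#|[set y; - y]| <= 2)%N by rewrite cards2; case: (_ != _).
  apply: leq_trans; apply: subset_leq_card; apply/fintype.subsetP => w; rewrite !inE.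
  by rewrite eqf_sqr.
have tot : \sum_s' (1 + quad_char s' - (n s')%:Z) = 0.
  rewrite sumrB big_split /= quad_char_sum0 addr0 sumr_const.
  under [X in _ - X]eq_bigr do rewrite -natz.
  rewrite -natr_sum; apply/eqP; rewrite subr_eq0; apply/eqP; congr (_%:R).
  rewrite -sum1_card (partition_big (fun y : 'F_p => y ^+ 2) xpredT) //=.
  by apply: eq_bigr => s' _; rewrite /n -sum1_card; apply: eq_bigl => y.
have /(_ s isT) := psumr_eq0P (fun s' _ => le s') tot.
by move/eqP; rewrite subr_eq0 => /eqP <-.
Qed.

Lemma sum_over_squares (K : fieldType) (f : 'F_p -> K) :
  \sum_x f (x ^+ 2) = \sum_s (1 + (quad_char s)%:~R) * f s.
Proof.
rewrite (partition_big (fun y : 'F_p => y ^+ 2) xpredT) //=.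
apply: eq_bigr => s _; rewrite (eq_bigr (fun => f s)); last by move=> y /eqP ->.
have -> : 1 + (quad_char s)%:~R = (#|[pred y : 'F_p | y ^+ 2 == s]|%:Z)%:~R :> K.
  by rewrite card_sqrt rmorphD.
by rewrite sumr_const -mulr_natl.
Qed.

Lemma trace_quad_char (D : int) : a_ p D = - \sum_(x : 'F_p) quad_char (x ^+ 3 + D%:~R * x).
Proof.
rewrite /a_ /card_E; pose f (x : 'F_p) := x ^+ 3 + D%:~R * x.
have -> : #|[pred P : 'F_p * 'F_p | P.2 ^+ 2 == P.1 ^+ 3 + D%:~R * P.1]| =
   (\sum_(x : 'F_p) #|[pred y : 'F_p | y ^+ 2 == f x]|)%N.
  rewrite -sum1_card.
  under [RHS]eq_bigr do rewrite -sum1_card.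
  by rewrite pair_big_dep /=; apply: eq_bigl => -[x y].
have -> : (\sum_(x : 'F_p) #|[pred y : 'F_p | y ^+ 2 == f x]|)%N.+1%:Z
   = 1 + (p%:Z + \sum_(x : 'F_p) quad_char (f x)).
  rewrite intS; congr (_ + _).
  rewrite -natz natr_sum; under eq_bigr do rewrite natz card_sqrt.
  by rewrite big_split /= sumr_const card_Fp // natz.
ring.
Qed.

(** Write [chi b (x (x^2 + d))] as [chi a (x^2) * chi b (x^2 + d)] since [a *+ 2 = b]; the sum
    over x becomes a sum over s = x^2 with weight 1 + chi b (s), and s = - d t turns both
    parts into Jacobi sums. *)
Lemma cubic_char_sum (K : fieldType) (i : K) (a b : 'Z_4) (d : 'F_p) :
  i ^+ 2 = -1 -> d != 0 -> a *+ 2 = b -> b *+ 2 = 0 ->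
  (forall s, chi I i b s = (quad_char s)%:~R) ->
  \sum_x chi I i b (x ^+ 3 + d * x) =
  chi I i (a + b) (- d) * jacobi I i a b + chi I i a (- d) * jacobi I i (a + b) b.
Proof.
move=> i2 d0 ab bb Hb; pose c := chi I i.
have dN0 : - d != 0 by rewrite oppr_eq0.
have cN1 : c b (-1) = 1.
  by rewrite /c Hb -I2 quad_char_sqr //; apply: (sqrtN1_neq0 I2).
have cM e s t : c e (s * t) = c e s * c e t by exact: chiM.
have shift e : \sum_s c e s * c b (s + d) = c e (- d) * c b (- d) * jacobi I i e b.
  rewrite /jacobi mulr_sumr (reindex_inj (mulfI dN0)) /=; apply: eq_bigr => t _.
  have -> : - d * t + d = (- d) * ((-1) * (1 - t)).
    by rewrite mulN1r mulrN mulrBr mulr1 opprB mulNr addrC opprK addrC.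
  rewrite (cM e) (cM b) (cM b) cN1 mul1r.
  exact: mulrACA.
transitivity (\sum_x c a (x ^+ 2) * c b (x ^+ 2 + d)).
  apply: eq_bigr => x _.
  have -> : x ^+ 3 + d * x = x * (x ^+ 2 + d) by rewrite mulrDr -exprS [x * d]mulrC.
  have cab : c b x = c a (x ^+ 2).
    rewrite /c /chi sqrf_eq0.
    case: (x =P 0) => [//|/eqP x0].
    by rewrite (quartic_logX p_pr) // -ab mulrnAl mulrnAr.
  rewrite -cab.
  exact: cM.
rewrite (sum_over_squares (fun s => c a s * c b (s + d))).
under eq_bigr do rewrite mulrDl mul1r.
rewrite big_split /= shift.
have -> : \sum_s (quad_char s)%:~R * (c a s * c b (s + d)) = \sum_s c (a + b) s * c b (s + d).
  apply: eq_bigr => s _; rewrite mulrA; congr (_ * _); rewrite -Hb.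
  have [->|s0] := eqVneq s 0; first by rewrite /c !chi0 mul0r.
  by rewrite /c chiD // mulrC.
rewrite shift /c -!chiD // -addrA.
by rewrite -mulr2n bb addr0.
Qed.

(** This is minus twice the real part of chi(- D)^-1 (u + v i), with u + v i the Jacobi sum. *)
Lemma trace_quartic_log (D : int) : D%:~R != 0 :> 'F_p ->
  a_ p D = - (2 * (re4 (quartic_log (- D%:~R)) * jacobi_re +
    im4 (quartic_log (- D%:~R)) * jacobi_im)).
Proof.
move=> D0; rewrite trace_quad_char; congr (- _).
set d : 'F_p := D%:~R in D0 *.
have i2 := sqrCi algC.
have dN0 : - d != 0 by rewrite oppr_eq0.
have e12 : 1 + 2%:R = 3%:R :> 'Z_4 by apply: val_inj.
have b2 : (2%:R : 'Z_4) *+ 2 = 0 by apply: val_inj.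
have := cubic_char_sum (a := 1) i2 D0 (erefl _) b2 (chi_quadE i2).
rewrite e12 -/(jacobi_chi _ _) -/(jacobi_chi_conj _ _).
under eq_bigr do rewrite (chi_quadE i2).
rewrite (jacobi_chiE i2) (jacobi_chi_conjE i2) -rmorph_sum /= /chi (negbTE dN0).
have e3 : ipow 'i (3%:R * quartic_log (- d)) =
  (re4 (quartic_log (- d)))%:~R - (im4 (quartic_log (- d)))%:~R * 'i :> algC.
  rewrite ipow_re_im //.
  by case: (Z4_cases (quartic_log (- d))) => ->; rewrite /= ?mulNr ?opprK ?mul0r ?oppr0.
rewrite e3 mul1r ipow_re_im //.
set S := \sum_x _; set a := re4 _; set b := im4 _ => H.
have : S%:~R = (2 * (a * jacobi_re + b * jacobi_im))%:~R :> algC.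
  rewrite H !rmorphM !rmorphD !rmorphM /=.
  rewrite [RHS](_ : _ = 2 * (a%:~R * jacobi_re%:~R - b%:~R * jacobi_im%:~R * 'i ^+ 2)).
    ring.
  by rewrite i2 mulrN1 opprK.
by move/eqP; rewrite eqr_int => /eqP.
Qed.
End Jacobi.

(** * Normalization of the Jacobi sum *)

Lemma intr_pchar_eq0 (K : nzRingType) (q : nat) (z : int) : q \in [pchar K] ->
  (z%:~R == 0 :> K) = (q%:Z %| z)%Z.
Proof.
move=> qK; rewrite dvdzE /= (dvdn_pcharf qK).
by case: (intP z) => [|n|n]; rewrite ?abszN ?rmorphN ?oppr_eq0 ?absz0.
Qed.

Section Normalize.
Variables (p : nat).
Hypotheses (p_pr : prime p) (p4 : (p %% 4 = 1)%N).

Lemma subr1M (A : comNzRingType) (x y : A) : (x - 1) * (y - 1) = x * y - x - y + 1.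
Proof. ring. Qed.

Lemma jacobi_shift (I : 'F_p) (K : fieldType) (i : K) (a b : 'Z_4) :
  I ^+ 2 = -1 -> i ^+ 2 = -1 -> 2%:R != 0 :> K -> a != 0 -> b != 0 ->
  \sum_(t : 'F_p) (chi I i a t - 1) * (chi I i b (1 - t) - 1) = jacobi I i a b + p%:R.
Proof.
move=> I2 i2 two0 a0 b0; rewrite /jacobi.
have S1 := chi_sum0 p_pr p4 I2 i2 two0 a0.
have S2 : \sum_(t : 'F_p) chi I i b (1 - t) = 0.
  rewrite -[RHS](chi_sum0 p_pr p4 I2 i2 two0 b0).
  by rewrite [RHS](reindex_inj (inv_inj (subKr 1))).
transitivity (\sum_(t : 'F_p) (chi I i a t * chi I i b (1 - t) - chi I i a t - chi I i b (1 -
  t) + 1)).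
  by apply: eq_bigr => t _; apply: subr1M.
by rewrite big_split /= !sumrB S1 S2 !subr0 sumr_const card_Fp.
Qed.

(** This is J = -1 mod (2 + 2i).  In J + p = sum (chi(t) - 1)(rho(1 - t) - 1), with rho the
    quadratic character, the terms t = 0, 1 vanish, and otherwise the first factor is
    a multiple of 1 - i and the second one is 0 or -2; moreover p = 1 mod 4. *)
Lemma jacobi_congruence (I : 'F_p) : I ^+ 2 = -1 ->
  (2 %| jacobi_im I)%Z /\ (4 %| jacobi_re I + jacobi_im I + 1)%Z.
Proof.
move=> I2; have i2 := sqrCi algC.
pose X (t : 'F_p) := (re4 (quartic_log I t) - 1) * (quad_char I (1 - t) - 1).
pose Y (t : 'F_p) := im4 (quartic_log I t) * (quad_char I (1 - t) - 1).
pose P (t : 'F_p) := (t != 0) && (t != 1).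
pose c := chi I ('i : algC).
have H : (jacobi_re I + p%:Z)%:~R + (jacobi_im I)%:~R * 'i =
    (\sum_(t | P t) X t)%:~R + (\sum_(t | P t) Y t)%:~R * 'i :> algC.
  transitivity (jacobi_chi I 'i + p%:R : algC).
    by rewrite (jacobi_chiE _ i2) rmorphD /= addrAC.
  rewrite /jacobi_chi -(jacobi_shift I2 i2 algC_two0) // -/c.
  rewrite (bigID P) /= [X in _ + X]big1 ?addr0; last first.
    move=> t; rewrite /P negb_and !negbK => /orP[/eqP ->|/eqP ->].
      by rewrite subr0 /c chi1 subrr mulr0.
    by rewrite /c chi1 subrr mul0r.
  rewrite !rmorph_sum /= mulr_suml -big_split /=; apply: eq_bigr => t /andP[t0 _].
  rewrite /c (chi_quadE _ i2) {1}/chi (negbTE t0) mul1r ipow_re_im //.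
  by rewrite !rmorphM !rmorphB /=; ring.
have [H1 H2] := algCi_inj H.
have XY t : t != 0 -> exists x y : int, [/\ X t = 2 * x, Y t = 2 * y & exists w : int,
  X t + Y t = 4 * w].
  move=> t0; have [t1|t1] := eqVneq t 1.
    exists 0, 0; rewrite /X /Y t1 quartic_log1 /re4 /im4 /= subrr !mul0r; split=> //; by exists 0.
  have : quad_char I (1 - t) = 1 \/ quad_char I (1 - t) = -1.
    rewrite /quad_char subr_eq0 eq_sym (negbTE t1).
    by case: (Z4_cases (quartic_log I (1 - t))) => ->; [left|right|left|right].
  rewrite /X /Y => -[] ->.
    exists 0, 0; rewrite subrr !mulr0; split=> //; by exists 0.
  have -> : -1 - 1 = -2 :> int by [].
  case: (Z4_cases (quartic_log I t)) => ->.
  - exists 0, 0; split => //; by exists 0.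
  - exists 1, (-1); split=> //; by exists 0.
  - exists 2, 0; split=> //; by exists 1.
  - exists 1, 1; split=> //; by exists 1.
have [v ev] : exists v : int, \sum_(t | P t) Y t = 2 * v.
  elim/big_ind: _ => [|x y [x' ->] [y' ->]|t /andP[t0 _]]; first by exists 0.
    by exists (x' + y'); rewrite mulrDr.
  by have [x [y [_ -> _]]] := XY t t0; exists y.
have [w ew] : exists w : int, \sum_(t | P t) X t + \sum_(t | P t) Y t = 4 * w.
  rewrite -big_split /=.
  elim/big_ind: _ => [|x y [x' ->] [y' ->]|t /andP[t0 _]]; first by exists 0.
    by exists (x' + y'); rewrite mulrDr.
  by have [x [y [_ _ [w ->]]]] := XY t t0; exists w.
split; first by rewrite H2 ev dvdz_mulr.
have p4' : p%:Z = 4 * (p %/ 4)%N%:Z + 1.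
  by rewrite {1}(divn_eq p 4) p4 mulnC; lia.
have -> : jacobi_re I + jacobi_im I + 1 = 4 * (w - (p %/ 4)%N%:Z) by lia.
by rewrite dvdz_mulr.
Qed.

(** Replacing [I] by [- I] conjugates the character, hence the Jacobi sum. *)
Lemma quartic_log_flip (I t : 'F_p) : I ^+ 2 = -1 -> t != 0 ->
  quartic_log (- I) t = - quartic_log I t.
Proof.
move=> I2 t0; have J2 : (- I) ^+ 2 = -1 by rewrite sqrrN.
apply: (ipow_inj J2 (Fp_two0 p_pr p4)).
rewrite quartic_log_exp // -(quartic_log_exp p_pr p4 I2 t0).
case: (Z4_cases (quartic_log I t)) => -> //; rewrite /ipow /= ?expr1.
- by rewrite exprS J2 mulrN1 opprK.
- by rewrite I2 J2.
- by rewrite exprS I2 mulrN1.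
Qed.

Lemma jacobi_log_flip (I t : 'F_p) : I ^+ 2 = -1 -> (t != 0) && (t != 1) ->
  jacobi_log (- I) t = - jacobi_log I t.
Proof.
move=> I2 /andP[t0 t1]; have t2 : 1 - t != 0 by rewrite subr_eq0 eq_sym.
by rewrite /jacobi_log (quartic_log_flip I2 t0) (quartic_log_flip I2 t2) mulNrn [RHS]opprD.
Qed.

Lemma jacobi_re_flip (I : 'F_p) : I ^+ 2 = -1 -> jacobi_re (- I) = jacobi_re I.
Proof.
move=> I2; apply: eq_bigr => t Ht; rewrite jacobi_log_flip //.
by case: (Z4_cases (jacobi_log I t)) => ->.
Qed.

Lemma jacobi_im_flip (I : 'F_p) : I ^+ 2 = -1 -> jacobi_im (- I) = - jacobi_im I.
Proof.
move=> I2; rewrite /jacobi_im -sumrN; apply: eq_bigr => t Ht; rewrite jacobi_log_flip //.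
by case: (Z4_cases (jacobi_log I t)) => ->.
Qed.
End Normalize.

(** From p | (ad - bc)(ad + bc) and the two ways of writing p^2 as a sum of two squares
    by Brahmagupta's identity, one coordinate of a product is a multiple of p, so
    that it is 0 or the other one is. *)
Lemma two_squares_unique (p : nat) (a b c d : int) : prime p ->
  a ^+ 2 + b ^+ 2 = p%:Z -> c ^+ 2 + d ^+ 2 = p%:Z ->
  a ^+ 2 = c ^+ 2 \/ a ^+ 2 = d ^+ 2.
Proof.
move=> p_pr Hab Hcd.
have p0 : 0 < p%:Z by rewrite ltz_nat prime_gt0.
have H : (p%:Z %| (a * d - b * c) * (a * d + b * c))%Z.
  apply/dvdzP; exists (a ^+ 2 - c ^+ 2).
  transitivity (a ^+ 2 * d ^+ 2 - b ^+ 2 * c ^+ 2); first by ring.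
  have -> : d ^+ 2 = p%:Z - c ^+ 2 by rewrite -Hcd; ring.
  have -> : b ^+ 2 = p%:Z - a ^+ 2 by rewrite -Hab; ring.
  ring.
have key (e f : int) : e ^+ 2 + f ^+ 2 = p%:Z ^+ 2 -> (p%:Z %| e)%Z -> e = 0 \/ f = 0.
  move=> Hef /dvdzP [k ek]; subst e.
  have : k ^+ 2 * p%:Z ^+ 2 <= 1 * p%:Z ^+ 2 by rewrite -exprMn mul1r -Hef lerDl sqr_ge0.
  rewrite ler_pM2r ?exprn_gt0 // => k2.
  have [->|k0] := eqVneq k 0; first by left; rewrite mul0r.
  right; have k1 : k ^+ 2 = 1.
    have : 0 < k ^+ 2 by rewrite exprn_even_gt0.
    by move: (k ^+ 2) k2; lia.
  move: Hef; rewrite exprMn k1 mul1r => /eqP; rewrite -subr_eq0 addrAC subrr add0r sqrf_eq0.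
  by move/eqP.
have pr2 : (a * d - b * c) ^+ 2 + (a * c + b * d) ^+ 2 = p%:Z ^+ 2.
  rewrite [in RHS]expr2 -{1}Hab -Hcd; ring.
have pr3 : (a * d + b * c) ^+ 2 + (a * c - b * d) ^+ 2 = p%:Z ^+ 2.
  rewrite [in RHS]expr2 -{1}Hab -Hcd; ring.
have p_pr' : (p%:Z %| a * d - b * c)%Z \/ (p%:Z %| a * d + b * c)%Z.
  by move: H; rewrite !dvdzE !abszM Euclid_dvdM // => /orP.
(* A vanishing coordinate makes (x, y) and (z, w) proportional. *)
have fin (x y z w : int) : x ^+ 2 + y ^+ 2 = p%:Z -> z ^+ 2 + w ^+ 2 = p%:Z ->
    x * w = y * z -> x ^+ 2 = z ^+ 2.
  move=> H1 H2 e; apply/eqP; rewrite -(inj_eq (mulfI (lt0r_neq0 p0))).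
  apply/eqP; rewrite -{1}H2 -H1 mulrDl mulrDl -[w ^+ 2 * _]exprMn [w * x]mulrC e; ring.
case: p_pr' => [/(key _ _ pr2)|/(key _ _ pr3)] [] /eqP.
- by rewrite subr_eq0 => /eqP e; left; apply: (fin a b c d).
- rewrite addr_eq0 => /eqP e; right; apply: (fin a b d (- c)) => //.
    by rewrite sqrrN addrC.
  by rewrite mulrN e opprK.
- rewrite addr_eq0 => /eqP e; left; rewrite -[c ^+ 2]sqrrN; apply: (fin a b (- c) d) => //.
    by rewrite sqrrN.
  by rewrite e mulrN.
- rewrite subr_eq0 => /eqP e; right; apply: (fin a b d c) => //.
  by rewrite addrC.
Qed.

(** The parities of the coordinates identify the imaginary part of J up to sign with
    [b]; the sign is then corrected by choosing between [I] and [- I]. *)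
Lemma normalized_root (p : nat) (x b : int) : prime p -> (2 %| b)%Z -> b != 0 ->
  x ^+ 2 + b ^+ 2 = p%:Z ->
  (p %% 4 = 1)%N /\ exists I : 'F_p, [/\ I ^+ 2 = -1, jacobi_im I = - b,
    (jacobi_re I) ^+ 2 = x ^+ 2 & (4 %| jacobi_re I + jacobi_im I + 1)%Z].
Proof.
move=> p_pr /dvdzP [b' eb] b0 Hp.
have x_odd : exists k, x = 2 * k + 1.
  have p_odd : odd p.
    case: (even_prime p_pr) => // p2; move: Hp; rewrite p2 eb => Hp.
    have b'0 : b' != 0 by apply: contraNneq b0 => b0; rewrite eb b0 mul0r.
    have : 0 < b' ^+ 2 by rewrite exprn_even_gt0.
    have := sqr_ge0 x; move: Hp; rewrite exprMn; lia.
  have := divz_eq x 2; have := modz_ge0 x (d := 2) isT; have := ltz_pmod x (d := 2) isT.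
  move: (x %/ 2)%Z (x %% 2)%Z => k r r1 r2 ex; exists k.
  have [r0|r0] : r = 0 \/ r = 1 by lia.
    exfalso; move: Hp; rewrite ex r0 eb => Hp.
    have e2 : p%:Z = 2 * (2 * k ^+ 2 + 2 * b' ^+ 2) by rewrite -Hp; ring.
    by move: (2 * k ^+ 2 + 2 * b' ^+ 2) e2 p_odd; lia.
  by rewrite ex r0; ring.
have [k ek] := x_odd.
have p4 : (p %% 4 = 1)%N.
  have e : p%:Z = 4 * (k ^+ 2 + k + b' ^+ 2) + 1 by rewrite -Hp ek eb; ring.
  move: (k ^+ 2 + k + b' ^+ 2) e => w e; lia.
split=> //.
have [I0 I02] : exists I0 : 'F_p, I0 ^+ 2 = -1.
  have bp : b%:~R != 0 :> 'F_p.
    rewrite (intr_pchar_eq0 _ (pchar_Fp p_pr)); apply/negP => /dvdzP [c ec].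
    have c0 : c != 0 by apply: contraNneq b0 => c0; rewrite ec c0 mul0r.
    have c2 : 0 < c ^+ 2 by rewrite exprn_even_gt0.
    have p1 : 1 < p%:Z by rewrite ltz_nat prime_gt1.
    have x2 := sqr_ge0 x.
    have : p%:Z ^+ 2 * 1 <= p%:Z ^+ 2 * c ^+ 2 by rewrite ler_pM2l ?exprn_gt0 //; lia.
    have p2 : p%:Z < p%:Z ^+ 2 by rewrite expr2 ltr_pMr //; lia.
    by move: Hp; rewrite ec exprMn [c ^+ 2 * _]mulrC; lia.
  exists (x%:~R / b%:~R).
  rewrite expr_div_n; apply/eqP; rewrite -subr_eq0 opprK.
  have -> : x%:~R ^+ 2 = - (b%:~R ^+ 2) :> 'F_p.
    apply/eqP; rewrite -addr_eq0 -!rmorphXn -rmorphD /= Hp.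
    by rewrite -pmulrn pchar_Fp_0.
  by rewrite mulNr mulfV ?expf_neq0 // addNr.
have [/dvdzP[v ev] c4] := jacobi_congruence p_pr p4 I02.
have n0 := jacobi_re_im_norm p_pr p4 I02.
have vb : jacobi_im I0 ^+ 2 = b ^+ 2.
  rewrite addrC in n0; have Hp' := Hp; rewrite addrC in Hp'.
  case: (two_squares_unique p_pr n0 Hp') => // e; exfalso.
  have := etrans (esym (subrr (x ^+ 2))) (congr1 (fun z => z - x ^+ 2) (esym e)).
  have -> : jacobi_im I0 ^+ 2 - x ^+ 2 = 2 * (2 * v ^+ 2 - 2 * k ^+ 2 - 2 * k) - 1 by rewrite
    ev ek; ring.
  by move: (2 * v ^+ 2 - _ - _); lia.
have ux : jacobi_re I0 ^+ 2 = x ^+ 2 by lia.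
case: (eqVneq (jacobi_im I0) (- b)) => e.
  by exists I0.
exists (- I0); rewrite sqrrN jacobi_im_flip // jacobi_re_flip //; split=> //.
  by apply/eqP; rewrite eqr_opp; move/eqP: vb; rewrite eqf_sqr (negbTE e) orbF.
have [_] := jacobi_congruence p_pr p4 (I := - I0) (etrans (sqrrN I0) I02).
by rewrite jacobi_im_flip // jacobi_re_flip.
Qed.

(** * The quartic symbol modulo a prime q *)

(** That is, c + b i is prime to q. *)
Definition norm_unit (q : nat) (b : int) (c : int) : bool := ~~ (q%:Z %| c ^+ 2 + b ^+ 2)%Z.

Lemma q4_cases q : odd q -> (q %% 4 = 1)%N \/ (q %% 4 = 3)%N.
Proof. by lia. Qed.

(** The absolute value of (q* - 1)/4, where q* = q or - q is 1 mod 4. *)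
Definition torus_exp q : nat := (if q %% 4 == 1 then q %/ 4 else (q %/ 4).+1)%N.

Lemma torus_exp_gt0 q : prime q -> (0 < torus_exp q)%N.
Proof. by move=> q_pr; rewrite /torus_exp; case: eqP => // H; have := prime_gt1 q_pr; lia. Qed.

Lemma torus_exp_mul4 q : odd q -> (4 * torus_exp q = if q %% 4 == 1 then q.-1 else q.+1)%N.
Proof. by move=> q_odd; rewrite /torus_exp; case: (q4_cases q_odd) => q4; rewrite q4 /=; lia. Qed.

Section Torus.
Variables (K : fieldType) (q : nat) (i : K).
Hypotheses (q_pr : prime q) (q_odd : odd q) (qK : q \in [pchar K]) (i2 : i ^+ 2 = -1).
Local Notation torus_exp := (torus_exp q).

Lemma pchar_two0 : 2%:R != 0 :> K.
Proof.
rewrite -(dvdn_pcharf qK) dvdn_prime2 //.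
by apply: contraTneq q_odd => ->.
Qed.

(** The exponent (q* - 1)/4 is negative for q = 3 mod 4; replacing [i] by its conjugate
    inverts (a + b i)/(a - b i) and thus absorbs the sign. *)
Definition torus_i : K := if (q %% 4 == 1)%N then i else - i.

Lemma torus_i2 : torus_i ^+ 2 = -1.
Proof. by rewrite /torus_i; case: ifP => _; rewrite ?sqrrN. Qed.

(** The quartic symbol of q at a + b i, as an element of a field of characteristic q. *)
Definition torus_power (a b : int) : K := ((a%:~R +
  b%:~R * torus_i) / (a%:~R - b%:~R * torus_i)) ^+ torus_exp.
Definition torus_log (a b : int) : 'Z_4 := log4 i (torus_power a b).

Lemma Frobenius_i : i ^+ q = if (q %% 4 == 1)%N then i else - i.
Proof.
rewrite (expi_mod4 i2); case: (q4_cases q_odd) => -> //=; by rewrite ?expr1 // exprS i2 mulrN1.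
Qed.

Lemma Frobenius_conj (a b : int) : (a%:~R + b%:~R * i) ^+ q =
  if (q %% 4 == 1)%N then a%:~R + b%:~R * i else a%:~R - b%:~R * i.
Proof.
rewrite -(pFrobenius_autE qK) rmorphD rmorphM !rmorph_int /= pFrobenius_autE Frobenius_i.
by case: ifP => // _; rewrite mulrN.
Qed.

Lemma mul_conjE (a b : int) : (a%:~R + b%:~R * i) * (a%:~R - b%:~R * i) = (a ^+ 2 + b ^+ 2)%:~R.
Proof.
rewrite rmorphD !rmorphXn /=.
transitivity (a%:~R ^+ 2 - b%:~R ^+ 2 * i ^+ 2); first by ring.
by rewrite i2 mulrN1 opprK.
Qed.

Section Fixed.
Variables (a b : int).
Hypothesis ab : ~~ (q%:Z %| a ^+ 2 + b ^+ 2)%Z.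

Lemma conj_factors_neq0 : (a%:~R + b%:~R * i != 0) && (a%:~R - b%:~R * i != 0).
Proof. by rewrite -negb_or -mulf_eq0 mul_conjE (intr_pchar_eq0 _ qK). Qed.

Lemma torus_neq0 : (a%:~R + b%:~R * torus_i != 0) && (a%:~R - b%:~R * torus_i != 0).
Proof.
have := conj_factors_neq0; rewrite /torus_i; case: ifP => // _.
by rewrite mulrN opprK andbC.
Qed.

(** For q = 1 mod 4 the quotient z is fixed by Frobenius, so z^(q-1) = 1; for
    q = 3 mod 4 Frobenius exchanges a + b i and a - b i, so z^(q+1) = 1. *)
Lemma torus_power4 : torus_power a b ^+ 4 = 1.
Proof.
have /andP[n1 n2] := conj_factors_neq0.
have f1 := Frobenius_conj a b; have := Frobenius_conj a (- b).
rewrite rmorphN /= mulNr opprK => f2.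
rewrite /torus_power -exprM /torus_exp /torus_i; case: (q4_cases q_odd) => q4;
  rewrite q4 /= in f1 f2 *.
  have -> : (q %/ 4 * 4 = q.-1)%N by lia.
  have z0 : (a%:~R + b%:~R * i) / (a%:~R - b%:~R * i) != 0 by rewrite mulf_neq0 ?invr_eq0.
  apply: (mulfI z0); rewrite -exprS prednK ?prime_gt0 // expr_div_n f1 f2 mulr1 //.
have -> : ((q %/ 4).+1 * 4 = q.+1)%N by lia.
rewrite exprSr expr_div_n mulrN opprK f1 f2 mulrA divfK // mulfV //.
Qed.

Lemma torus_logE : ipow i (torus_log a b) = torus_power a b.
Proof. by rewrite log4K // ?pchar_two0 ?torus_power4. Qed.
End Fixed.

Lemma natr_pchar_inj (c c' : nat) : (c < q)%N -> (c' < q)%N -> c%:R = c'%:R :> K -> c = c'.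
Proof using qK.
clear q_pr q_odd.
move=> cq c'q e.
have : ((c%:Z - c'%:Z)%:~R == 0 :> K) by rewrite rmorphB subr_eq0; apply/eqP.
rewrite (intr_pchar_eq0 _ qK) => /dvdzP[d ed].
have [d0|[d1|d1]] : d = 0 \/ 1 <= d \/ d <= -1 by lia.
- by move: ed; rewrite d0 mul0r; lia.
- have : 1 * q%:Z <= d * q%:Z by rewrite ler_wpM2r.
  by rewrite -ed; lia.
- have : d * q%:Z <= -1 * q%:Z by rewrite ler_wpM2r.
  by rewrite -ed; lia.
Qed.

Lemma torus_log_congr (a a' b b' : int) : (q%:Z %| a - a')%Z -> (q%:Z %| b - b')%Z ->
  torus_log a b = torus_log a' b'.
Proof.
rewrite -!(intr_pchar_eq0 _ qK) !rmorphB /= !subr_eq0 => /eqP Ha /eqP Hb.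
by rewrite /torus_log /torus_power Ha Hb.
Qed.

Lemma torus_logN (a b : int) : ~~ (q%:Z %| a ^+ 2 + b ^+ 2)%Z ->
  torus_log (- a) b = - torus_log a b.
Proof.
move=> ab; have abN : ~~ (q%:Z %| (- a) ^+ 2 + b ^+ 2)%Z by rewrite sqrrN.
have /andP[n1 n2] := torus_neq0 ab.
apply/eqP; rewrite -addr_eq0; apply/eqP.
apply: (ipow_inj i2 pchar_two0); rewrite ipowD // !torus_logE // /torus_power -exprMn rmorphN /=.
have -> : (- a%:~R + b%:~R * torus_i) / (- a%:~R - b%:~R * torus_i) * ((a%:~R +
  b%:~R * torus_i) / (a%:~R - b%:~R * torus_i)) = 1.
  have n3 : - a%:~R - b%:~R * torus_i != 0 by rewrite -opprD oppr_eq0.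
  by field; rewrite n2 n3.
by rewrite expr1n.
Qed.

Lemma torus_log_b0 (a b : int) : (q%:Z %| b)%Z -> ~~ (q%:Z %| a)%Z -> torus_log a b = 0.
Proof.
rewrite -!(intr_pchar_eq0 _ qK) => /eqP b0 a0.
rewrite /torus_log /torus_power b0 !mul0r addr0 subr0 mulfV // expr1n.
by rewrite -(expr0 i) log4_exp // pchar_two0.
Qed.

(** For a = 0 the quotient is -1. *)
Lemma torus_log_a0 (a b : int) : (q%:Z %| a)%Z -> ~~ (q%:Z %| b)%Z -> torus_log a b *+ 2 = 0.
Proof.
move=> qa qb; have ab : ~~ (q%:Z %| a ^+ 2 + b ^+ 2)%Z.
  move: qa qb; rewrite -!(intr_pchar_eq0 _ qK) rmorphD !rmorphXn /= => /eqP -> b0.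
  by rewrite expr0n add0r expf_eq0.
move: qa qb; rewrite -!(intr_pchar_eq0 _ qK) => /eqP a0 b0.
apply: (ipow_inj i2 pchar_two0); rewrite ipowX // torus_logE // /torus_power a0 !add0r.
rewrite invrN mulrN mulfV; last by rewrite mulf_neq0 //; apply: (sqrtN1_neq0 torus_i2).
by rewrite exprAC sqrrN !expr1n.
Qed.

(** On the line a + b = 0 one has (a + b w)/(a - b w) = - w for w^2 = -1. *)
Lemma torus_log_ab (a b : int) : (q%:Z %| a + b)%Z -> ~~ (q%:Z %| b)%Z ->
  torus_log a b *+ 2 = (2 * torus_exp)%:R.
Proof.
move=> qab qb; have ab : ~~ (q%:Z %| a ^+ 2 + b ^+ 2)%Z.
  move: qab qb; rewrite -!(intr_pchar_eq0 _ qK) !rmorphD !rmorphXn /= addr_eq0 => /eqP -> b0.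
  by rewrite sqrrN -mulr2n -mulr_natl mulf_neq0 ?expf_neq0 ?pchar_two0.
move: qab qb; rewrite -!(intr_pchar_eq0 _ qK) rmorphD /= addr_eq0 => /eqP a0 b0.
apply: (ipow_inj i2 pchar_two0); rewrite ipowX // torus_logE // /torus_power a0.
have w0 := sqrtN1_neq0 torus_i2.
have n1 : 1 + torus_i != 0.
  rewrite addrC addr_eq0; apply/eqP => e; move: torus_i2; rewrite e sqrrN expr1n => /esym/eqP.
  by rewrite (N1_neq1 pchar_two0).
have -> : (- b%:~R + b%:~R * torus_i) / (- b%:~R - b%:~R * torus_i) = - torus_i.
  have n2 : - b%:~R - b%:~R * torus_i != 0.
    by rewrite -opprD oppr_eq0 -{1}[b%:~R]mulr1 -mulrDr mulf_neq0.
  apply: (mulIf n2); rewrite divfK //.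
  transitivity (b%:~R * torus_i + b%:~R * torus_i ^+ 2); last by ring.
  by rewrite torus_i2; ring.
by rewrite ipow_nat // exprAC sqrrN torus_i2 exprM i2.
Qed.

(** The residues with log k are roots of (X + w)^n - i^k (X - w)^n, of degree at most
    n, and at most n - 1 for k = 0 because the leading terms then cancel. *)
Lemma torus_log_count_le (b : int) (k : 'Z_4) : ~~ (q%:Z %| b)%Z ->
  (count (fun c : nat => norm_unit q b c && (torus_log c b == k)) (iota 0 q)
   <= torus_exp - (k == 0%R))%N.
Proof.
move=> qb; rewrite -size_filter; set s := seq.filter _ _.
pose w := b%:~R * torus_i.
have w0 : w != 0 by rewrite /w mulf_neq0 ?(sqrtN1_neq0 torus_i2) // (intr_pchar_eq0 _ qK).
pose R : {poly K} := ('X + w%:P) ^+ torus_exp - ipow i k *: ('X - w%:P) ^+ torus_exp.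
have Rn0 : R != 0.
  apply/eqP => /(congr1 (horner^~ w)); rewrite /R !hornerE subrr.
  rewrite expr0n gtn_eqF ?(torus_exp_gt0 q_pr) // mulr0 subr0 => /eqP;
    rewrite expf_eq0 (torus_exp_gt0 q_pr) /=.
  by rewrite -mulr2n -mulr_natl mulf_eq0 (negbTE pchar_two0) (negbTE w0).
have s1 : size (('X + w%:P) ^+ torus_exp) = torus_exp.+1 by rewrite -[w]opprK polyCN
  size_exp_XsubC.
have s2 : size (('X - w%:P) ^+ torus_exp) = torus_exp.+1 by rewrite size_exp_XsubC.
have sR : (size R <= (torus_exp - (k == 0%R)).+1)%N.
  have [k0|k0] := eqVneq k 0; rewrite ?subn0; last first.
    rewrite (leq_trans (size_polyD _ _)) // size_polyN geq_max s1 leqnn.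
    by rewrite (leq_trans (size_scale_leq _ _)) // s2.
  rewrite subn1 prednK ?(torus_exp_gt0 q_pr) //.
  apply/leq_sizeP => j; rewrite leq_eqVlt => /orP[/eqP <-|tj].
    rewrite /R k0 ipow0 scale1r coefB.
    have m1 : ('X + w%:P) ^+ torus_exp \is monic by rewrite monic_exp // -[w]opprK polyCN
      monicXsubC.
    have m2 : ('X - w%:P) ^+ torus_exp \is monic by rewrite monic_exp // monicXsubC.
    move: m1 m2; rewrite !monicE !lead_coefE s1 s2 /= => /eqP -> /eqP ->.
    by rewrite subrr.
  by rewrite /R coefB coefZ !nth_default ?s1 ?s2 // mulr0 subrr.
rewrite -ltnS (leq_trans _ sR) // -(size_map (fun c : nat => c%:R : K)).
apply: max_poly_roots => //.
- apply/allP => _ /mapP [c cs ->]; move: cs; rewrite mem_filter => /andP[/andP[cb /eqP ck] _].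
  have /andP[_ n2] := torus_neq0 cb.
  have := torus_logE cb; rewrite ck /torus_power expr_div_n => e.
  rewrite /root /R !hornerE /= e.
  have n3 : c%:R - w != 0 by exact: n2.
  by rewrite -/w divfK ?expf_neq0 // subrr.
- rewrite map_inj_in_uniq ?filter_uniq ?iota_uniq // => c c'.
  rewrite !mem_filter !mem_iota !add0n => /and3P[_ _ cq] /and3P[_ _ c'q] e.
  exact: natr_pchar_inj e.
Qed.
End Torus.

(** * Value distribution of the symbol and quartic reciprocity *)

Section Counts.
Variables (K : fieldType) (q : nat) (i : K).
Hypotheses (q_pr : prime q) (q_odd : odd q) (qK : q \in [pchar K]) (i2 : i ^+ 2 = -1).
Local Notation torus_exp := (torus_exp q).

(** For q = 1 mod 4 the only excluded residues are the at most two roots of X^2 + b^2; for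
    q = 3 mod 4 there are none, since such a root would be fixed by Frobenius. *)
Lemma norm_unit_count (b : int) : ~~ (q%:Z %| b)%Z ->
  ((4 * torus_exp).-1 <= count (fun c : nat => norm_unit q b c) (iota 0 q))%N.
Proof.
move=> qb; have b0 : b%:~R * i != 0.
  by rewrite mulf_neq0 ?(sqrtN1_neq0 i2) // (intr_pchar_eq0 _ qK).
have E : (count (fun c : nat => norm_unit q b c) (iota 0 q) +
          count (fun c : nat => ~~ norm_unit q b c) (iota 0 q) = q)%N.
  by rewrite -[RHS](size_iota 0) -[RHS](count_predC (fun c : nat => norm_unit q b c)).
have := q4_cases q_odd; rewrite /torus_exp => -[q4|q4]; rewrite q4 /=.
  suff : (count (fun c : nat => ~~ norm_unit q b c) (iota 0 q) <= 2)%N by lia.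
  pose R : {poly K} := 'X^2 - ((b%:~R * i) ^+ 2)%:P.
  have sR : size R = 3 by rewrite size_XnsubC.
  rewrite -ltnS -[3%N]sR -size_filter -(size_map (fun c : nat => c%:R : K)).
  apply: max_poly_roots.
  - by rewrite -size_poly_eq0 sR.
  - apply/allP => _ /mapP [c cs ->]; move: cs; rewrite mem_filter negbK => /andP[cb _].
    rewrite -(intr_pchar_eq0 _ qK) -(mul_conjE i2) in cb.
    rewrite /root /R !hornerE; move: cb.
    by rewrite (_ : (_ + _) * _ = c%:R ^+ 2 - (b%:~R * i) ^+ 2) //; ring.
  - rewrite map_inj_in_uniq; first by rewrite filter_uniq ?iota_uniq.
    move=> c c'.
    rewrite !mem_filter !mem_iota !add0n => /and3P[_ _ cq] /and3P[_ _ c'q] e.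
    exact: (natr_pchar_inj qK cq c'q e).
suff H0 : count (fun c : nat => ~~ norm_unit q b c) (iota 0 q) = 0%N.
  by rewrite H0 addn0 in E; rewrite E; lia.
apply/eqP; rewrite -leqn0 leqNgt -has_count; apply/hasPn => c _.
  rewrite negbK /norm_unit; apply/negP.
  rewrite -(intr_pchar_eq0 _ qK) -(mul_conjE i2) mulf_eq0 => H.
  have cb : c%:~R = (- b)%:~R * i \/ c%:~R = b%:~R * i :> K.
    case/orP: H => H; [left|right]; apply/eqP; last by rewrite -subr_eq0.
    by rewrite rmorphN mulNr -addr_eq0.
  have [b' b'0 e] : exists2 b' : int, b'%:~R * i != 0 & c%:~R = b'%:~R * i.
    by case: cb => e; [exists (- b); rewrite // rmorphN mulNr oppr_eq0|exists b].
  have fc := Frobenius_conj q_odd qK i2 c 0; have := Frobenius_conj q_odd qK i2 0 b'.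
  rewrite q4 /= !mul0r !addr0 subr0 in fc.
  rewrite q4 /= add0r sub0r -e fc e => /eqP.
  rewrite -addr_eq0 -mulr2n -mulr_natl mulf_eq0 (negbTE b'0) orbF.
  by rewrite (negbTE (pchar_two0 q_pr q_odd qK)).
Qed.

(** The upper bounds of [torus_log_count_le] add up to 4 n - 1, and [norm_unit_count] bounds
    the total number of residues from below by 4 n - 1; hence all of them are equalities. *)
Lemma torus_log_count (b : int) (k : 'Z_4) : ~~ (q%:Z %| b)%Z ->
  (count (fun c : nat => norm_unit q b c && (torus_log q i c b == k)) (iota 0 q)
   = torus_exp - (k == 0%R))%N.
Proof.
move=> qb.
pose n k := count (fun c : nat => norm_unit q b c && (torus_log q i c b == k)) (iota 0 q).
have le k' : (n k' <= torus_exp - (k' == 0%R))%N by exact: torus_log_count_le.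
have tot : (\sum_(k' : 'Z_4) n k' = count (fun c : nat => norm_unit q b c) (iota 0 q))%N.
  rewrite -sum1_count big_mkcond (partition_big (fun c : nat => torus_log q i c b) xpredT) //=.
  apply: eq_bigr => k' _; rewrite /n -sum1_count big_mkcond [RHS]big_mkcond.
  apply: eq_bigr => c _ /=; by case: (norm_unit q b c); case: (_ == _).
have := norm_unit_count qb; rewrite -tot.
have t0 := torus_exp_gt0 q_pr.
have -> : (\sum_(k' : 'Z_4) n k' = n 0%R + n 1%R + n 2%:R + n 3%:R)%N.
  by rewrite !big_ord_recl big_ord0 addn0 !addnA; congr (n _ + n _ + n _ + n _)%N; apply: val_inj.
have := le 0; have := le 1; have := le 2%:R; have := le 3%:R.
rewrite /= -/(n k).
by case: (Z4_cases k) => ->; rewrite /=; lia.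
Qed.
End Counts.

Section Reciprocity.
Variables (K : closedFieldType) (q p : nat) (i : K) (I : 'F_p).
Hypotheses (q_pr : prime q) (q_odd : odd q) (qK : q \in [pchar K]) (i2 : i ^+ 2 = -1).
Hypotheses (p_pr : prime p) (p4 : (p %% 4 = 1)%N) (I2 : I ^+ 2 = -1) (pq : p != q).
Local Notation torus_exp := (torus_exp q).
Local Notation two0 := (pchar_two0 q_pr q_odd qK).

(** Frobenius raises [chi 1] to the power q and replaces the root of unity by its q-th
    power, which amounts to scaling the summation variable. *)
Lemma gauss_sum_Frobenius (z : K) : z ^+ p = 1 ->
  gauss_sum I i z 1 ^+ q = chi I i (- q%:R) q%:R * gauss_sum I i z q%:R.
Proof.
move=> zp.
have q0 : q%:R != 0 :> 'F_p by rewrite -(dvdn_pcharf (pchar_Fp p_pr)) dvdn_prime2.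
rewrite -(gauss_sum_twist p_pr p4 I2 i2) //.
rewrite -(pFrobenius_autE qK) /gauss_sum rmorph_sum /=; apply: eq_bigr => t _.
rewrite pFrobenius_autE exprMn; congr (_ * _).
  rewrite /chi; case: (t =P 0) => [_|_]; first by rewrite expr0n gtn_eqF ?prime_gt0.
  by rewrite -ipowX // mul1r mulr_natl.
rewrite [q%:R * t]mulrC zpowM // val_Fp_nat //.
by rewrite expr_mod // /zpow -exprM mulnC exprM zp expr1n.
Qed.

(** Compare the q-th power of the Gauss sum with the power of g^4 = J^3 conj(J) of
    exponent [torus_exp q], using that Frobenius fixes J for q = 1 mod 4 and conjugates it
    for q = 3 mod 4. *)
Lemma quartic_reciprocity :
  quartic_log I (if (q %% 4 == 1)%N then q%:R else - q%:R) =
    torus_log q i (- jacobi_re I) (- jacobi_im I).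
Proof.
have pK : p%:R != 0 :> K by rewrite -(dvdn_pcharf qK) dvdn_prime2 // eq_sym.
have q0 : q%:R != 0 :> 'F_p by rewrite -(dvdn_pcharf (pchar_Fp p_pr)) dvdn_prime2.
have [z zp z1] := root_unity_exists p_pr pK.
have G4 := gauss_sum_pow4 p_pr p4 I2 i2 two0 zp z1 pK.
have JJ := jacobi_chi_norm p_pr p4 I2 i2 two0 zp z1 pK.
have GF := gauss_sum_Frobenius zp.
set J := jacobi_chi I i in G4 JJ; set Jc := jacobi_chi_conj I i in JJ.
have JE : J = - ((- jacobi_re I)%:~R + (- jacobi_im I)%:~R * i) by rewrite /J jacobi_chiE //
  !rmorphN /=; ring.
have JcE : Jc = - ((- jacobi_re I)%:~R - (- jacobi_im I)%:~R * i) by rewrite /Jc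
  jacobi_chi_conjE // !rmorphN /=; ring.
have J0 : J != 0 by apply: contraNneq pK => H; rewrite -JJ H mul0r.
have Jc0 : Jc != 0 by apply: contraNneq pK => H; rewrite -JJ H mulr0.
have fJ := Frobenius_conj q_odd qK i2 (- jacobi_re I) (- jacobi_im I).
have fJ' : J ^+ q = if (q %% 4 == 1)%N then J else Jc.
  rewrite JE JcE exprNn fJ -signr_odd q_odd mulN1r; by case: ifP.
have G0 : gauss_sum I i z 1 != 0.
  apply/eqP => g0; move: G4; rewrite g0 expr0n /= => /esym/eqP.
  by rewrite mulf_eq0 expf_eq0 (negbTE J0) (negbTE pK).
have nE : ~~ (q%:Z %| (- jacobi_re I) ^+ 2 + (- jacobi_im I) ^+ 2)%Z.
  by rewrite !sqrrN (jacobi_re_im_norm p_pr p4 I2) /= dvdzE /= dvdn_prime2 // eq_sym.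
apply: (ipow_inj i2 two0); rewrite (torus_logE q_pr q_odd qK i2 nE).
have torE : torus_power q i (- jacobi_re I) (- jacobi_im I) =
  if (q %% 4 == 1)%N then (J / Jc) ^+ torus_exp else (Jc / J) ^+ torus_exp.
  rewrite /torus_power /torus_i JE JcE invrN mulrNN invrN mulrNN.
  by case: ifP => // _; rewrite mulrN opprK.
rewrite torE.
case: (q4_cases q_odd) => q4; rewrite q4 /= in fJ' *.
  have qz : q%:R = 1 :> 'Z_4 by rewrite -Zp_nat_mod // q4.
  have e4 : (4 * torus_exp = q.-1)%N by rewrite torus_exp_mul4 // q4.
  have Gq : gauss_sum I i z 1 ^+ q.-1 = chi I i (- 1) q%:R.
    apply: (mulIf G0); rewrite -exprSr prednK ?prime_gt0 //.
    by move: GF; rewrite qz.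
  have J4 : J ^+ (4 * torus_exp) = 1.
    by apply: (mulfI J0); rewrite e4 -exprS prednK ?prime_gt0 // mulr1.
  move: Gq; rewrite chiN // -e4 exprM G4 -JJ => Gq.
  apply: invr_inj; rewrite -[ipow i _]mul1r.
  have <- : chi I i 1 q%:R = 1 * ipow i (quartic_log I q%:R) by rewrite /chi (negbTE q0) !mul1r.
  rewrite -Gq -exprVn invf_div.
  rewrite -[LHS]divr1 -J4 exprM -expr_div_n; congr (_ ^+ _).
  by field.
have qz : q%:R = - 1 :> 'Z_4 by rewrite -Zp_nat_mod // q4; apply: val_inj.
have e4 : (4 * torus_exp = q.+1)%N by rewrite torus_exp_mul4 // q4.
have Gq : gauss_sum I i z 1 ^+ q.+1 = chi I i 1 (- q%:R) * p%:R.
  rewrite exprSr GF qz opprK -mulrA [gauss_sum _ _ _ (-1) * _]mulrC.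
  rewrite (gauss_sumMN p_pr p4 I2 i2 two0 zp z1 (a := 1) isT) mulrA.
  by rewrite -[in LHS](chiM p_pr p4 I2 i2) mulrN1.
have J4 : J ^+ (4 * torus_exp) = p%:R by rewrite e4 exprS fJ' JJ.
apply: (mulIf pK); move: Gq; rewrite -e4 exprM G4 -{1}JJ.
rewrite /chi oppr_eq0 (negbTE q0) mul1r => <-.
rewrite -J4 exprM -exprMn; congr (_ ^+ _).
by field.
Qed.
End Reciprocity.

Lemma closed_field_pchar (q : nat) : prime q -> exists2 K : closedFieldType, q \in [pchar K] &
  exists i : K, i ^+ 2 = -1.
Proof.
move=> q_pr; have [K [f _]] := countable_algebraic_closure 'F_q.
exists (K : closedFieldType); last by have [j] := GRing.imaginary_exists K; exists j.
by rewrite (fmorph_pchar f) pchar_Fp.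
Qed.

(** * Quartic logarithms of integers *)

(** What the rest of the proof uses of the quartic symbol of q, with no reference to the
    auxiliary field of characteristic q: [th a b] is the log of the symbol at a + b i. *)
Record local_log (q : nat) (th : int -> int -> 'Z_4) : Prop := LocalLog {
  ll_congr : forall a a' b : int, (q%:Z %| a - a')%Z -> th a b = th a' b;
  ll_opp : forall a b : int, norm_unit q b a -> th (- a) b = - th a b;
  ll_b0 : forall a b : int, (q%:Z %| b)%Z -> ~~ (q%:Z %| a)%Z -> th a b = 0;
  ll_a0 : forall a b : int, (q%:Z %| a)%Z -> ~~ (q%:Z %| b)%Z -> th a b *+ 2 = 0;
  ll_ab : forall a b : int, (q%:Z %| a + b)%Z -> ~~ (q%:Z %| b)%Z ->
    th a b *+ 2 = (2 * torus_exp q)%:R;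
  ll_count : forall (b : int) (k : 'Z_4), ~~ (q%:Z %| b)%Z ->
    (count (fun c : nat => norm_unit q b c && (th c b == k)) (iota 0 q) =
      torus_exp q - (k == 0%R))%N;
  ll_recip : forall (p : nat) (I : 'F_p), prime p -> (p %% 4 = 1)%N -> I ^+ 2 = -1 ->
    p != q -> quartic_log I (if (q %% 4 == 1)%N then q%:R else - q%:R) =
      th (- jacobi_re I) (- jacobi_im I) }.

Lemma local_log_exists q : prime q -> odd q -> exists th, local_log q th.
Proof.
move=> q_pr q_odd; have [K qK [i i2]] := closed_field_pchar q_pr.
exists (torus_log q i); split.
- by move=> a a' b H; apply: torus_log_congr => //; rewrite subrr dvdz0.
- by move=> a b H; apply: torus_logN.
- by move=> a b; apply: torus_log_b0.
- by move=> a b; apply: torus_log_a0.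
- by move=> a b; apply: torus_log_ab.
- by move=> b k; apply: torus_log_count.
- by move=> p I p_pr p4 I2 pq; apply: quartic_reciprocity.
Qed.

Lemma local_logs : exists th : nat -> int -> int -> 'Z_4,
  forall q, prime q -> odd q -> local_log q (th q).
Proof.
have H q : exists th, prime q -> odd q -> local_log q th.
  case: (boolP (prime q && odd q)) => [/andP[q1 q2]|H].
    by have [th Hth] := local_log_exists q1 q2; exists th.
  by exists (fun _ _ => 0) => q1 q2; move: H; rewrite q1 q2.
by have [th Hth] := boolp.choice H; exists th.
Qed.

Lemma Z4_int_eq (m n : int) : (4 %| m - n)%Z -> m%:~R = n%:~R :> 'Z_4.
Proof.
move=> /dvdzP[k ek]; have -> : m = n + k * 4 by rewrite -ek addrC subrK.
rewrite rmorphD rmorphM /= (_ : 4%:~R = 0 :> 'Z_4) ?mulr0 ?addr0 //.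
exact: val_inj.
Qed.

Section PowerSum.
Variables (p : nat).
Hypothesis p_pr : prime p.

(** For e > 0, scaling the variable by g with g^e <> 1 multiplies the sum by g^e. *)
Lemma power_sum0 e : (e < p.-1)%N -> \sum_(t : 'F_p) t ^+ e = 0.
Proof.
move=> ep; case: (posnP e) => [->|e0].
  under eq_bigr do rewrite expr0.
  by rewrite sumr_const card_Fp // pchar_Fp_0.
have [g g0 Hg] : exists2 g : 'F_p, g != 0 & g ^+ e != 1.
  apply/exists_inP; rewrite -negb_forall_in; apply/negP => /forall_inP H.
  pose P : {poly 'F_p} := 'X^e - 1.
  have sP : size P = e.+1 by rewrite size_XnsubC.
  have : (size (rem 0%R (enum 'F_p)) < size P)%N.
    apply: max_poly_roots.
    - by rewrite -size_poly_eq0 sP.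
    - apply/allP => t; rewrite mem_rem_uniq ?enum_uniq // inE => /andP[t0 _].
      have := H t t0; rewrite /root /P !hornerE => /eqP ->.
      by rewrite subrr.
    - by rewrite rem_uniq // enum_uniq.
  rewrite size_rem ?mem_enum // -cardE card_Fp // sP; lia.
have : \sum_(t : 'F_p) t ^+ e = g ^+ e * \sum_(t : 'F_p) t ^+ e.
  rewrite mulr_sumr (reindex_inj (mulfI g0)) /=.
  by apply: eq_bigr => t _; rewrite exprMn.
move/eqP; rewrite -subr_eq0 -{1}[X in X - _]mul1r -mulrBl mulf_eq0 subr_eq0 eq_sym.
by rewrite (negbTE Hg) /= => /eqP.
Qed.

Lemma poly_sum0 (P : {poly 'F_p}) : (size P < p)%N -> \sum_(t : 'F_p) P.[t] = 0.
Proof.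
move=> sP; under eq_bigr do rewrite horner_coef.
rewrite exchange_big /= big1 // => i _.
rewrite -mulr_sumr power_sum0 ?mulr0 //.
by rewrite -ltnS prednK ?prime_gt0 // (leq_trans _ sP) // ltnS ltn_ord.
Qed.
End PowerSum.

(** Read in F_p itself, the Jacobi sum is the sum over F_p of the values of a polynomial
    of degree 3 (p - 1)/4 < p - 1. *)
Lemma jacobi_orientation (p : nat) (I : 'F_p) : prime p -> (p %% 4 = 1)%N -> I ^+ 2 = -1 ->
  (jacobi_re I)%:~R + (jacobi_im I)%:~R * I = 0 :> 'F_p.
Proof.
move=> p_pr p4 I2; rewrite -jacobi_chiE // /jacobi_chi /jacobi.
pose m := (p %/ 4)%N; have m0 : (0 < m)%N by apply: quarter_gt0.
pose P : {poly 'F_p} := 'X^m * (1 - 'X) ^+ (m * 2).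
have c1 (t : 'F_p) : chi I I 1 t = t ^+ m.
  rewrite /chi; case: (t =P 0) => [->|/eqP t0]; first by rewrite expr0n gtn_eqF.
  by rewrite mul1r quartic_log_exp.
have c2 (t : 'F_p) : chi I I 2%:R t = t ^+ (m * 2).
  rewrite /chi; case: (t =P 0) => [->|/eqP t0]; first by rewrite expr0n gtn_eqF ?muln_gt0 ?m0.
  by rewrite mulr_natl ipowX // quartic_log_exp // -exprM.
transitivity (\sum_(t : 'F_p) P.[t]).
  by apply: eq_bigr => t _; rewrite c1 c2 /P !hornerE.
apply: poly_sum0 => //.
have s1 : (size ((1 - 'X : {poly 'F_p}) ^+ (m * 2)) <= (m * 2).+1)%N.
  rewrite (leq_trans (size_poly_exp_leq _ _)) // ltnS.
  have -> : size (1 - 'X : {poly 'F_p}) = 2.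
    by rewrite -opprB size_polyN size_XsubC.
  by rewrite mul1n.
rewrite (leq_ltn_trans (size_polyMleq _ _)) // size_polyXn addSn /=.
have pm : p = (4 * m).+1 := card_quarter p4.
rewrite [X in (_ < X)%N]pm ltnS (leq_trans (leq_add (leqnn m) s1)) //.
clearbody m; move: m0; clear; lia.
Qed.

(** [odd n./2] is the character of the classes 1 and 3 mod 4: it records whether
    n* is n or - n. *)
Lemma half_mul m n : odd m -> odd n -> odd (m * n)./2 = odd (m./2 + n./2).
Proof.
move=> m_odd n_odd; rewrite -{1}[m]odd_double_half -{1}[n]odd_double_half m_odd n_odd.
move: (m./2) (n./2) => x y.
have -> : ((true + x.*2) * (true + y.*2) = (x + y + (x * y).*2).*2.+1)%N.
  rewrite -!mul2n; nia.
by rewrite /= uphalf_double oddD odd_double addbF.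
Qed.

Lemma prod_prime_list n : (0 < n)%N -> exists2 s, all prime s & n = (\prod_(q <- s) q)%N.
Proof.
elim/ltn_ind: n => n IH n0; case: (ltngtP n 1) => [|n1|->]; first by lia.
  have d1 := pdiv_prime n1; have /dvdnP[m em] := pdiv_dvd n.
  have m0 : (0 < m)%N by move: n0; rewrite em; case: m {em}.
  have [s sp es] : exists2 s, all prime s & m = (\prod_(q <- s) q)%N.
    apply: IH => //; rewrite [X in (_ < X)%N]em ltn_Pmulr //; exact: prime_gt1.
  by exists (pdiv n :: s); rewrite ?big_cons /= ?d1 // -es mulnC.
by exists [::]; rewrite ?big_nil.
Qed.

(** [odd (n ^ 2 %/ 8)] is the quadratic character of 2 modulo n. *)
Lemma sq8_mul m n : odd m -> odd n -> odd ((m * n) ^ 2 %/ 8) = odd (m ^ 2 %/ 8 + n ^ 2 %/ 8).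
Proof.
have key k : odd k -> (k ^ 2 = 8 * (k ^ 2 %/ 8) + 1)%N.
  move=> k_odd; have : (k ^ 2 %% 8 = 1)%N.
    rewrite -modnXm; have : (k %% 8 < 8)%N by rewrite ltn_mod.
    have : odd (k %% 8) by rewrite odd_mod.
    by case: (k %% 8)%N => [|[|[|[|[|[|[|[|]]]]]]]].
  by move=> e; rewrite {1}(divn_eq (k ^ 2) 8) e mulnC.
move=> m_odd n_odd; rewrite expnMn {1}(key m m_odd) {1}(key n n_odd).
move: (m ^ 2 %/ 8)%N (n ^ 2 %/ 8)%N => x y.
have -> : ((8 * x + 1) * (8 * y + 1) = (8 * (x * y) + x + y) * 8 + 1)%N by nia.
by rewrite divnMDl // divn_small // addn0 -addnA oddD oddM.
Qed.

Section LogFormulas.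
Variable th : nat -> int -> int -> 'Z_4.
Hypothesis thP : forall q, prime q -> odd q -> local_log q (th q).
Variables (p : nat) (I : 'F_p) (a b b' : int).
Hypotheses (p_pr : prime p) (p4 : (p %% 4 = 1)%N) (I2 : I ^+ 2 = -1).
Hypotheses (aE : a = - jacobi_re I) (bE : b = - jacobi_im I) (b'E : b = 2 * b').
Hypothesis (ab1 : (4 %| a + b - 1)%Z).
Local Notation quartic_log := (quartic_log I).

Lemma norm_ab : a ^+ 2 + b ^+ 2 = p%:Z.
Proof. by rewrite aE bE !sqrrN jacobi_re_im_norm. Qed.

Lemma ab_coprime q : prime q -> ~~ ((q%:Z %| a)%Z && (q%:Z %| b)%Z).
Proof.
move=> q_pr; apply/negP => /andP[/dvdzP[x ex] /dvdzP[y ey]].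
have : (q * q %| p)%N.
  rewrite -[(_ %| _)%N]/((q * q)%N%:Z %| p%:Z)%Z; apply/dvdzP; exists (x ^+ 2 + y ^+ 2).
  by rewrite -norm_ab ex ey PoszM; ring.
move=> qqp; have : (q %| p)%N by apply: dvdn_trans qqp; apply: dvdn_mulr.
rewrite dvdn_prime2 // => /eqP qp; move: qqp; rewrite qp => /dvdn_leq; have := prime_gt1 p_pr.
move=> p1 /(_ (ltnW p1)); nia.
Qed.

Let ps0 (z : int) : (z%:~R == 0 :> 'F_p) = (p%:Z %| z)%Z.
Proof. exact: intr_pchar_eq0 (pchar_Fp p_pr). Qed.

(** This ties [I] to a + b i, and is what decides between i and - i in the value of
    the character at 2. *)
Lemma bIa : b%:~R = I * a%:~R.
Proof.
have /eqP := jacobi_orientation p_pr p4 I2; rewrite addr_eq0 => /eqP e.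
rewrite aE bE !rmorphN /= e; transitivity (I ^+ 2 * (jacobi_im I)%:~R); last by ring.
by rewrite I2 mulN1r.
Qed.

Lemma ap0 : a%:~R != 0 :> 'F_p.
Proof.
apply/negP => H; have /negP := ab_coprime p_pr; apply.
by rewrite -!ps0 bIa (eqP H) mulr0 eqxx.
Qed.

Lemma bp0 : b%:~R != 0 :> 'F_p.
Proof. by rewrite bIa mulf_neq0 ?ap0 // (sqrtN1_neq0 I2). Qed.

Lemma quarterE : (p %/ 4)%N%:Z * 4 = a ^+ 2 + b ^+ 2 - 1.
Proof. rewrite norm_ab {2}(card_quarter p4); lia. Qed.

Lemma a_form : exists k, a = 4 * k + 1 - 2 * b'.
Proof. by move: ab1 => /dvdzP[k ek]; exists k; move: ek; rewrite b'E; lia. Qed.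

(** -1 = [I ^+ 2] has log (p - 1)/2 = (a^2 - 1)/2 + b^2/2, and these two terms are 0 and b
    mod 4 because a is odd and b is even. *)
Lemma quartic_log_N1 : quartic_log (-1) = b%:~R.
Proof.
rewrite -I2 (quartic_logX p_pr) ?(sqrtN1_neq0 I2) // quartic_log_root // -mulrnA mulnC
  -[LHS]/((2 * (p %/ 4))%N%:Z%:~R).
apply: Z4_int_eq; have [k ek] := a_form.
have e := quarterE; apply/dvdzP; exists (2 * k ^+ 2 + k - 2 * k * b' + b' ^+ 2 - b').
rewrite ek b'E in e; rewrite b'E PoszM.
suff : 2 * (2%:Z * (p %/ 4)%N - 2 * b') = 2 * ((2 * k ^+ 2 + k - 2 * k * b' +
  b' ^+ 2 - b') * 4) by lia.
transitivity ((p %/ 4)%N%:Z * 4 - 4 * b'); first by ring.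
rewrite e; ring.
Qed.

Lemma b_double : b%:~R *+ 2 = 0 :> 'Z_4.
Proof. by rewrite -mulr_natl -[2%:R]/(2%:~R) -rmorphM /=; apply: (Z4_int_eq (n := 0));
  rewrite b'E subr0 mulrA dvdz_mulr. Qed.

Lemma b_parity n : b%:~R *+ n = b%:~R *+ odd n :> 'Z_4.
Proof.
move: b_double; move: (b%:~R : 'Z_4) => x x2.
by rewrite -{1}[n]odd_double_half -muln2 mulrnDr mulrnA mulrnAC x2 mul0rn addr0.
Qed.

Lemma b_mod2 m n : odd m = odd n -> b%:~R *+ m = b%:~R *+ n :> 'Z_4.
Proof. by move=> e; rewrite b_parity e -b_parity. Qed.

Lemma natp0 q : prime q -> p != q -> q%:R != 0 :> 'F_p.
Proof. by move=> q_pr pq; rewrite -(dvdn_pcharf (pchar_Fp p_pr)) dvdn_prime2. Qed.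

Lemma quartic_log_prime q : prime q -> odd q -> p != q ->
  quartic_log q%:R = b%:~R *+ q./2 + th q a b.
Proof.
move=> q_pr q_odd pq; have H := ll_recip (thP q_pr q_odd) p_pr p4 I2 pq.
rewrite -aE -bE in H; rewrite -H.
have e : (odd q./2) = (q %% 4 != 1)%N by move: q_odd; lia.
case: ifP => q4.
  by rewrite (@b_mod2 _ 0) ?mulr0n ?add0r // e q4.
rewrite -mulN1r (quartic_logM p_pr p4) ?natp0 ?oppr_eq0 ?oner_eq0 // quartic_log_N1 addrA -mulrSr.
by rewrite (@b_mod2 _ 0) ?mulr0n ?add0r //= e q4.
Qed.

(** Additivity reduces to prime factors.  The sign between n and n* contributes the
    multiple [n./2] of the log of -1. *)
Lemma quartic_log_list s : all prime s -> all odd s -> p \notin s ->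
  [/\ odd (\prod_(q <- s) q)%N, ((\prod_(q <- s) q)%N)%:R != 0 :> 'F_p &
  quartic_log ((\prod_(q <- s) q)%N)%:R = b%:~R *+ (\prod_(q <- s) q)%N./2 +
    \sum_(q <- s) th q a b].
Proof.
elim: s => [|q s IH] /=; first by rewrite !big_nil oner_neq0 quartic_log1 mulr0n addr0.
move=> /andP[q_pr sp] /andP[q_odd so]; rewrite in_cons negb_or => /andP[pq ps].
have [od nz e] := IH sp so ps; rewrite !big_cons oddM q_odd od natrM mulf_neq0 ?(natp0 q_pr pq)
  //; split=> //.
rewrite (quartic_logM p_pr p4) ?(natp0 q_pr pq) // quartic_log_prime // e (b_mod2 (half_mul
  q_odd od)) mulrnDr.
by rewrite addrACA.
Qed.

Lemma quartic_log_nat n : odd n -> (forall q, prime q -> (q %| n)%N -> p != q) ->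
  exists s, [/\ all prime s, n = (\prod_(q <- s) q)%N, all odd s, (forall q, q \in s ->
    (q %| n)%N) &
    n%:R != 0 :> 'F_p /\ quartic_log n%:R = b%:~R *+ n./2 + \sum_(q <- s) th q a b].
Proof.
move=> n_odd H; have n0 : (0 < n)%N by case: n n_odd {H}.
have [s sp es] := prod_prime_list n0.
have sn q : q \in s -> (q %| n)%N.
  by move=> qs; rewrite es (big_rem q) //= dvdn_mulr.
have so : all odd s.
  by apply/allP => q /sn qn; apply: dvdn_odd qn n_odd.
have ps : p \notin s.
  apply/negP => ps; have := H p p_pr (sn _ ps); by rewrite eqxx.
have [_ nz e] := quartic_log_list sp so ps.
by exists s; split=> //; rewrite es.
Qed.

Lemma quartic_log_dvd_b n : odd n -> (forall q, prime q -> (q %| n)%N -> (q%:Z %| b)%Z) ->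
  n%:R != 0 :> 'F_p /\ quartic_log n%:R = b%:~R *+ n./2.
Proof.
move=> n_odd H.
have pn q : prime q -> (q %| n)%N -> p != q.
  move=> q_pr qn; apply/eqP => pq; have := bp0; rewrite ps0 pq => /negP; apply.
  exact: H.
have [s [sp es so sn [nz ->]]] := quartic_log_nat n_odd pn; split=> //.
rewrite big1_seq ?addr0 // => q /andP[_ qs].
have q_pr := allP sp q qs; have qb := H q q_pr (sn _ qs).
apply: (ll_b0 (thP q_pr (allP so q qs))) => //.
by have := ab_coprime q_pr; rewrite qb andbT.
Qed.

Lemma quartic_log_sign (z : int) : z%:~R != 0 :> 'F_p ->
  quartic_log z%:~R *+ 2 = quartic_log (`|z|%N)%:R *+ 2.
Proof.
move=> nz; have [z0|z0] := ltrP z 0; last first.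
  have e : z%:~R = (`|z|%N)%:R :> 'F_p by rewrite -{1}(gez0_abs z0) -pmulrn.
  by rewrite e.
have e : z%:~R = -1 * (`|z|%N)%:R :> 'F_p.
  by rewrite pmulrn (ltz0_abs z0) mulN1r rmorphN opprK.
have n0 : (`|z|%N)%:R != 0 :> 'F_p.
  by apply: contraNneq nz => n0; rewrite e n0 mulr0.
rewrite e (quartic_logM p_pr p4) ?oppr_eq0 ?oner_eq0 //.
by rewrite mulrnDl quartic_log_N1 b_double add0r.
Qed.

Lemma a_odd : odd `|a|%N.
Proof. have [k ek] := a_form; move: ek; lia. Qed.

Lemma abs_ab_odd : odd (absz (a + b)%R).
Proof. have [k ek] := a_form; move: ek; rewrite b'E; lia. Qed.

(** Every prime q dividing a has (a + b i)/(a - b i) = -1 mod q. *)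
Lemma quartic_log_a : quartic_log a%:~R *+ 2 = 0.
Proof.
rewrite quartic_log_sign ?ap0 //.
have pn q : prime q -> (q %| `|a|%N)%N -> p != q.
  move=> q_pr qn; apply/eqP => pq; have := ap0; rewrite ps0 pq => /negP; apply.
  by rewrite dvdzE.
have [s [sp es so sn [nz ->]]] := quartic_log_nat a_odd pn.
rewrite mulrnDl mulrnAC b_double mul0rn add0r -sumrMnl big1_seq // => q /andP[_ qs].
have q_pr := allP sp q qs; have qa : (q%:Z %| a)%Z by rewrite dvdzE /=; apply: sn.
apply: (ll_a0 (thP q_pr (allP so q qs))) => //.
by have := ab_coprime q_pr; rewrite qa.
Qed.

Lemma abp0 : (a + b)%:~R != 0 :> 'F_p.
Proof.
have two0 := Fp_two0 p_pr p4.
suff : (a + b)%:~R ^+ 2 != 0 :> 'F_p by rewrite expf_eq0.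
rewrite -rmorphXn /=.
have -> : (a + b) ^+ 2 = p%:Z + 2 * a * b by rewrite -norm_ab; ring.
rewrite rmorphD /= -pmulrn pchar_Fp_0 // add0r !rmorphM /= !mulf_neq0 ?ap0 ?bp0 //.
Qed.

(** The square of the character at a + b is the quadratic character of 2 modulo a + b,
    by [ll_ab] applied to the prime factors of a + b. *)
Lemma quartic_log_ab : quartic_log (a + b)%:~R *+ 2 = (2 * (absz (a + b)%R ^ 2 %/ 8))%N%:R.
Proof.
rewrite quartic_log_sign ?abp0 //.
have pn q : prime q -> (q %| absz (a + b)%R)%N -> p != q.
  move=> q_pr qn; apply/eqP => pq; have := abp0; rewrite ps0 pq => /negP; apply.
  by rewrite dvdzE.
have [s [sp es so sn [nz ->]]] := quartic_log_nat abs_ab_odd pn.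
rewrite mulrnDl mulrnAC b_double mul0rn add0r -sumrMnl.
have twoN (x y : nat) : odd x = odd y -> (2 * x)%N%:R = (2 * y)%N%:R :> 'Z_4.
  move=> e; apply: (Z4_int_eq (m := (2 * x)%N) (n := (2 * y)%N)).
  apply/dvdzP; exists ((x./2)%:Z - (y./2)%:Z); move: e; clear; lia.
rewrite (eq_big_seq (fun q => (2 * torus_exp q)%N%:R)); last first.
  move=> q qs; have q_pr := allP sp q qs.
  have qa : (q%:Z %| a + b)%Z by rewrite dvdzE /=; apply: sn.
  apply: (ll_ab (thP q_pr (allP so q qs))) => //.
  apply/negP => qb; have := ab_coprime q_pr; rewrite qb andbT => /negP; apply.
  have -> : a = (a + b) - b by rewrite addrK.
  by rewrite rpredB.
rewrite -natr_sum -big_distrr /=; apply: twoN.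
rewrite [in RHS]es.
elim: s sp so {es sn} => [|q s IH] /=; first by rewrite !big_nil.
move=> /andP[q_pr sp] /andP[q_odd so].
have po : odd (\prod_(q <- s) q)%N.
  by elim: s so {IH sp} => [|x s IH] /=; rewrite ?big_nil // big_cons oddM => /andP[-> /IH ->].
rewrite !big_cons sq8_mul // !oddD IH //; congr (_ (+) _).
rewrite /torus_exp.
have : (q %% 8 < 8)%N by rewrite ltn_mod.
have : odd (q %% 8) by rewrite odd_mod.
have -> : (q ^ 2 %/ 8 = (((q %/ 8) * 8 + q %% 8) ^ 2) %/ 8)%N by rewrite -divn_eq.
have -> : (q %% 4 = q %% 8 %% 4)%N by rewrite modn_dvdm.
have -> : (q %/ 4 = (q %/ 8) * 2 + q %% 8 %/ 4)%N by lia.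
move: (q %/ 8)%N => k.
case: (q %% 8)%N => [|[|[|[|[|[|[|[|]]]]]]]] //= _ _.
- have -> : ((k * 8 + 1) ^ 2 = (8 * k ^ 2 + 2 * k) * 8 + 1)%N by nia.
  lia.
- have -> : ((k * 8 + 3) ^ 2 = (8 * k ^ 2 + 6 * k + 1) * 8 + 1)%N by nia.
  lia.
- have -> : ((k * 8 + 5) ^ 2 = (8 * k ^ 2 + 10 * k + 3) * 8 + 1)%N by nia.
  lia.
- have -> : ((k * 8 + 7) ^ 2 = (8 * k ^ 2 + 14 * k + 6) * 8 + 1)%N by nia.
  lia.
Qed.

(** Apply the character to (a + b)^2 = 2 a b and b = I a:
    chi(2) = chi(a + b)^2 chi(a)^-2 chi(I)^-1. *)
Lemma quartic_log_2 : quartic_log 2%:R = (- b')%:~R.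
Proof.
have two0 := Fp_two0 p_pr p4.
have e : (a + b)%:~R ^+ 2 = 2%:R * a%:~R * b%:~R :> 'F_p.
  rewrite -rmorphXn /=.
  have -> : (a + b) ^+ 2 = p%:Z + 2 * a * b by rewrite -norm_ab; ring.
  by rewrite rmorphD /= -pmulrn pchar_Fp_0 // add0r !rmorphM.
have := congr1 quartic_log e.
rewrite (quartic_logX p_pr) ?abp0 // !(quartic_logM p_pr p4) ?mulf_neq0 ?ap0 ?bp0 //.
rewrite {1}bIa (quartic_logM p_pr p4) ?ap0 ?(sqrtN1_neq0 I2) // quartic_log_root //.
rewrite quartic_log_ab => e1.
have e2 : (2 * (absz (a + b)%R ^ 2 %/ 8))%N%:R =
  quartic_log 2%:R + (p %/ 4)%:R + quartic_log a%:~R *+ 2 :> 'Z_4.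
  by rewrite e1 mulr2n; ring.
rewrite quartic_log_a addr0 in e2.
have -> : quartic_log 2%:R = ((2 * (absz (a + b)%R ^ 2 %/ 8))%N%:Z - (p %/ 4)%N%:Z)%:~R.
  by rewrite rmorphB /= -!pmulrn e2 addrK.
apply: Z4_int_eq; have [k ek] := a_form.
have abE : a + b = 4 * k + 1 by rewrite ek b'E; ring.
have s8 : (8 * (absz (a + b)%R ^ 2 %/ 8))%N%:Z = (a + b) ^+ 2 - 1.
  have : (absz (a + b)%R ^ 2)%N%:Z = (a + b) ^+ 2 by rewrite -abszX gez0_abs ?sqr_ge0.
  have e8 : (a + b) ^+ 2 = 8 * (2 * k ^+ 2 + k) + 1 by rewrite abE; ring.
  rewrite e8; move: (absz (a + b)%R ^ 2)%N (2 * k ^+ 2 + k) => N w; lia.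
have q4 := quarterE.
have [w ew] : exists w, b' * (1 - b') = 2 * w.
  have := divz_eq b' 2; have := modz_ge0 b' (d := 2) isT; have := ltz_pmod b' (d := 2) isT.
  move: (b' %/ 2)%Z (b' %% 2)%Z => x r r1 r2 ->.
  have [->|->] : r = 0 \/ r = 1 by lia.
    by exists (x * (1 - x * 2)); ring.
  by exists (- (x * 2 + 1) * x); ring.
apply/dvdzP; exists (k * b' + w).
have e3 : 4 * ((2 * (absz (a + b)%R ^ 2 %/ 8))%N%:Z - (p %/ 4)%N%:Z) = 4 * (a * b').
  transitivity ((8 * (absz (a + b)%R ^ 2 %/ 8))%N%:Z - (p %/ 4)%N%:Z * 4);
    first by rewrite !PoszM; ring.
  by rewrite s8 q4 b'E; ring.
have -> : (2 * (absz (a + b)%R ^ 2 %/ 8))%N%:Z - (p %/ 4)%N%:Z = a * b'.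
  by apply: (mulfI _ e3).
rewrite opprK ek; transitivity (4 * k * b' + 2 * (b' * (1 - b'))); first by ring.
rewrite ew; ring.
Qed.

(** The squares and cubes reduce the exponents of the local symbols mod 4 to 1, 2 and 3;
    chi(8) is the inverse of chi(2).  Prime factors of d divide b and contribute only a sign. *)
Lemma quartic_log_ND (s : int) (d dp dq dl : nat) : s = 1 \/ s = -1 ->
  odd d -> (forall q, prime q -> (q %| d)%N -> (q%:Z %| b)%Z) ->
  (forall n, n \in [:: dp; dq; dl] ->
    [/\ n = (\prod_(q <- primes n) q)%N, odd n & p \notin primes n]) ->
  let D := s * (8 * d * dp * dq ^ 2 * dl ^ 3)%N%:Z in
  D%:~R != 0 :> 'F_p /\
  quartic_log (- D%:~R) = b'%:~R + b%:~R *+ ((s == 1) + d./2 + dp./2 + dl./2) +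
    (\sum_(q <- primes dp) th q a b + (\sum_(q <- primes dq) th q a b) *+ 2 +
     (\sum_(q <- primes dl) th q a b) *+ 3).
Proof.
move=> s1 d_odd d_b H D.
have two0 := Fp_two0 p_pr p4.
have [d0 kd] := quartic_log_dvd_b d_odd d_b.
have F n : n \in [:: dp; dq; dl] -> n%:R != 0 :> 'F_p /\
    quartic_log n%:R = b%:~R *+ n./2 + \sum_(q <- primes n) th q a b.
  move=> nin; have [en n_odd pn] := H n nin.
  have sp : all prime (primes n) by apply/allP => q; rewrite mem_primes => /andP[].
  have so : all odd (primes n).
    by apply/allP => q; rewrite mem_primes => /and3P[_ _ qn]; apply: dvdn_odd qn n_odd.
  by have [_ nz e] := quartic_log_list sp so pn; rewrite -en in nz e.
have [p0 kp] := F dp (mem_head _ _).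
have [q0 kq] : dq%:R != 0 :> 'F_p /\
    quartic_log dq%:R = b%:~R *+ dq./2 + \sum_(q <- primes dq) th q a b.
  by apply: F; rewrite !inE eqxx orbT.
have [l0 kl] : dl%:R != 0 :> 'F_p /\
    quartic_log dl%:R = b%:~R *+ dl./2 + \sum_(q <- primes dl) th q a b.
  by apply: F; rewrite !inE eqxx !orbT.
have DE : - D%:~R = (- s)%:~R * (2%:R ^+ 3 * d%:R * dp%:R * dq%:R ^+ 2 * dl%:R ^+ 3) :> 'F_p.
  rewrite /D rmorphM rmorphN mulNr /= -pmulrn !natrM.
  by have -> : 8%:R = 2%:R ^+ 3 :> 'F_p by rewrite -natrX.
have s0 : (- s)%:~R != 0 :> 'F_p.
  by case: s1 => ->; rewrite ?opprK ?rmorphN ?oppr_eq0 oner_eq0.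
have ks : quartic_log (- s)%:~R = b%:~R *+ (s == 1).
  by case: s1 => ->; rewrite ?opprK ?rmorphN /= ?quartic_log_N1 ?mulr1n ?quartic_log1.
split.
  rewrite -oppr_eq0 DE !mulf_neq0 ?expf_neq0 //.
have kk6 x1 x2 x3 x4 x5 x6 : x1 != 0 -> x2 != 0 -> x3 != 0 -> x4 != 0 -> x5 != 0 -> x6 != 0 ->
    quartic_log (x1 * (x2 * x3 * x4 * x5 * x6)) =
      quartic_log x1 + (quartic_log x2 + quartic_log x3 + quartic_log x4 + quartic_log x5 +
        quartic_log x6).
  by move=> *; rewrite !(quartic_logM p_pr p4) ?mulf_neq0.
rewrite DE kk6 ?expf_neq0 // (quartic_logX p_pr p4 I2 3 two0) (quartic_logX p_pr p4 I2 2 q0)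
  (quartic_logX p_pr p4 I2 3 l0).
rewrite quartic_log_2 ks kd kp kq kl.
have e1 : (- b')%:~R *+ 3 = b'%:~R :> 'Z_4.
  rewrite -mulr_natl -[3%:R]/(3%:~R) -rmorphM /=; apply: Z4_int_eq.
  by apply/dvdzP; exists (- b'); ring.
rewrite e1.
have b3 n : b%:~R *+ n *+ 2 = 0 :> 'Z_4 by rewrite mulrnAC b_double mul0rn.
rewrite !mulrnDl b3 add0r [_ *+ 3]mulrSr b3 add0r !mulrnDr.
move: (b%:~R *+ (s == 1)) (b%:~R *+ d./2) (b%:~R *+ dp./2) (b%:~R *+ dl./2) => x1 x2 x3 x4.
move: (\sum_(q <- primes dp) _) (\sum_(q <- primes dq) _) (\sum_(q <- primes dl) _) => y1 y2 y3.
move: (y2 *+ 2) (y3 *+ 3) => z2 z3.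
by ring.
Qed.
End LogFormulas.

(** * Counting residue classes *)

Lemma count_iotaE (P : pred nat) n : count P (iota 0 n) = (\sum_(c < n) P c)%N.
Proof.
rewrite -sum1_count big_mkcond -(big_mkord xpredT (fun c => (P c : nat))) /index_iota subn0.
by apply: eq_bigr => c _; case: (P c).
Qed.

Lemma sum_crt m n (F : nat -> nat -> nat) : coprime m n -> (0 < m)%N -> (0 < n)%N ->
  (\sum_(c < m * n) F (c %% m) (c %% n) = \sum_(x < m) \sum_(y < n) F x y)%N.
Proof.
move=> co m0 n0.
pose h (c : 'I_(m * n)) : 'I_m * 'I_n :=
  (Ordinal (ltn_pmod c m0), Ordinal (ltn_pmod c n0)).
have h_inj : injective h.
  move=> c c' [e1 e2]; apply: val_inj => /=.
  have : (c == c' %[mod m * n])%N.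
    by rewrite chinese_remainder // e1 e2 !eqxx.
  by rewrite !modn_small // => /eqP.
have [g hg gh] : bijective h by apply: inj_card_bij => //; rewrite card_prod !card_ord.
rewrite pair_big /= (reindex h) /=; last by exists g => x _; [apply: hg|apply: gh].
by [].
Qed.

Section LogDistribution.
Variable th : nat -> int -> int -> 'Z_4.
Hypothesis thP : forall q, prime q -> odd q -> local_log q (th q).
Variables (b : int) (r : nat) (e : int).
Hypothesis e1 : e = 1 \/ e = -1.
Hypothesis r4 : (r < 4)%N.

Implicit Type L : seq (nat * nat).
Definition norm_unitL L (c : int) : bool := all (fun x => norm_unit x.1 b c) L.

Definition total_log L (c : int) : 'Z_4 := \sum_(x <- L) th x.1 c b *+ x.2.
Definition moduli_prod L : nat := (\prod_(x <- L) x.1)%N.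

(** A list of pairs (q, w), meaning that the prime q occurs in - D with exponent w mod 4. *)
Definition good_list L : bool := 
  uniq [seq x.1 | x <- L] &&
  all (fun x => [&& prime x.1, odd x.1, ~~ (x.1%:Z %| b)%Z & (x.2 \in [:: 1; 2; 3]%N)]) L.

(** [e] is a sign: the Gaussian integer attached to x is e x + b i, with e depending
    on x mod 4 only. *)
Definition class_log L (k : 'Z_4) (c : nat) : bool :=
  [&& (c %% 4 == r)%N, norm_unitL L c & total_log L (e * c%:Z) == k].

(** The values at 0, 2 and 1 or 3 of the Fourier transform over Z/4 of [class_log_count]
    are [total_count], [quad_sum] and [quart_sum]. *)
Definition total_count L : int := \prod_(x <- L) (4 * (torus_exp x.1)%:Z - 1).

Definition quad_sum L : int := \prod_(x <- L) (if odd x.2 then -1 else 4 * (torus_exp x.1)%:Z -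
  1).
Definition quart_sum L : int := \prod_(x <- L) (-1).

Definition class_log_count L (k : 'Z_4) : nat := (\sum_(c < 4 * moduli_prod L) class_log L k c)%N.

Lemma norm_unit_congr q (c c' : int) : (q%:Z %| c - c')%Z -> norm_unit q b c = norm_unit q b c'.
Proof.
move=> /dvdzP[x ex]; have -> : c = c' + x * q%:Z by rewrite -ex addrC subrK.
congr (~~ _).
have -> : (c' + x * q%:Z) ^+ 2 + b ^+ 2 = (x * (2 * c' + x * q%:Z)) * q%:Z + (c' ^+ 2 +
  b ^+ 2) by ring.
by rewrite rpredDl // dvdz_mull.
Qed.

Lemma dvdz_modn_sub (q m c : nat) : (q %| m)%N -> (q%:Z %| c%:Z - (c %% m)%N%:Z)%Z.
Proof.
move=> qm; rewrite {1}(divn_eq c m) PoszD addrK PoszM dvdz_mull //.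
Qed.

Lemma norm_unitL_mod L (c : nat) : good_list L ->
  norm_unitL L c = norm_unitL L (c %% (4 * moduli_prod L))%N.
Proof.
move=> /andP[_ gL]; apply: eq_in_all => x xL; apply: norm_unit_congr; apply: dvdz_modn_sub.
by rewrite dvdn_mull // /moduli_prod (big_rem x) //= dvdn_mulr.
Qed.

Lemma total_log_mod L (f : int) (c : nat) : good_list L ->
  total_log L (f * c%:Z) = total_log L (f * (c %% (4 * moduli_prod L))%N%:Z).
Proof.
move=> /andP[_ gL]; apply: eq_big_seq => x xL; congr (_ *+ _).
have /and4P[q_pr q_odd _ _] := allP gL x xL.
apply: (ll_congr (thP q_pr q_odd)); rewrite -mulrBr dvdz_mull //; apply: dvdz_modn_sub.
by rewrite dvdn_mull // /moduli_prod (big_rem x) //= dvdn_mulr.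
Qed.

Lemma class_log_mod L k c : good_list L -> class_log L k c =
  class_log L k (c %% (4 * moduli_prod L)).
Proof.
move=> gL; rewrite /class_log -(norm_unitL_mod c gL) -(total_log_mod e c gL).
by rewrite modn_dvdm // dvdn_mulr.
Qed.

(** The count is symmetric in the sign of the log, by [ll_opp]. *)
Lemma count_signed q (k : 'Z_4) : prime q -> odd q -> ~~ (q%:Z %| b)%Z ->
  (\sum_(c < q) (norm_unit q b c && (th q (e * c%:Z)%R b == k)) = torus_exp q - (k == 0%R))%N.
Proof.
move=> q_pr q_odd qb; have H := thP q_pr q_odd.
case: e1 => ->.
  rewrite -(ll_count H k qb) count_iotaE; apply: eq_bigr => c _.
  by rewrite mul1r.
have -> : (k == 0) = (- k == 0) by rewrite oppr_eq0.
rewrite -(ll_count H (- k) qb) count_iotaE; apply: eq_bigr => c _.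
rewrite mulN1r; case: (boolP (norm_unit q b c)) => //= ac.
by rewrite (ll_opp H) // eqr_oppLR.
Qed.

(** By the Chinese remainder theorem the logs at q and at the other primes are
    independent; sum over the value j of the log at q. *)
Lemma class_log_count_cons q w L k : good_list ((q, w) :: L) ->
  (class_log_count ((q, w) :: L) k = \sum_(j : 'Z_4) (torus_exp q - (j == 0%R)) *
    class_log_count L (k - j *+ w)%R)%N.
Proof.
move=> gqL; have /andP[/= /andP[qL uL] /andP[/and4P[q_pr q_odd qb w3] aL]] := gqL.
have gL : good_list L by rewrite /good_list uL.
have modE : (4 * moduli_prod ((q, w) :: L) = 4 * moduli_prod L * q)%N.
  by rewrite /moduli_prod big_cons /= mulnCA mulnC.
have M0 : (0 < 4 * moduli_prod L)%N.
  rewrite muln_gt0 /= /moduli_prod; elim: L aL {uL qL gL gqL modE} => [|x L IH] /=;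
    first by rewrite big_nil.
  by case/andP => /andP[x_pr _] aL; rewrite big_cons muln_gt0 prime_gt0 // IH.
have co : coprime (4 * moduli_prod L) q.
  rewrite coprimeMl (_ : coprime 4 q) /=; last first.
    by rewrite (_ : 4 = 2 ^ 2)%N // coprimeXl // coprime2n.
  rewrite /moduli_prod; elim: L aL qL {uL gL gqL modE M0} => [|x L IH] /=;
    first by rewrite big_nil coprime1n.
  case/andP => /andP[x_pr _] aL; rewrite in_cons negb_or => /andP[qx qL].
  by rewrite big_cons coprimeMl IH // andbT prime_coprime // dvdn_prime2 // eq_sym.
pose G (x y : nat) : bool := norm_unit q b y && class_log L (k - th q (e * y%:Z) b *+ w) x.
have PE c : class_log ((q, w) :: L) k c = G (c %% (4 * moduli_prod L))%N (c %% q)%N.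
  rewrite /G -class_log_mod // {1}/class_log /= /total_log big_cons /=.
  have qd : (q%:Z %| c%:Z - (c %% q)%N%:Z)%Z by exact: dvdz_modn_sub.
  rewrite -(norm_unit_congr qd).
  have -> : th q (e * (c %% q)%N%:Z) b = th q (e * c%:Z) b.
    apply/esym/(ll_congr (thP q_pr q_odd)); by rewrite -mulrBr dvdz_mull.
  have key (F t : 'Z_4) : (t + F == k) = (F == k - t).
    by rewrite [RHS]eq_sym subr_eq [RHS]eq_sym addrC.
  rewrite /class_log -/(total_log L _) key.
  by case: (norm_unit q b c); case: (c %% 4 == r)%N.
transitivity (\sum_(c < 4 * moduli_prod L * q) G (c %% (4 * moduli_prod L)) (c %% q))%N.
  by rewrite /class_log_count modE; apply: eq_bigr => c _; rewrite PE.
rewrite (sum_crt (fun x y => G x y : nat) co M0 (prime_gt0 q_pr)) exchange_big /=.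
transitivity (\sum_(y < q) \sum_(j : 'Z_4) (norm_unit q b y && (th q (e * y%:Z)%R b == j)) *
  class_log_count L (k - j *+ w)%R)%N.
  apply: eq_bigr => y _; rewrite (bigD1 (th q (e * y%:Z) b)) //= eqxx andbT.
  rewrite [X in (_ + X)%N]big1 ?addn0; last by move=> j /negbTE; rewrite eq_sym => ->;
    rewrite andbF.
  by rewrite /class_log_count big_distrr /=; apply: eq_bigr => x _; rewrite mulnb.
rewrite exchange_big /=; apply: eq_bigr => j _.
by rewrite -big_distrl /= count_signed.
Qed.

Lemma sum_Z4 (V : nmodType) (f : 'Z_4 -> V) :
  \sum_(j : 'Z_4) f j = f 0 + f 1 + f 2%:R + f 3%:R.
Proof.
rewrite !big_ord_recl big_ord0 addr0 !addrA.
by congr (f _ + f _ + f _ + f _); apply: val_inj.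
Qed.

(** Fourier inversion on Z/4.  In the induction step of weight w one adds [torus_exp q] times the
    previous counts at all k - j w, where the nontrivial frequencies not killed by w cancel, and
    subtracts once the previous count at k. *)
Lemma class_log_count_formula L k : good_list L ->
  4 * (class_log_count L k)%:Z = total_count L + re4 (k *+ 2) * quad_sum L +
    2 * re4 k * quart_sum L.
Proof.
elim: L k => [|[q w] L IH] k gqL.
  rewrite /class_log_count /moduli_prod big_nil muln1 /total_count /quad_sum /quart_sum
    !big_nil !mulr1.
  have -> : (\sum_(c < 4) class_log [::] k c = (k == 0%R))%N.
    rewrite (bigD1 (Ordinal r4)) //= {1}/class_log /= /total_log big_nil modn_small // eqxx /=
      [0 == k]eq_sym.
    rewrite big1 ?addn0 // => c; rewrite /class_log -val_eqE /= modn_small // => /negbTE -> //.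
  by case: (Z4_cases k) => ->.
have /andP[/= /andP[qL uL] /andP[/and4P[q_pr q_odd qb w3] aL]] := gqL.
have gL : good_list L by rewrite /good_list uL.
rewrite (class_log_count_cons k gqL).
rewrite /total_count /quad_sum /quart_sum !big_cons -/(total_count L) -/(quad_sum L)
  -/(quart_sum L) /=.
have t0 := torus_exp_gt0 q_pr.
rewrite -natz natr_sum; under eq_bigr do rewrite natz PoszM.
rewrite sum_Z4 /= !subn0 -subzn //.
set t : int := (torus_exp q : int).
have eX (x : int) k' : 4 * (x * (class_log_count L k')%:Z) =
  x * (total_count L + re4 (k' *+ 2) * quad_sum L + 2 * re4 k' * quart_sum L).
  by rewrite -IH // mulrCA.
rewrite !mulrDr !eX.
move: (total_count L) (quad_sum L) (quart_sum L) => T E2 E1.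
move: w3; rewrite !inE => /or3P[] /eqP ->; case: (Z4_cases k) => -> /=.
all: rewrite /re4 /=; ring.
Qed.
End LogDistribution.

(** * The trace as a function of a residue class *)

(** The sign s for which s c + b i is primary, that is s c + b = 1 mod 4 when c is odd
    and b even. *)
Definition primary_sign (b : int) (c : nat) : int := if (4 %| c%:Z + b - 1)%Z then 1 else -1.

Definition weighted_primes (dp dq dl : nat) : seq (nat * nat) :=
  [seq (q, 1%N) | q <- primes dp] ++ [seq (q, 2%N) | q <- primes dq] ++
  [seq (q, 3%N) | q <- primes dl].

Lemma total_log_weighted th b dp dq dl a : total_log th b (weighted_primes dp dq dl) a =
  \sum_(q <- primes dp) th q a b + (\sum_(q <- primes dq) th q a b) *+ 2 +
     (\sum_(q <- primes dl) th q a b) *+ 3.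
Proof.
rewrite /total_log /weighted_primes !big_cat !big_map /= -!sumrMnl addrA.
by congr (_ + _ + _); apply: eq_bigr => q _; rewrite mulr1n.
Qed.

Section TraceClass.
Variable th : nat -> int -> int -> 'Z_4.
Hypothesis thP : forall q, prime q -> odd q -> local_log q (th q).
Variables (b b' s : int) (d dp dq dl : nat).
Hypotheses (b0 : b != 0) (b'E : b = 2 * b') (s1 : s = 1 \/ s = -1) (d_odd : odd d).
Hypothesis d_b : forall q, prime q -> (q %| d)%N -> (q%:Z %| b)%Z.
Hypothesis dpql : forall n, n \in [:: dp; dq; dl] -> n = (\prod_(q <- primes n) q)%N /\ odd n.

Let D : int := s * (8 * d * dp * dq ^ 2 * dl ^ 3)%N%:Z.

(** The part of the log of - D that does not depend on x. *)
Definition constant_log : 'Z_4 := b'%:~R + b%:~R *+ ((s == 1) + d./2 + dp./2 + dl./2).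

(** With k the log of - D and a + b i primary, a_p / 2 is a, b, - a, - b for
    k = 0, 1, 2, 3; these differ since a is odd and b is even and nonzero. *)
Lemma trace_class (p x : nat) : prime p -> p%:Z = b ^+ 2 + x%:Z ^+ 2 ->
  (forall n, n \in [:: dp; dq; dl] -> p \notin primes n) ->
  let k := constant_log + total_log th b (weighted_primes dp dq dl) (primary_sign b x * x%:Z) in
  [/\ ~~ (p%:Z %| 2 * D)%Z, (a_ p D == 2 * b) = (k == 1) & (a_ p D == 2 * (- b)) = (k == 3%:R)].
Proof.
move=> p_pr px pn k.
have b2 : (2 %| b)%Z by rewrite b'E dvdz_mulr.
have px' : x%:Z ^+ 2 + b ^+ 2 = p%:Z by rewrite px addrC.
have [p4 [I [I2 jvE ju2 j4]]] := normalized_root p_pr b2 b0 px'.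
have bE : b = - jacobi_im I by rewrite jvE opprK.
pose a := - jacobi_re I.
have ab1 : (4 %| a + b - 1)%Z.
  have -> : a + b - 1 = - (jacobi_re I + jacobi_im I + 1) by rewrite /a bE; ring.
  by rewrite rpredN.
have aE : a = primary_sign b x * x%:Z.
  have := ju2; rewrite -sqrrN -/a => /eqP; rewrite eqf_sqr => /orP[] /eqP e.
    by rewrite /primary_sign -e ab1 mul1r.
  rewrite /primary_sign; case: ifP => H; last by rewrite mulN1r.
  rewrite mul1r; exfalso; move: ab1 H; rewrite e => /dvdzP[y ey] /dvdzP[z zpow].
  move: ey zpow; rewrite b'E; lia.
have [D0 kE] := quartic_log_ND thP p_pr p4 I2 (erefl a) bE b'E ab1 s1 d_odd d_b
  (fun n nin => And3 (dpql nin).1 (dpql nin).2 (pn n nin)).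
rewrite -/D in D0 kE.
have kE' : quartic_log I (- D%:~R) = k.
  by rewrite kE /k /constant_log total_log_weighted -aE.
have two0 := Fp_two0 p_pr p4.
have [w ew] : exists w, a = 4 * w + 1 - 2 * b'.
  by move: ab1 => /dvdzP[w ew]; exists w; move: ew; rewrite b'E; lia.
split.
- rewrite -(intr_pchar_eq0 _ (pchar_Fp p_pr)) rmorphM /= mulf_neq0 //.
- rewrite (trace_quartic_log p_pr p4 I2 D0) kE'.
  rewrite -[jacobi_re I]opprK -/a -[jacobi_im I]opprK -bE.
  have b'0 : b' != 0 by apply: contraNneq b0 => z; rewrite b'E z mulr0.
  move: ew b'0 b'E; clear; move: k a => k a ew b'0 ->.
  case: (Z4_cases k) => ->; rewrite /re4 /im4 /=.
  - have -> : (0 == 1 :> 'Z_4) = false by []. 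
    lia.
  - have -> : (1 == 1 :> 'Z_4) = true by []. 
    lia.
  - have -> : (2%:R == 1 :> 'Z_4) = false by []. 
    lia.
  - have -> : (3%:R == 1 :> 'Z_4) = false by []. 
    lia.
- rewrite (trace_quartic_log p_pr p4 I2 D0) kE'.
  rewrite -[jacobi_re I]opprK -/a -[jacobi_im I]opprK -bE.
  have b'0 : b' != 0 by apply: contraNneq b0 => z; rewrite b'E z mulr0.
  move: ew b'0 b'E; clear; move: k a => k a ew b'0 ->.
  case: (Z4_cases k) => ->; rewrite /re4 /im4 /=.
  - have -> : (0 == 3%:R :> 'Z_4) = false by []. 
    lia.
  - have -> : (1 == 3%:R :> 'Z_4) = false by []. 
    lia.
  - have -> : (2%:R == 3%:R :> 'Z_4) = false by []. 
    lia.
  - have -> : (3%:R == 3%:R :> 'Z_4) = true by []. 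
    lia.
Qed.
End TraceClass.

(** * Hardy-Littlewood asymptotics and infinite products *)

Local Open Scope classical_set_scope.
Local Open Scope ring_scope.

Section Asymptotics.
Variable R : realType.
Definition HL_scale (n : nat) : R := Num.sqrt n%:R / ln n%:R.

Lemma HL_scale_gt0 n : (1 < n)%N -> 0 < HL_scale n.
Proof.
move=> n1; rewrite divr_gt0 // ?sqrtr_gt0 ?ltr0n ?(ltnW n1) // ln_gt0 //.
by rewrite ltr1n.
Qed.

Lemma equiv_cvg (f : nat -> R) (l : R) :
  (f : nat -> R^o) ~_\oo (fun n => l * HL_scale n : R^o) ->
    (fun n => f n / HL_scale n) @ \oo --> l.
Proof.
move=> /eqaddoP H; apply/cvgrPdist_le => /= e e0.
have l1 : 0 < `|l| + 1 by rewrite ltr_wpDl.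
have e1 : 0 < e / (`|l| + 1) by rewrite divr_gt0.
have /= H1 := H _ e1.
near=> n.
have g0 : 0 < HL_scale n by apply: HL_scale_gt0; near: n; exact: nbhs_infty_gt.
have : `|f n - l * HL_scale n| <= e / (`|l| + 1) * `|l * HL_scale n|.
  by near: n; exact: H1.
rewrite distrC normrM (gtr0_norm g0) => H2.
have -> : l - f n / HL_scale n = (l * HL_scale n - f n) / HL_scale n.
  by rewrite mulrBl mulfK // gt_eqF.
rewrite normrM normfV (gtr0_norm g0) ler_pdivrMr //.
apply: (le_trans H2); rewrite mulrA ler_pM2r // -mulrA ler_piMr ?(ltW e0) //.
by rewrite ler_pdivrMl // mulr1 lerDl.
Unshelve. all: by end_near. Qed.

Lemma equiv0_eq0 (f : nat -> R) (g : nat -> R) :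
  (f : nat -> R^o) ~_\oo (fun n => 0 * g n : R^o) -> \forall n \near \oo, f n = 0.
Proof.
move=> /eqaddoP H; have /= H1 := H 1 ltr01.
near=> n.
have : `|f n - 0 * g n| <= 1 * `|0 * g n| by near: n; exact: H1.
by rewrite mul0r normr0 mulr0 subr0 normr_le0 => /eqP.
Unshelve. all: by end_near. Qed.

(** With y = n^(1/4), ln n = 4 ln y < 4 y gives sqrt n / ln n > y / 4. *)
Lemma HL_scale_inv_cvg0 : (fun n => (HL_scale n)^-1) @ \oo --> 0.
Proof.
pose y (n : nat) : R := Num.sqrt (Num.sqrt n%:R).
have yg n : (1 < n)%N -> y n / 4 <= HL_scale n.
  move=> n1; have n0 : 0 < n%:R :> R by rewrite ltr0n ltnW.
  have s0 : 0 < Num.sqrt n%:R :> R by rewrite sqrtr_gt0.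
  have y0 : 0 < y n by rewrite sqrtr_gt0.
  have yy : y n ^+ 2 = Num.sqrt n%:R by rewrite sqr_sqrtr // ltW.
  have y4 : n%:R = y n ^+ 4.
    by rewrite (_ : 4 = 2 * 2)%N // exprM yy sqr_sqrtr // ltW.
  have l0 : 0 < ln n%:R :> R by rewrite ln_gt0 // ltr1n.
  rewrite /HL_scale ler_pdivlMr // -yy {1}y4 lnXn //.
  have -> : y n / 4 * (ln (y n) *+ 4) = y n * ln (y n).
    by rewrite -[_ *+ 4]mulr_natr; field.
  by rewrite expr2 ler_pM2l // ltW // ln_sublinear.
have ginf : HL_scale n @[n --> \oo] --> +oo.
  apply/cvgryPge => A0; pose A := Num.max A0 0.
  near=> n.
  have n1 : (1 < n)%N by near: n; exact: nbhs_infty_gt.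
  apply: le_trans (yg n n1); rewrite ler_pdivlMr //.
  apply: (@le_trans _ _ (A * 4)); first by rewrite ler_pM2r // le_max lexx.
  have A4 : 0 <= A * 4 by rewrite mulr_ge0 // le_max lexx orbT.
  have nA : (A * 4) ^+ 2 ^+ 2 <= n%:R by near: n; exact: nbhs_infty_ger.
  have := ler_wsqrtr nA; rewrite sqrtr_sqr ger0_norm ?sqr_ge0 // => nA2.
  by have := ler_wsqrtr nA2; rewrite sqrtr_sqr ger0_norm.
by apply/gtr0_cvgV0 => //; near=> n; apply: HL_scale_gt0; near: n; exact: nbhs_infty_gt.
Unshelve. all: by end_near. Qed.
End Asymptotics.

Section EulerProduct.
Variable R : realType.

Definition HLfactor (A Delta : int) (p : nat) : R :=
  if [&& prime p, (2 < p)%N & ~~ (p%:Z %| A)%Z]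
  then 1 - (legendre Delta p)%:~R / (p%:R - 1) else 1.

Lemma HLfactor_neq0 A Delta p : HLfactor A Delta p != 0.
Proof.
rewrite /HLfactor; case: ifP => [/and3P[p_pr p2 _]|_]; last exact: oner_neq0.
have p1 : 2 <= p%:R - 1 :> R.
  by rewrite lerBrDr -[1]/(1%:R) -natrD ler_nat addn1.
have p0 : p%:R - 1 != 0 :> R by rewrite gt_eqF // (lt_le_trans _ p1).
rewrite subr_eq0; apply/eqP => /(congr1 (fun z => z * (p%:R - 1))).
rewrite mul1r divfK // => e.
by move: e; rewrite /legendre; case: ifP => _; [|case: ifP => _] => e; lra.
Qed.

(** Changing finitely many nonzero factors multiplies the limit by a nonzero constant. *)
Lemma prod_tail_cvg (f1 f2 : nat -> R) N0 (l : R) :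
  (forall p, (N0 <= p)%N -> f1 p = f2 p) -> (forall p, f1 p != 0) -> (forall p, f2 p != 0) ->
  (fun n => \prod_(0 <= p < n) f1 p) @ \oo --> l -> l != 0 ->
  exists2 l', l' != 0 & (fun n => \prod_(0 <= p < n) f2 p) @ \oo --> l'.
Proof.
move=> e12 f10 f20 H l0.
pose C := (\prod_(0 <= p < N0) f2 p) / (\prod_(0 <= p < N0) f1 p).
have n1 : \prod_(0 <= p < N0) f1 p != 0 by rewrite prodf_seq_neq0; apply/allP => p _;
  rewrite ?f10 ?f20 implybT.
have n2 : \prod_(0 <= p < N0) f2 p != 0 by rewrite prodf_seq_neq0; apply/allP => p _;
  rewrite ?f10 ?f20 implybT.
exists (C * l); first by rewrite !mulf_neq0 ?invr_neq0.
have HC : (fun n => C * \prod_(0 <= p < n) f1 p) @ \oo --> C * l by apply: cvgMl_tmp.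
apply: cvg_trans HC; apply: near_eq_cvg; near=> n.
have n0 : (N0 <= n)%N by near: n; exact: nbhs_infty_ge.
have cut (f : nat -> R) : \prod_(0 <= p < n) f p =
    \prod_(0 <= p < N0) f p * \prod_(N0 <= p < n) f p by rewrite -big_cat_nat.
rewrite !cut /C mulrA divfK //; congr (_ * _).
by apply: eq_big_nat => p /andP[p0 _]; rewrite e12.
Unshelve. all: by end_near. Qed.

Lemma legendre_sqr (k : int) (p : nat) : prime p -> ~~ (p%:Z %| k)%Z ->
  legendre (-4 * k ^+ 2) p = legendre (-4) p.
Proof.
move=> p_pr pk; rewrite /legendre -!(intr_pchar_eq0 _ (pchar_Fp p_pr)).
have -> : (-4 * k ^+ 2)%:~R = (-4)%:~R * k%:~R ^+ 2 :> 'F_p by rewrite rmorphM rmorphXn.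
have k0 : k%:~R != 0 :> 'F_p by rewrite (intr_pchar_eq0 _ (pchar_Fp p_pr)).
rewrite mulf_eq0 expf_eq0 /= (negbTE k0) orbF; case: ifP => // _.
congr (if _ then _ else _); apply/existsP/existsP => -[x /eqP ex].
  by exists (x / k%:~R); rewrite expr_div_n ex mulfK // expf_neq0.
by exists (x * k%:~R); rewrite exprMn ex.
Qed.

(** For x^2 + 1 a zero constant would make the number of primes represented vanish
    eventually, whereas 2 = 1^2 + 1 is always counted.  A limit that does not exist has
    the default value 0, so that the same argument yields convergence. *)
Lemma HL_base : Hardy_Littlewood R -> exists2 l : R, l != 0 &
  (fun n => \prod_(0 <= p < n) HLfactor 1 (-4) p) @ \oo --> l.
Proof.
move=> HL; have nsq : ~ exists k : int, 0 ^+ 2 - 4 * 1 * 1 = k ^+ 2.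
  by move=> [k e]; have := sqr_ge0 k; rewrite -e.
have H := HL 1 0 1 isT erefl isT nsq.
have pE : (fun n : nat => \prod_(0 <= p < n | [&& prime p, (2 < p)%N & ~~ (p%:Z %| 1)%Z])
         (1 - (legendre (0 ^+ 2 - 4 * 1 * 1) p)%:~R / (p%:R - 1)) : R)
   = (fun n => \prod_(0 <= p < n) HLfactor 1 (-4) p).
  by apply: boolp.funext => n; rewrite big_mkcond.
rewrite /HL_delta pE in H.
set L := lim _ in H.
have L0 : L != 0.
  apply/eqP => L0; rewrite L0 mulr0 in H.
  have /equiv0_eq0 := H => H0.
  have [N _ HN] := H0.
  have := HN (maxn N 3) (leq_maxl _ _) => /eqP; rewrite pnatr_eq0 => /eqP c0.
  have p2 : (2 < maxn N 3)%N by rewrite leq_max orbT.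
  have := card0_eq c0 (Ordinal p2); rewrite inE /= => /negP; apply.
  by apply/asboolP; exists 1%N.
exists L => //; exact: (cvg_inNpoint L0).
Qed.
End EulerProduct.

(** * The constant of a residue class *)

Section Classes.
Variable R : realType.
Hypothesis HL : Hardy_Littlewood R.
Variables (m : nat) (b : int).
Hypotheses (m0 : (0 < m)%N) (m2 : (2 %| m)%N) (b0 : b != 0).

(** Counts the primes (m y + c)^2 + b^2 < n with y >= 0. *)
Definition class_count (c n : nat) : nat :=
  HL_count (m%:Z ^+ 2) (2 * m%:Z * c%:Z) (c%:Z ^+ 2 + b ^+ 2) n.

(** The discriminant of (m y + c)^2 + b^2 is -4 (m b)^2, and the other factors of the
    constant depend on m only. *)
Lemma class_constant : exists2 delta : R, delta != 0 &
  forall c : nat, coprime m (absz (c%:Z ^+ 2 + b ^+ 2)%R) ->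
    (fun n => (class_count c n)%:R / HL_scale R n) @ \oo --> delta.
Proof.
have [l l0 Hl] := HL_base HL.
pose A : int := m%:Z ^+ 2; pose Del : int := -4 * (m%:Z * b) ^+ 2.
have mz : m%:Z != 0 by rewrite eqz_nat -lt0n.
have tail p : (m + absz b + 3 <= p)%N -> HLfactor R 1 (-4) p = HLfactor R A Del p.
  move=> pN; rewrite /HLfactor; case: (boolP (prime p)) => //= p_pr.
  have p2 : (2 < p)%N by lia.
  have pm : ~~ (p %| m)%N by apply/negP => /(dvdn_leq m0); lia.
  have pb : ~~ (p %| absz b)%N by apply/negP => /dvdn_leq; rewrite absz_gt0 b0 => /(_ isT); lia.
  have pA : ~~ (p%:Z %| A)%Z by rewrite dvdzE /A abszX Euclid_dvdX // andbT.
  have p1 : ~~ (p%:Z %| 1)%Z by rewrite dvdzE /= dvdn1; lia.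
  rewrite p2 pA p1 /= /Del legendre_sqr //.
  by rewrite dvdzE abszM Euclid_dvdM // negb_or pm.
have [l' l'0 Hl'] := prod_tail_cvg tail (HLfactor_neq0 R 1 (-4)) (HLfactor_neq0 R A Del) Hl l0.
pose F : R := \prod_(p <- primes `|A|%N | (2 < p)%N) (p%:R / (p%:R - 1)).
have F0 : F != 0.
  rewrite /F prodf_seq_neq0; apply/allP => p; rewrite mem_primes => /andP[p_pr _].
  apply/implyP => p2; have p1 : 1 < p%:R :> R by rewrite ltr1n ltnW.
  by rewrite mulf_neq0 ?invr_neq0 ?subr_eq0 ?gt_eqF // (lt_trans _ p1).
exists (2%:~R / Num.sqrt A%:~R * F * l').
  rewrite !mulf_neq0 ?invr_neq0 ?intr_eq0 //.
  by rewrite sqrtr_eq0 -ltNge ltr0z exprn_gt0 // ltz_nat.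
move=> c co.
set B : int := 2 * m%:Z * c%:Z; set C : int := c%:Z ^+ 2 + b ^+ 2.
have A0 : 0 < A by rewrite exprn_gt0 // ltz_nat.
have gABC : gcdz A (gcdz B C) = 1.
  have cAC : coprimez A C by rewrite /A coprimezXl.
  have := dvdz_gcd; move=> /(_ (gcdz A (gcdz B C)) A C).
  rewrite dvdz_gcdl (dvdz_trans (dvdz_gcdr A _) (dvdz_gcdr B C)) (eqP cAC) /=.
  rewrite dvdz1 => /eqP e; by rewrite -[LHS]gez0_abs ?e.
have C_odd : ~~ (2 %| C)%Z.
  apply/negP => C2; have : (2 %| gcdn m (absz C))%N by rewrite dvdn_gcd m2.
  by rewrite (eqP co).
have parity : ~~ ((2 %| A + B)%Z && (2 %| C)%Z) by rewrite (negbTE C_odd) andbF.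
have DelE : B ^+ 2 - 4 * A * C = Del by rewrite /B /A /C /Del; ring.
have nsq : ~ exists k : int, B ^+ 2 - 4 * A * C = k ^+ 2.
  rewrite DelE => -[k e]; have := sqr_ge0 k; rewrite -e /Del mulNr oppr_ge0 pmulr_rle0 //.
  by rewrite exprn_even_le0 //= mulf_eq0 (negbTE mz) (negbTE b0).
have := HL A0 gABC parity nsq => /equiv_cvg.
rewrite /class_count -/A -/B -/C.
have -> // : HL_delta R A B C = 2%:~R / Num.sqrt A%:~R * F * l'.
rewrite /HL_delta DelE; congr (_ / _ * _ * _).
- have AB2 : (2 %| A + B)%Z.
    rewrite rpredD //; last by rewrite /B -mulrA dvdz_mulr.
    by rewrite /A expr2 dvdz_mulr.
  have -> : gcdz 2 (A + B) = 2 by rewrite (gcdz_idPl AB2).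
  by [].
- rewrite /F big_seq_cond [RHS]big_seq_cond; apply: eq_bigl => p.
  case: (boolP (p \in primes `|A|%N)) => //; rewrite !andTb mem_primes => /and3P[p_pr _ pA].
  case: (2 < p)%N => //; rewrite !andTb; move: pA; rewrite /A abszX Euclid_dvdX // andbT => pm.
  by rewrite /B mulrAC dvdz_mull // dvdzE.
- rewrite -(cvg_lim _ Hl') //; apply: (congr1 (fun u : nat -> R => lim (u @ \oo))).
  apply: boolp.funext => n; by rewrite big_mkcond.
Qed.

(** A common prime factor of m and c^2 + b^2 divides every prime in the class. *)
Lemma class_count_le1 (c n : nat) : ~~ coprime m (absz (c%:Z ^+ 2 + b ^+ 2)%R) ->
  (class_count c n <= 1)%N.
Proof.
move=> nco; set g := gcdn m (absz (c%:Z ^+ 2 + b ^+ 2)%R) in nco *.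
have g1 : (1 < g)%N by rewrite ltn_neqAle eq_sym nco gcdn_gt0 m0.
pose l := pdiv g; have l_pr : prime l by exact: pdiv_prime.
have lm : (l %| m)%N := dvdn_trans (pdiv_dvd g) (dvdn_gcdl _ _).
have lC : (l %| absz (c%:Z ^+ 2 + b ^+ 2)%R)%N := dvdn_trans (pdiv_dvd g) (dvdn_gcdr _ _).
rewrite /class_count /HL_count; apply/card_le1_eqP => p.
have key (p' : 'I_n) : prime p' && `[< exists x : nat, (p' : nat)%:Z = m%:Z ^+ 2 * x%:Z ^+ 2
     + 2 * m%:Z * c%:Z * x%:Z + (c%:Z ^+ 2 + b ^+ 2) >] -> (p' : nat) = l.
  case/andP => p_pr /asboolP [x ex].
  have : (l%:Z %| (p' : nat)%:Z)%Z.
    rewrite ex; apply: rpredD; last by rewrite dvdzE.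
    apply: rpredD; first by rewrite expr2 -!mulrA dvdz_mulr // dvdzE.
    by rewrite -!mulrA dvdz_mull // dvdz_mulr // dvdzE.
  by rewrite dvdzE /= dvdn_prime2 // => /eqP.
by move=> q; rewrite !inE => /key pl /key ql; apply: val_inj; rewrite /= pl ql.
Qed.
End Classes.

(** * Equidistribution among residue classes *)

Lemma cvg_bigsum (R : realType) (I : Type) (s : seq I) (f : I -> nat -> R) (l : I -> R) :
  (forall i, (fun n => f i n) @ \oo --> l i) ->
  (fun n => \sum_(i <- s) f i n) @ \oo --> \sum_(i <- s) l i.
Proof.
move=> H; elim: s => [|i s IH].
  rewrite big_nil (_ : (fun n => _) = fun=> 0); first exact: cvg_cst.
  by apply: boolp.funext => n; rewrite big_nil.
rewrite big_cons (_ : (fun n => _) = (fun n => f i n + \sum_(j <- s) f j n)).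
  by apply: cvgD.
by apply: boolp.funext => n; rewrite big_cons.
Qed.

Section Ratio.
Variable R : realType.
Hypothesis HL : Hardy_Littlewood R.
Variables (m : nat) (b : int).
Hypotheses (m0 : (0 < m)%N) (m2 : (2 %| m)%N) (b0 : b != 0).

Definition in_class (c p : nat) : bool := prime p && `[< exists x : nat,
  p%:Z = m%:Z ^+ 2 * x%:Z ^+ 2 + 2 * m%:Z * c%:Z * x%:Z + (c%:Z ^+ 2 + b ^+ 2) >].

Definition admissible (c : nat) : bool := coprime m (absz (c%:Z ^+ 2 + b ^+ 2)%R).

Lemma in_classP (c p : nat) : (c < m)%N ->
  reflect (prime p /\ exists2 x : nat, p%:Z = b ^+ 2 + x%:Z ^+ 2 & (x %% m)%N = c) (in_class c p).
Proof.
move=> cm; apply: (iffP andP) => -[p_pr]; last first.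
  move=> [x px xc]; split=> //; apply/asboolP; exists (x %/ m)%N.
  rewrite px {1}(divn_eq x m) xc PoszD PoszM; ring.
move=> /asboolP[x ex]; split=> //; exists (x * m + c)%N.
  by rewrite ex PoszD PoszM; ring.
by rewrite modnMDl modn_small.
Qed.

(** The nonnegative x with p = x^2 + b^2 is unique. *)
Lemma in_Q_classes p : (in_Q b p = \sum_(c < m) in_class c p :> nat)%N.
Proof.
case: (boolP (in_Q b p)) => [/andP[p_pr /asboolP[x px]]|nQ]; last first.
  rewrite big1 // => c _; apply/eqP; rewrite eqb0; apply: contra nQ.
  move=> /(in_classP _ (ltn_ord c))[p_pr [x px _]]; rewrite /in_Q p_pr.
  by apply/asboolP; exists x%:Z.
pose y := absz x; have py : p%:Z = b ^+ 2 + y%:Z ^+ 2 by rewrite px /y abszE real_normK ?num_real.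
rewrite (bigD1 (Ordinal (ltn_pmod y m0))) //= big1 ?addn0.
  have -> // : in_class (y %% m) p.
  by apply/in_classP; [rewrite ltn_pmod|split=> //; exists y].
move=> c nc; apply/eqP; rewrite eqb0; apply: contra nc.
move=> /(in_classP _ (ltn_ord c))[_ [z pz zc]]; apply/eqP/val_inj; rewrite /= -zc.
have : z%:Z ^+ 2 = y%:Z ^+ 2 by apply: (addrI (b ^+ 2)); rewrite -pz.
by move/eqP; rewrite eqrXn2 // => /eqP[->].
Qed.

Lemma card_ordE (P : pred nat) n : #|[pred p : 'I_n | P p]| = (\sum_(p < n) P p)%N.
Proof. by rewrite -sum1_card big_mkcond; apply: eq_bigr => p _; rewrite inE; case: (P p). Qed.

Variables (X S : pred nat).
Hypothesis XS : forall c p, (c < m)%N -> admissible c -> in_class c p -> X p = S c.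

Definition class_part (c n : nat) : nat := (\sum_(p < n) (in_class c p && X p))%N.

Lemma class_countE c n : class_count m b c n = (\sum_(p < n) in_class c p)%N.
Proof. exact: (card_ordE (in_class c)). Qed.

Lemma card_split n : (\sum_(p < n) (in_Q b p && X p) = \sum_(c < m) class_part c n)%N.
Proof.
rewrite exchange_big /=; apply: eq_bigr => p _.
case: (X p); first by rewrite andbT in_Q_classes; apply: eq_bigr => c _; rewrite andbT.
by rewrite andbF big1 // => c _; rewrite andbF.
Qed.

(** In a class c with c^2 + b^2 prime to m the condition holds for all primes or for none; the other
    classes contain at most one prime and are negligible. *)
Lemma class_part_cvg (delta : R) (c : nat) : (c < m)%N ->
  (forall c : nat, coprime m (absz (c%:Z ^+ 2 + b ^+ 2)%R) ->
    (fun n => (class_count m b c n)%:R / HL_scale R n) @ \oo --> delta) ->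
  (fun n => (class_part c n)%:R / HL_scale R n) @ \oo --> (admissible c && S c)%:R * delta.
Proof.
move=> cm Hd; case: (boolP (admissible c)) => adc.
  case: (boolP (S c)) => Sc /=.
    rewrite mul1r (_ : (fun n => _) = (fun n => (class_count m b c n)%:R / HL_scale R n)).
      exact: Hd.
    apply: boolp.funext => n; congr (_%:R / _).
    rewrite class_countE; apply: eq_bigr => p _.
    by case: (boolP (in_class c p)) => //= pc; rewrite (XS cm adc pc) Sc.
  rewrite mul0r (_ : (fun n => _) = fun=> 0); first exact: cvg_cst.
  apply: boolp.funext => n; rewrite /class_part big1 ?mul0r // => p _.
  by case: (boolP (in_class c p)) => //= pc; rewrite (XS cm adc pc) (negbTE Sc).
rewrite /= mul0r.
apply: (squeeze_cvgr (f := fun=> 0) (h := fun n => (HL_scale R n)^-1)); last 2 first.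
- exact: cvg_cst.
- exact: HL_scale_inv_cvg0.
near=> n.
have g0 : 0 < HL_scale R n by apply: HL_scale_gt0; near: n; exact: nbhs_infty_gt.
rewrite divr_ge0 ?ler0n ?(ltW g0) //= ler_pdivrMr // mulVf ?gt_eqF //.
rewrite -[1]/(1%:R) ler_nat (leq_trans _ (class_count_le1 m0 n adc)) //.
rewrite class_countE; apply: leq_sum => p _; by case: (in_class c p); case: (X p).
Unshelve. all: by end_near. Qed.
End Ratio.

(** Sum [class_part_cvg] over the classes and divide; the common constant cancels. *)
Lemma density_classes (R : realType) (m : nat) (b : int) (X S : pred nat) :
  Hardy_Littlewood R -> (0 < m)%N -> (2 %| m)%N -> b != 0 ->
  (forall c p, (c < m)%N -> admissible m b c -> in_class m b c p -> X p = S c) ->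
  (0 < \sum_(c < m) admissible m b c)%N ->
  (fun N : nat => (#|[pred p : 'I_N.+1 | in_Q b p && X p]|)%:R / (card_Q b N)%:R : R) @ \oo -->
  ((\sum_(c < m) (admissible m b c && S c))%N%:R / (\sum_(c < m) admissible m b c)%N%:R : R).
Proof.
move=> HL m0 m2 b0 XS T0.
have [delta d0 Hd] := class_constant HL m0 m2 b0.
have tot (X' S' : pred nat) :
    (forall c p, (c < m)%N -> admissible m b c -> in_class m b c p -> X' p = S' c) ->
    (fun n => (\sum_(p < n) (in_Q b p && X' p))%N%:R / HL_scale R n) @ \oo -->
    ((\sum_(c < m) (admissible m b c && S' c))%N%:R * delta : R).
  move=> XS'; rewrite natr_sum mulr_suml.
  rewrite (_ : (fun n => _) = (fun n => \sum_(c < m) (class_part m b X' c n)%:R / HL_scale R n)).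
    by apply: cvg_bigsum => c; apply: (class_part_cvg m0 XS' (ltn_ord c) Hd).
  by apply: boolp.funext => n; rewrite (card_split b m0) natr_sum mulr_suml.
have H1 := tot X S XS.
have H2 := tot xpredT xpredT (fun _ _ _ _ _ => erefl).
set s1 := (\sum_(c < m) (admissible m b c && S c))%N in H1 *.
have e2 : (\sum_(c < m) (admissible m b c && true) = \sum_(c < m) admissible m b c)%N.
  by apply: eq_bigr => c _; rewrite andbT.
rewrite e2 in H2; set s2 := (\sum_(c < m) admissible m b c)%N in T0 H2 *.
have s2d : s2%:R * delta != 0 by rewrite mulf_neq0 // pnatr_eq0 -lt0n.
have H3 := cvgM H1 (cvgV s2d H2).
have -> : s1%:R / s2%:R = s1%:R * delta * (s2%:R * delta)^-1 :> R.
  have s20 : s2%:R != 0 :> R by rewrite pnatr_eq0 -lt0n.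
  by field; rewrite s20 d0.
rewrite -cvg_shiftS in H3.
set l := _ * _ in H3 *.
have {}H3 : (fun N : nat => ((\sum_(p < N.+1) (in_Q b p && X p))%N%:R / HL_scale R N.+1) *
    ((\sum_(p < N.+1) (in_Q b p && true))%N%:R / HL_scale R N.+1)^-1) @ \oo --> l by exact: H3.
apply: cvg_trans H3; apply: near_eq_cvg; near=> N.
have n1 : (0 < N)%N by near: N; exact: nbhs_infty_gt.
have g0 : HL_scale R N.+1 != 0 by rewrite gt_eqF // HL_scale_gt0.
rewrite (card_ordE (fun p => in_Q b p && X p)) /card_Q (card_ordE (in_Q b)).
have -> : (\sum_(p < N.+1) (in_Q b p && true) = \sum_(p < N.+1) in_Q b p)%N.
  by apply: eq_bigr => p _; rewrite andbT.
by move: (HL_scale R N.+1) g0 => g g0; rewrite [in X in _ * X]invf_div mulrA divfK.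
Unshelve. all: by end_near. Qed.

(** * Densities as quotients of numbers of classes *)

Lemma squarefree_primes n : (0 < n)%N -> squarefree n -> n = (\prod_(q <- primes n) q)%N.
Proof.
move=> n0 sq; rewrite {1}[n]prod_prime_decomp // prime_decompE big_map /=.
apply: eq_big_seq => q; rewrite mem_primes => /and3P[q_pr _ qn].
suff -> : logn q n = 1%N by rewrite expn1.
apply/eqP; rewrite eqn_leq logn_gt0 mem_primes q_pr n0 qn /= andbT leqNgt; apply/negP => l2.
have := sq q; rewrite pfactor_dvdn // => /(_ l2) q1.
by move: q_pr; rewrite q1.
Qed.

Lemma tau_torus_exp q : prime q -> odd q ->
  ((if q %% 4 == 3 then q else q - 2)%N)%:Z = 4 * (torus_exp q)%:Z - 1.
Proof.
move=> q_pr q_odd; have := prime_gt1 q_pr; rewrite /torus_exp.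
by case: (q4_cases q_odd) => q4; rewrite q4 /=; lia.
Qed.

Lemma tau_prod n : odd n -> (tau n)%:Z = \prod_(q <- primes n) (4 * (torus_exp q)%:Z - 1).
Proof.
move=> n_odd; rewrite /tau -natz natr_prod; apply: eq_big_seq => q.
rewrite mem_primes => /and3P[q_pr _ qn]; rewrite natz tau_torus_exp //.
exact: dvdn_odd qn n_odd.
Qed.

Lemma tau_coprime m n : (0 < m)%N -> (0 < n)%N -> coprime m n -> tau (m * n) = (tau m * tau n)%N.
Proof.
move=> m0 n0 co; rewrite /tau -big_cat; apply: perm_big; apply: uniq_perm.
- exact: primes_uniq.
- rewrite cat_uniq !primes_uniq andbT /=; apply/hasPn => q qn; apply/negP => qm.
  move: qn qm; rewrite !mem_primes => /and3P[q_pr _ qn] /and3P[_ _ qm].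
  have : (q %| gcdn m n)%N by rewrite dvdn_gcd qm.
  by rewrite (eqP co) dvdn1 => /eqP q1; move: q_pr; rewrite q1.
- by move=> q; rewrite mem_cat primesM.
Qed.

(** Modulo 2, [q./2] is 1 for q = 3 mod 4 and 0 for q = 1 mod 4, so that [q./2] + 1 counts
    the primes that are 1 or 5 mod 8. *)
Lemma half_parity s : all odd s ->
  odd ((\prod_(q <- s) q)%N./2 + size s) =
  odd (count (fun l => l %% 8 == 1)%N s + count (fun l => l %% 8 == 5)%N s).
Proof.
move=> so; suff [] : odd (\prod_(q <- s) q)%N /\ odd ((\prod_(q <- s) q)%N./2 + size s) =
  odd (count (fun l => l %% 8 == 1)%N s + count (fun l => l %% 8 == 5)%N s) by [].
elim: s so => [|q s IH] /=; first by rewrite !big_nil.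
move=> /andP[q_odd /IH[po e]]; rewrite !big_cons oddM q_odd po; split=> //.
rewrite oddD half_mul // !oddD /=; move: e; rewrite !oddD.
have : (q %% 8 < 8)%N by rewrite ltn_mod.
have -> : odd q./2 = odd ((q %% 8)./2).
  by rewrite {1}(divn_eq q 8); move: (q %/ 8)%N (q %% 8)%N => x y; lia.
have : odd (q %% 8) by rewrite odd_mod.
move: (odd (_./2)) (odd (size s)) (odd (count _ s)) (odd (count _ s)) => u v c1 c5.
move: (q %% 8)%N => r.
by case: r => [|[|[|[|[|[|[|[|]]]]]]]] //= _ _; case: u; case: v; case: c1; case: c5.
Qed.

Section Density.
Variable R : realType.
Hypothesis HL : Hardy_Littlewood R.
Variable th : nat -> int -> int -> 'Z_4.
Hypothesis thP : forall q, prime q -> odd q -> local_log q (th q).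
Variables (b b' s : int) (d dp dq dl : nat).
Hypotheses (b0 : b != 0) (b'E : b = 2 * b') (s1 : s = 1 \/ s = -1) (d_odd : odd d).
Hypothesis d_b : forall q, prime q -> (q %| d)%N -> (q%:Z %| b)%Z.
Hypothesis dpql : forall n, n \in [:: dp; dq; dl] -> n = (\prod_(q <- primes n) q)%N /\ odd n.
Hypothesis dpql_b : forall n q, n \in [:: dp; dq; dl] -> q \in primes n -> ~~ (q%:Z %| b)%Z.
Hypotheses (co1 : coprime dp dq) (co2 : coprime dp dl) (co3 : coprime dq dl).

Let D : int := s * (8 * d * dp * dq ^ 2 * dl ^ 3)%N%:Z.
Let L := weighted_primes dp dq dl.
Let m := (4 * moduli_prod L)%N.

Lemma mem_weighted_primes q w : (q, w) \in L ->
  exists2 n, n \in [:: dp; dq; dl] & q \in primes n /\ w \in [:: 1; 2; 3]%N.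
Proof.
rewrite /L /weighted_primes !mem_cat => /or3P[] /mapP[x xn [-> ->]].
- by exists dp; rewrite ?mem_head.
- by exists dq; rewrite // !inE eqxx orbT.
- by exists dl; rewrite // !inE eqxx !orbT.
Qed.

Lemma primes_mem_weighted n q : n \in [:: dp; dq; dl] -> q \in primes n ->
  exists w, (q, w) \in L.
Proof.
rewrite !inE => /or3P[] /eqP -> qn; [exists 1%N|exists 2%N|exists 3%N];
  rewrite /L /weighted_primes !mem_cat.
- by rewrite map_f.
- by rewrite [X in _ || (X || _)]map_f ?orbT.
- by rewrite [X in _ || (_ || X)]map_f ?orbT.
Qed.

Lemma coprime_disjoint x y q : coprime x y -> q \in primes x -> q \notin primes y.
Proof.
move=> co; rewrite !mem_primes => /and3P[q_pr _ qx]; apply/negP => /and3P[_ _ qy].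
have : (q %| gcdn x y)%N by rewrite dvdn_gcd qx.
by rewrite (eqP co) dvdn1 => /eqP q1; move: q_pr; rewrite q1.
Qed.

Lemma good_weighted_primes : good_list b L.
Proof.
apply/andP; split; last first.
  apply/allP => -[q w] /mem_weighted_primes[n nin [qn wn]] /=.
  have := qn; rewrite mem_primes => /and3P[q_pr _ q_n].
  by rewrite q_pr (dvdn_odd q_n (dpql nin).2) (dpql_b nin qn).
have e w n : [seq x.1 | x <- [seq (q, w : nat) | q <- primes n]] = primes n.
  by rewrite -map_comp map_id.
rewrite /L /weighted_primes !map_cat !e.
rewrite !cat_uniq !primes_uniq /= andbT has_cat negb_or -andbA.
apply/and3P; split.
- by apply/hasPn => q qn; apply: contraL qn; apply: coprime_disjoint.
- by apply/hasPn => q qn; apply: contraL qn; apply: coprime_disjoint.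
- by apply/hasPn => q qn; apply: contraL qn; apply: coprime_disjoint.
Qed.
Let gL := good_weighted_primes.

Lemma moduli_prod_gt0 : (0 < moduli_prod L)%N.
Proof.
rewrite /moduli_prod; have /andP[_ aL] := gL.
elim: (L) aL => [|x M IH] /=; first by rewrite big_nil.
by case/andP => /andP[x_pr _] aM; rewrite big_cons muln_gt0 prime_gt0 // IH.
Qed.

Lemma m_gt0 : (0 < m)%N. Proof. by rewrite muln_gt0 moduli_prod_gt0. Qed.

(** The factor 4 of m forces c to be odd, because b is even. *)
Lemma admissibleE c : admissible m b c = odd c && norm_unitL b L c.
Proof.
rewrite /admissible /m coprimeMl; congr (_ && _).
  rewrite (_ : 4 = 2 ^ 2)%N // coprime_pexpl // coprime2n.
  by rewrite b'E; move: (c) => c'; have := odd_double_half c'; case: (odd c') => /= <-; lia.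
have /andP[_ aL] := gL; rewrite /moduli_prod.
elim: (L) aL => [|x M IH] /=; first by rewrite big_nil coprime1n.
case/andP => /andP[x_pr _] aM; rewrite big_cons coprimeMl IH // prime_coprime //.
Qed.

Lemma primary_sign_mod c : primary_sign b c = primary_sign b (c %% 4)%N.
Proof.
rewrite /primary_sign; congr (if _ then _ else _).
rewrite {1}(divn_eq c 4) PoszD PoszM -!addrA rpredDl // dvdz_mull //.
Qed.

(** The log that the primes dividing [dbar] must contribute for - D to have log [t]. *)
Definition target_log (t : 'Z_4) : 'Z_4 := t - constant_log b b' s d dp dl.

Definition class_hit (t : 'Z_4) (c : nat) : bool :=
  constant_log b b' s d dp dl + total_log th b L (primary_sign b c * c%:Z) == t.

Lemma odd_mod4 c : odd c = (c %% 4 == 1)%N || (c %% 4 == 3)%N.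
Proof. by lia. Qed.

(** The sign is constant on each of the two odd classes mod 4, so these are counted
    separately. *)
Lemma class_hitE t c : (admissible m b c && class_hit t c =
  class_log th b 1 (primary_sign b 1) L (target_log t) c +
    class_log th b 3 (primary_sign b 3) L (target_log t) c :> nat)%N.
Proof.
rewrite admissibleE odd_mod4 /class_hit primary_sign_mod /class_log /target_log.
have key (x y : 'Z_4) : (x + y == t) = (y == t - x).
  by rewrite [RHS]eq_sym subr_eq [RHS]eq_sym addrC.
rewrite key.
case: (c %% 4 =P 1)%N => [->|_] /=; first by rewrite addn0.
by case: (c %% 4 =P 3)%N => [->|_].
Qed.

Lemma primary_sign_cases c : primary_sign b c = 1 \/ primary_sign b c = -1.
Proof. by rewrite /primary_sign; case: ifP; [left|right]. Qed.

Lemma count_hit t : (4 * (\sum_(c < m) (admissible m b c && class_hit t c))%N%:Z =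
  2 * (total_count L + re4 (target_log t *+ 2) * quad_sum L +
    2 * re4 (target_log t) * quart_sum L))%R.
Proof.
have -> : (\sum_(c < m) (admissible m b c && class_hit t c) =
   class_log_count th b 1 (primary_sign b 1) L (target_log t) +
     class_log_count th b 3 (primary_sign b 3) L (target_log t))%N.
  by rewrite /class_log_count -big_split /=; apply: eq_bigr => c _; rewrite class_hitE.
have H1 := class_log_count_formula thP (primary_sign_cases 1) (isT : (1 < 4)%N) (target_log t) gL.
have H3 := class_log_count_formula thP (primary_sign_cases 3) (isT : (3 < 4)%N) (target_log t) gL.
by rewrite PoszD mulrDr H1 H3; ring.
Qed.

Lemma count_adm : ((\sum_(c < m) admissible m b c)%N%:Z = 2 * total_count L)%R.
Proof.
have e : (\sum_(c < m) admissible m b c =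
    \sum_(t : 'Z_4) \sum_(c < m) (admissible m b c && class_hit t c))%N.
  rewrite exchange_big /=; apply: eq_bigr => c _.
  rewrite (bigD1 (constant_log b b' s d dp dl +
    total_log th b L (primary_sign b c * c%:Z))) //= /class_hit eqxx andbT.
  by rewrite big1 ?addn0 // => t /negbTE; rewrite eq_sym => ->; rewrite andbF.
apply: (@mulfI _ (4 : int)) => //.
rewrite e -natz natr_sum mulr_sumr; under eq_bigr do rewrite [X in 4 * X]natz count_hit.
rewrite /target_log (reindex_inj (addIr (constant_log b b' s d dp dl))) /=.
under eq_bigr do rewrite addrK.
rewrite sum_Z4 /re4 /=; ring.
Qed.

Lemma total_countE : total_count L = (tau dp * tau dq * tau dl)%N%:Z.
Proof.
rewrite !PoszM !tau_prod ?(dpql _).2 ?inE ?eqxx ?orbT //.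
by rewrite /total_count /L /weighted_primes !big_cat !big_map /= mulrA.
Qed.

Lemma prodN1 (r : seq nat) : \prod_(q <- r) (-1 : int) = (-1) ^+ size r.
Proof. by rewrite big_const_seq count_predT iter_mulr_1. Qed.

Lemma quad_sumE : quad_sum L = (-1) ^+ (omega dp + omega dl) * (tau dq)%:Z.
Proof.
rewrite tau_prod ?(dpql _).2 ?inE ?eqxx ?orbT //.
by rewrite /quad_sum /L /weighted_primes !big_cat (big_map (fun q => (q,
  1%N))) (big_map (fun q => (q, 2%N))) (big_map (fun q => (q,
    3%N))) /= !prodN1 exprD mulrA mulrAC.
Qed.

Lemma quart_sumE : quart_sum L = (-1) ^+ (omega dp + omega dq + omega dl).
Proof. by rewrite /quart_sum /L /weighted_primes !big_cat (big_map (fun q => (q,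
  1%N))) (big_map (fun q => (q, 2%N))) (big_map (fun q => (q, 3%N))) /= !prodN1 !exprD mulrA. Qed.

Lemma tau_gt0 n : odd n -> (0 < tau n)%N.
Proof.
move=> n_odd; rewrite /tau big_seq prodn_cond_gt0 // => q.
rewrite mem_primes => /and3P[q_pr _ qn]; have q_odd := dvdn_odd qn n_odd.
by have := prime_gt1 q_pr; case: ifP => _; lia.
Qed.

Definition term_C : R := (-1) ^+ (omega dp + omega dq + omega dl) / (tau (dp * dq * dl))%:R.

(** [t = 1] and [t = 3] are the logs of - D for which the trace is 2 b and - 2 b. *)
Lemma class_hit_trace t m' c p :
  (m' = b /\ t = 1) \/ (m' = - b /\ t = 3%:R) ->
  (c < m)%N -> admissible m b c -> in_class m b c p ->
  ~~ (p%:Z %| 2 * D)%Z && (a_ p D == 2 * m') = class_hit t c.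
Proof.
move=> mt cm adc /(in_classP b p cm)[p_pr [x px xc]].
have pn n : n \in [:: dp; dq; dl] -> p \notin primes n.
  move=> nin; apply/negP => pn; have [w wL] := primes_mem_weighted nin pn.
  move: adc; rewrite admissibleE => /andP[_ /allP /(_ _ wL)] /=.
  have pm : (p %| m)%N by rewrite dvdn_mull // /moduli_prod (big_rem _ wL) //= dvdn_mulr.
  rewrite -xc -(norm_unit_congr b (dvdz_modn_sub x pm)) /norm_unit addrC -px.
  by rewrite dvdzz.
have [nD t1 t3] := trace_class thP b0 b'E s1 d_odd d_b dpql p_pr px pn.
rewrite nD /= /class_hit.
have -> : total_log th b L (primary_sign b c * c%:Z) = total_log th b L (primary_sign b x * x%:Z).
  rewrite (total_log_mod thP (primary_sign b x) x gL) -/m xc [primary_sign b x]primary_sign_mod.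
  by rewrite [primary_sign b c]primary_sign_mod -xc modn_dvdm // dvdn_mulr.
by case: mt => -[-> ->]; rewrite ?t1 ?t3.
Qed.

(** The last term is 0 or, up to sign, B, and A occurs with the sign + or -, according to the
    parity of the target log. *)
Lemma has_dens_class m' t : (m' = b /\ t = 1) \/ (m' = - b /\ t = 3%:R) ->
  has_dens D m' (4^-1 * (1 + (re4 (target_log t *+ 2))%:~R * term_A R dp dl
    + 2 * (re4 (target_log t))%:~R * term_C)).
Proof.
move=> mt; set k := target_log t.
have [odp odq odl] : [/\ odd dp, odd dq & odd dl].
  by split; apply: (dpql _).2; rewrite !inE eqxx ?orbT.
have tp := tau_gt0 odp; have tq := tau_gt0 odq; have tl := tau_gt0 odl.
have adm_gt0 : (0 < \sum_(c < m) admissible m b c)%N.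
  rewrite -ltz_nat count_adm total_countE pmulr_rgt0 // ltz_nat !muln_gt0 tp tq tl //.
have m2 : (2 %| m)%N by rewrite dvdn_mulr.
have := density_classes HL m_gt0 m2 b0 (fun c p => class_hit_trace mt) adm_gt0.
rewrite /has_dens.
set s1' := (\sum_(c < m) (admissible m b c && class_hit t c))%N.
set s2' := (\sum_(c < m) admissible m b c)%N.
have Qm p : in_Q m' p = in_Q b p.
  by case: mt => -[-> _] //; rewrite /in_Q sqrrN.
have -> : s1'%:R / s2'%:R = 4^-1 * (1 + (re4 (k *+ 2))%:~R * term_A R dp dl
    + 2 * (re4 k)%:~R * term_C) :> R.
  have e1 := count_hit t; rewrite -/s1' total_countE quad_sumE quart_sumE -/k in e1.
  have e2 := count_adm; rewrite -/s2' total_countE in e2.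
  have {}e1 := congr1 (fun z : int => z%:~R : R) e1.
  have {}e2 := congr1 (fun z : int => z%:~R : R) e2.
  have c12 : coprime (dp * dq) dl by rewrite coprimeMl co2.
  have [p0 q0 l0] : [/\ (0 < dp)%N, (0 < dq)%N & (0 < dl)%N].
    by split; [case: (dp) odp|case: (dq) odq|case: (dl) odl].
  rewrite /term_A /term_C !tau_coprime ?muln_gt0 ?p0 ?q0 ?l0 //.
  have tpR : (tau dp)%:R != 0 :> R by rewrite pnatr_eq0 -lt0n.
  have tqR : (tau dq)%:R != 0 :> R by rewrite pnatr_eq0 -lt0n.
  have tlR : (tau dl)%:R != 0 :> R by rewrite pnatr_eq0 -lt0n.
  move: e1 e2; rewrite !PoszM !(rmorphM, rmorphD, rmorphXn, rmorphN1) /= -!pmulrn.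
  move: ((tau dp)%:R : R) ((tau dq)%:R : R) ((tau dl)%:R : R) tpR tqR tlR => x y z x0 y0 z0.
  move: (s1'%:R : R) (s2'%:R : R) ((re4 (k *+ 2))%:~R : R) ((re4 k)%:~R : R) => u v r2 r1.
  move: ((-1) ^+ (omega dp + omega dl) : R) ((-1) ^+ (omega dp + omega dq + omega dl) : R).
  move=> f1 f2 e1 e2.
  have eu : u = (x * y * z + r2 * (f1 * y) + 2 * r1 * f2) / 2.
    by apply: (@mulfI _ (4 : R)); [rewrite pnatr_eq0|lra].
  have ev : v = 2 * (x * y * z) by rewrite e2.
  by rewrite eu ev; field; rewrite x0 y0 z0.
rewrite (_ : (fun N : nat => (card_Q_trace D m' N)%:R / (card_Q m' N)%:R) =
  (fun N : nat => (#|[pred p : 'I_N.+1 | in_Q b p & ~~ (p%:Z %| 2 * D)%Z && (a_ p D == 2 *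
    m')]|)%:R
    / (card_Q b N)%:R)) //.
apply: boolp.funext => N; congr (_%:R / _%:R).
  by apply: eq_card => p; rewrite !inE Qm.
by apply: eq_card => p; rewrite !inE Qm.
Qed.
End Density.

(** * The logarithm of - D and the closed formulas *)

Local Close Scope classical_set_scope.
Unset Implicit Arguments.
Set Strict Implicit.

Lemma constant_log_2mod8 (b b' s : int) (d dp dl : nat) : b = 2 * b' -> (4 %| b' - 1)%Z ->
  constant_log b b' s d dp dl = 1 + 2%:R *+ odd ((s == 1) + d./2 + dp./2 + dl./2).
Proof.
move=> bE b1; rewrite /constant_log.
have -> : b'%:~R = 1 :> 'Z_4 by apply: (Z4_int_eq (n := 1)).
have -> : b%:~R = 2%:R :> 'Z_4.
  apply: (Z4_int_eq (n := 2)); have -> : b - 2 = 2 * (b' - 1) by rewrite bE; ring.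
  by rewrite dvdz_mull.
congr (1 + _); move: (_ + _ + _ + _)%N => n.
rewrite -{1}[n]odd_double_half -muln2 mulnC mulrnDr mulrnA.
by rewrite (_ : 2%:R *+ 2 = 0 :> 'Z_4) ?mul0rn ?addr0 //; apply: val_inj.
Qed.

Lemma constant_log_4dvd (b b' s : int) (d dp dl : nat) : b = 2 * b' -> (2 %| b')%Z ->
  constant_log b b' s d dp dl = 0 \/ constant_log b b' s d dp dl = 2%:R.
Proof.
move=> bE /dvdzP[j ej]; rewrite /constant_log.
have -> : b%:~R = 0 :> 'Z_4.
  by apply: (Z4_int_eq (n := 0)); rewrite subr0 bE ej; apply/dvdzP; exists j; ring.
rewrite mul0rn addr0 ej rmorphM /=.
by case: (Z4_cases j%:~R) => ->; [left|right|left|right]; apply: val_inj.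
Qed.

(** Reconciles the exponent of -1 in B with the signs between the q and the q*:
    each q = 3 mod 4 in [dp] or [dl] contributes a sign that cancels its local sum -1. *)
Lemma sign_parity (s d dp dq dl : nat) : odd d ->
  (forall n, n \in [:: dp; dl] -> n = (\prod_(q <- primes n) q)%N /\ odd n) ->
  odd (s + d./2 + dp./2 + dl./2 + (omega dp + omega dq + omega dl)) =
  odd s (+) odd (omega_mod8 1 dp + omega_mod8 5 dp + omega_mod8 1 dl + omega_mod8 5 dl
               + omega dq + (d - 1) %/ 2).
Proof.
move=> d_odd H.
have key n : n \in [:: dp; dl] -> odd (n./2 + omega n) = odd (omega_mod8 1 n + omega_mod8 5 n).
  move=> /H[nE n_odd]; rewrite {1}nE /omega half_parity //.
  apply/allP => q; rewrite mem_primes => /and3P[_ _ qn]; exact: dvdn_odd qn n_odd.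
have kp := key dp (mem_head _ _).
have kl : odd (dl./2 + omega dl) = odd (omega_mod8 1 dl + omega_mod8 5 dl).
  by apply: key; rewrite !inE eqxx orbT.
have -> : ((d - 1) %/ 2 = d./2)%N by rewrite divn2; move: d_odd; lia.
rewrite !oddD in kp kl *.
move: kp kl; clear.
move: (odd s) (odd d./2) (odd dp./2) (odd dl./2) (odd (omega dp)) (odd (omega dq)) (odd (omega
  dl)).
move: (odd (omega_mod8 1 dp)) (odd (omega_mod8 5 dp)) (odd (omega_mod8 1 dl)) (odd (omega_mod8
  5 dl)).
by do 11! case.
Qed.

Theorem theorem4p11 (R : realType) (HL : Hardy_Littlewood R)
    (ps qs ls : seq nat) (D beta : int) (d dp dq dl : nat) (dbar : int)
    (* D = +-8 (p_1...p_r) (q_1...q_s)^2 (l_1...l_t)^3 *)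
    (pql_prime : all prime (ps ++ qs ++ ls))
    (pql_odd : all odd (ps ++ qs ++ ls))
    (pql_distinct : uniq (ps ++ qs ++ ls))
    (D_form : eight_form D (\prod_(p <- ps) p)%N (\prod_(q <- qs) q)%N (\prod_(l <- ls) l)%N)
    (beta_neq0 : beta != 0) (beta_even : (2 %| beta)%Z)
    (* D = d * dbar *)
    (D_fact : D = d%:Z * dbar)
    (d_dbar_coprime : coprime d `|dbar|%N)
    (d_gt0 : (0 < d)%N) (d_odd : odd d)
    (d_beta : forall p : nat, prime p -> (p %| d)%N -> (p%:Z %| beta)%Z)
    (dbar_beta : forall p : nat, prime p -> odd p -> (p%:Z %| dbar)%Z -> ~~ (p%:Z %| beta)%Z)
    (* dbar = +-8 dp dq^2 dl^3 *)
    (dbar_form : eight_form dbar dp dq dl)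
    (dpql_gt0 : [&& (0 < dp)%N, (0 < dq)%N & (0 < dl)%N])
    (dpql_odd : [&& odd dp, odd dq & odd dl])
    (dpql_sqfree : [/\ squarefree dp, squarefree dq & squarefree dl])
    (dpql_coprime : [&& coprime dp dq, coprime dp dl & coprime dq dl])
    (dbar_odd_prime : exists p : nat, [/\ prime p, odd p & (p%:Z %| dbar)%Z]) :
  let A : R := term_A R dp dl in
  let B : R := term_B R d dp dq dl in
  (two_exactly 1 beta -> (beta = 2 %[mod 8])%Z ->
     (0 < D -> has_dens D beta (4^-1 * (1 + A - B)) /\
               has_dens D (- beta) (4^-1 * (1 + A + B))) /\
     (D < 0 -> has_dens D beta (4^-1 * (1 + A + B)) /\
               has_dens D (- beta) (4^-1 * (1 + A - B)))) /\
  ((4 %| beta)%Z ->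
     has_dens D beta (4^-1 * (1 - A)) /\ has_dens D (- beta) (4^-1 * (1 - A))).
Proof.
move=> A B.
have [th thP] := local_logs.
have [b' bE] : exists b', beta = 2 * b'.
  by move/dvdzP: beta_even => [x ->]; exists x; rewrite mulrC.
have [s s1 DE] : exists2 s : int, s = 1 \/ s = -1 & D = s * (8 * d * dp * dq ^ 2 * dl ^ 3)%N%:Z.
  by case: dbar_form => e; [exists 1; [left|]|exists (-1); [right|]];
    rewrite // D_fact e !PoszM; ring.
have dbar_dvd n q : n \in [:: dp; dq; dl] -> (q %| n)%N -> (q%:Z %| dbar)%Z.
  move=> nin qn; have : (n%:Z %| dbar)%Z.
    suff : (n%:Z %| 8 * dp%:Z * dq%:Z ^+ 2 * dl%:Z ^+ 3)%Z by case: dbar_form => ->;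
      rewrite ?rpredN.
    move: nin; rewrite !inE => /or3P[] /eqP ->; apply/dvdzP.
    - by exists (8 * dq%:Z ^+ 2 * dl%:Z ^+ 3); ring.
    - by exists (8 * dp%:Z * dq%:Z * dl%:Z ^+ 3); ring.
    - by exists (8 * dp%:Z * dq%:Z ^+ 2 * dl%:Z ^+ 2); ring.
  by apply: dvdz_trans; rewrite dvdzE.
have /and3P[op oq ol] := dpql_odd; have /and3P[p0 q0 l0] := dpql_gt0.
have [sp sq sl] := dpql_sqfree; have /and3P[co1 co2 co3] := dpql_coprime.
have dpql n : n \in [:: dp; dq; dl] -> n = (\prod_(q <- primes n) q)%N /\ odd n.
  rewrite !inE => /or3P[] /eqP ->; split=> //; exact: squarefree_primes.
have dpql_b n q : n \in [:: dp; dq; dl] -> q \in primes n -> ~~ (q%:Z %| beta)%Z.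
  move=> nin; rewrite mem_primes => /and3P[q_pr _ qn].
  apply: dbar_beta => //; first exact: dvdn_odd qn (dpql n nin).2.
  exact: dbar_dvd nin qn.
have main m' t := @has_dens_class R HL th thP beta b' s d dp dq dl beta_neq0 bE s1 d_odd
  d_beta dpql dpql_b co1 co2 co3 m' t.
rewrite -DE in main.
have M1 := main beta 1 (or_introl (conj erefl erefl)).
have M3 := main (- beta) 3%:R (or_intror (conj erefl erefl)).
split.
  move=> _ b8; have b'1 : (4 %| b' - 1)%Z.
    have /dvdzP[k ek] : (8 %| beta - 2)%Z by rewrite -eqz_mod_dvd; apply/eqP.
    by apply/dvdzP; exists k; move: ek; rewrite bE; lia.
  pose N := ((s == 1) + d./2 + dp./2 + dl./2)%N.
  have cE : constant_log beta b' s d dp dl = 1 + 2%:R *+ odd N by exact: constant_log_2mod8.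
  have BE : B * (-1) ^+ (s == 1) = 2 * (-1) ^+ N * term_C R dp dq dl.
    rewrite /B /term_B /term_C mulrAC -!mulrA; congr (2 * _).
    rewrite !mulrA -!exprD; congr (_ / _).
    rewrite -[LHS]signr_odd -[RHS]signr_odd; apply: (congr1 (fun e : bool => (-1) ^+ e)).
    rewrite addnC oddD -(@sign_parity _ _ _ _ _ d_odd) //.
    by move=> n; rewrite !inE => /orP[] /eqP ->; apply: dpql; rewrite !inE eqxx ?orbT.
  have v1 : 4^-1 * (1 + A + B * (-1) ^+ (s == 1)) = 
      4^-1 * (1 + (re4 (target_log beta b' s d dp dl 1 *+ 2))%:~R * A
        + 2 * (re4 (target_log beta b' s d dp dl 1))%:~R * term_C R dp dq dl).
    rewrite BE /target_log cE -[(-1) ^+ N]signr_odd.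
    by case: (odd N); rewrite /re4 /= ?mul1r // rmorphN.
  have v3 : 4^-1 * (1 + A - B * (-1) ^+ (s == 1)) = 
      4^-1 * (1 + (re4 (target_log beta b' s d dp dl 3%:R *+ 2))%:~R * A
        + 2 * (re4 (target_log beta b' s d dp dl 3%:R))%:~R * term_C R dp dq dl).
    rewrite BE /target_log cE -[(-1) ^+ N]signr_odd.
    by case: (odd N); rewrite /re4 /= ?mul1r ?expr0 ?expr1 ?rmorphN ?mulrN ?mulNr ?opprK.
  rewrite -v1 in M1; rewrite -v3 in M3.
  have X0 : 0 < (8 * d * dp * dq ^ 2 * dl ^ 3)%N%:Z.
    by rewrite ltz_nat !muln_gt0 d_gt0 p0 q0 l0.
  split=> Ds.
    have s_1 : s = 1 by case: s1 => // sN; move: Ds; rewrite DE sN; lia.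
    by rewrite s_1 eqxx expr1 mulrN1 ?opprK in M1 M3.
  have s_1 : s = -1 by case: s1 => // sN; move: Ds; rewrite DE sN; lia.
  by rewrite s_1 expr0 mulr1 in M1 M3.
move=> /dvdzP[k ek].
have b'2 : (2 %| b')%Z by apply/dvdzP; exists k; move: ek; rewrite bE; lia.
have cE := constant_log_4dvd beta b' s d dp dl bE b'2.
have v1 : 4^-1 * (1 - A) = 
      4^-1 * (1 + (re4 (target_log beta b' s d dp dl 1 *+ 2))%:~R * A
        + 2 * (re4 (target_log beta b' s d dp dl 1))%:~R * term_C R dp dq dl).
  by case: cE => cE; rewrite /target_log cE /re4 /= mulr0 mul0r addr0 rmorphN mulN1r.
have v3 : 4^-1 * (1 - A) = 
      4^-1 * (1 + (re4 (target_log beta b' s d dp dl 3%:R *+ 2))%:~R * A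
        + 2 * (re4 (target_log beta b' s d dp dl 3%:R))%:~R * term_C R dp dq dl).
  by case: cE => cE; rewrite /target_log cE /re4 /= mulr0 mul0r addr0 rmorphN mulN1r.
by rewrite -v1 in M1; rewrite -v3 in M3; split.
Qed.
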